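(* Let $X=V(f_1,\ldots,f_c)\overset{i}{\hookrightarrow}\mathbb{P}^n$, with $n\ge 3$, be a smooth complete intersection surface of type $(d_1,\ldots,d_c)$ in complex projective space $\mathbb{P}^n$, with all $d_j\ge 2$, and let $d$ be an integer. If $X$ is invariant by a foliation by curves with tangent sheaf $i^{*}\mathcal{O}_{\mathbb{P}^n}(1-d)$, then $$\deg(X)\le\left(\frac{d+n-2}{c}\right)^c.$$ Moreover, when $n=3$, the converse also holds: if $\deg(X)\le d+1$, then $X$ is invariant by a foliation by curves with tangent sheaf $i^{*}\mathcal{O}_{\mathbb{P}^3}(1-d)$.
   Context: A smooth complete intersection surface of type $(d_1,\ldots,d_c)$ in $\mathbb{P}^n$ is a smooth complete intersection $X=V(f_1,\ldots,f_c)\subset\mathbb{P}^n$ of codimension $c=n-2$, where $f_j$ is homogeneous of degree $d_j$; $i:X\to\mathbb{P}^n$ is the inclusion, and $\deg(X)=\prod_{j=1}^c d_j$. $\Theta_X$ is the tangent sheaf of $X$. That $X$ is invariant by a foliation by curves with tangent sheaf $i^{*}\mathcal{O}_{\mathbb{P}^n}(1-d)$ means that $X$ admits a foliation with this tangent sheaf, i.e. a class, modulo nonzero scalars, of a nonzero global section $s\in H^0(X,\Theta_X\otimes i^{*}\mathcal{O}_{\mathbb{P}^n}(d-1))$. *)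

(* Defs.v *)
From HB Require Import structures.
From mathcomp Require Import all_boot all_order all_algebra.
From mathcomp Require Import mpoly complex.
From mathcomp Require Import classical_sets reals.

Set Implicit Arguments.
Unset Strict Implicit.
Unset Printing Implicit Defensive.

Import Order.TTheory GRing.Theory Num.Theory.
Local Open Scope ring_scope.
Local Open Scope classical_set_scope.

(* Subsets of projective space are represented by the sets of homogeneous
   coordinate vectors (nonzero p : 'rV[K]_n.+1) of their points, and functions
   on them by functions of p whose values matter only on those vectors. *)

Definition cone (K : closedFieldType) (n c : nat)
    (f : 'I_c -> {mpoly K[n.+1]}) : set 'rV[K]_n.+1 :=
  [set p : 'rV[K]_n.+1 | p != 0 /\ forall j, (f j).@[p ord0] = 0].

Definition jacobian (K : closedFieldType) (n c : nat)
    (f : 'I_c -> {mpoly K[n.+1]}) (p : 'rV[K]_n.+1) : 'M[K]_(c, n.+1) :=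
  \matrix_(j, k) ((f j)^`M(k)).@[p ord0].

(* X = V(f) is smooth of codimension c, as a scheme, at each of its points:
   this is the Jacobian criterion, in which c plays the role of the
   codimension.  In particular X is reduced, which is why the sheaf of regular
   functions on closed points used below is its structure sheaf. *)
Definition smooth_complete_intersection (K : closedFieldType) (n c : nat)
    (dg : 'I_c -> nat) (f : 'I_c -> {mpoly K[n.+1]}) : Prop :=
  (forall j, f j \is (dg j).-homog) /\
  (forall p, cone f p -> \rank (jacobian f p) = c).

Definition ci_degree (c : nat) (dg : 'I_c -> nat) : nat := (\prod_(j < c) dg j)%N.

Definition zariski_open (K : closedFieldType) (n c : nat)
    (f : 'I_c -> {mpoly K[n.+1]}) (U : set 'rV[K]_n.+1) : Prop :=
  exists2 B : set {mpoly K[n.+1]},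
    (forall h, B h -> exists e : nat, h \is e.-homog) &
    U = [set p : 'rV[K]_n.+1 | cone f p /\ exists2 h, B h & h.@[p ord0] != 0].

Definition chart (K : closedFieldType) (n c : nat)
    (f : 'I_c -> {mpoly K[n.+1]}) (i : 'I_n.+1) : set 'rV[K]_n.+1 :=
  [set p : 'rV[K]_n.+1 | cone f p /\ p ord0 i != 0].

(* phi is a section of O_X over U: locally a quotient of homogeneous
   polynomials of the same degree. *)
Definition regular (K : closedFieldType) (n c : nat)
    (f : 'I_c -> {mpoly K[n.+1]}) (U : set 'rV[K]_n.+1)
    (phi : 'rV[K]_n.+1 -> K) : Prop :=
  forall p, U p ->
    exists (V : set 'rV[K]_n.+1) (e : nat) (g h : {mpoly K[n.+1]}),
      [/\ zariski_open f V, V p & V `<=` U] /\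
      [/\ g \is e.-homog, h \is e.-homog &
          forall q, V q ->
            h.@[q ord0] != 0 /\ phi q = g.@[q ord0] / h.@[q ord0]].

(* Sections over U of the tangent sheaf Theta_X, i.e. K-linear derivations of
   the sheaf of rings O_X restricted to U.  td_local expresses both that
   D V phi depends only on phi on V and that D commutes with restrictions. *)
Record tangent_field (K : closedFieldType) (n c : nat)
    (f : 'I_c -> {mpoly K[n.+1]}) (U : set 'rV[K]_n.+1) : Type := TangentField {
  td :> set 'rV[K]_n.+1 -> ('rV[K]_n.+1 -> K) -> 'rV[K]_n.+1 -> K;
  td_regular : forall V phi,
    zariski_open f V -> V `<=` U -> regular f V phi -> regular f V (td V phi);
  td_local : forall V W phi psi,
    zariski_open f V -> zariski_open f W -> W `<=` V -> V `<=` U ->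
    regular f V phi -> regular f W psi ->
    (forall p, W p -> psi p = phi p) ->
    forall p, W p -> td W psi p = td V phi p;
  td_linear : forall V (a : K) phi psi,
    zariski_open f V -> V `<=` U -> regular f V phi -> regular f V psi ->
    forall p, V p ->
      td V (fun q => a * phi q + psi q) p = a * td V phi p + td V psi p;
  td_leibniz : forall V phi psi,
    zariski_open f V -> V `<=` U -> regular f V phi -> regular f V psi ->
    forall p, V p ->
      td V (fun q => phi q * psi q) p = td V phi p * psi p + phi p * td V psi p
}.

(* Global sections of Theta_X (x) i^*O(m).  On the chart U_i = {x_i != 0} the
   sheaf i^*O(m) is free with generator x_i^m, so such a section is a family
   theta_i (x) x_i^m with theta_i in Theta_X(U_i), whose members agree on the
   overlaps U_i `&` U_j. *)
Record twisted_field (K : closedFieldType) (n c : nat)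
    (f : 'I_c -> {mpoly K[n.+1]}) (m : int) : Type := TwistedField {
  tw :> forall i : 'I_n.+1, tangent_field f (chart f i);
  tw_glue : forall (i j : 'I_n.+1) V phi,
    zariski_open f V -> V `<=` chart f i `&` chart f j -> regular f V phi ->
    forall p, V p ->
      tw i V phi p * (p ord0 i) ^ m = tw j V phi p * (p ord0 j) ^ m
}.

Definition twisted_field_nonzero (K : closedFieldType) (n c : nat)
    (f : 'I_c -> {mpoly K[n.+1]}) (m : int) (s : twisted_field f m) : Prop :=
  exists (i : 'I_n.+1) V phi p,
    [/\ zariski_open f V, V `<=` chart f i, regular f V phi, V p &
        s i V phi p != 0].

(* X admits a foliation by curves with tangent sheaf i^*O(e): a nonzero global
   section of Theta_X (x) i^*O(-e), the foliation being its class modulo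
   nonzero scalars. *)
Definition has_foliation (K : closedFieldType) (n c : nat)
    (f : 'I_c -> {mpoly K[n.+1]}) (e : int) : Prop :=
  exists s : twisted_field f (- e), twisted_field_nonzero s.

(* Main.v *)
Require Import Defs.
From HB Require Import structures.
From mathcomp Require Import all_boot all_order all_algebra.
From mathcomp Require Import mpoly complex.
From mathcomp Require Import boolp classical_sets reals.
From mathcomp Require Import zify ring.
Set Implicit Arguments.
Unset Strict Implicit.
Unset Printing Implicit Defensive.

Import Order.TTheory GRing.Theory Num.Theory.
Local Open Scope classical_set_scope.
Local Open Scope ring_scope.

(** Let [sigma] be the sum of the [d_j - 1]. The first half says that a foliation
    of twist [d - 1] forces [sigma <= d]; the inequality of arithmetic and
    geometric means then bounds the product of the [d_j], whose sum is
    [sigma + c <= d + n - 2].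

    A section of the tangent sheaf twisted by [d - 1], wedged with the Euler field
    [x], becomes a bivector [G] on the cone over [X]. Its coordinates have degree
    [d + 1], do not depend on the chart ([bivec_chart]) and are tangent to the
    equations ([bivec_tangent]); they are given by forms on the ambient space
    ([glue]). On a surface, a bivector on the three-dimensional cone that is
    tangent to the equations is dual to a covector: by way of the volume form of the
    ambient space, [G] is dual to [h /\ df_1 /\ ... /\ df_c] for some row [h]
    ([bivector_division]), the coordinate form of the isomorphism between the
    tangent sheaf and the 1-forms twisted by the anticanonical sheaf. The
    coefficients of [df_1 /\ ... /\ df_c] have degree [sigma], so [h] has degree
    [d + 1 - sigma]. If this is negative, [G] is zero. If it is zero, [h] is a
    constant covector, and [G /\ x = 0] says that the linear form it defines
    vanishes on the cone, so that [h = 0], because the equations have degree at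
    least two ([bivector_degree]). Hence [sigma <= d] ([foliation_degree]).

    Lifting the local covectors to a single [h], like gluing local polynomials to a
    single one, needs the coordinate ring of the cone to have depth three, the
    vanishing of the first cohomology of [O_X(k)]. It appears here as a regular
    sequence of three linear forms, obtained as follows. Homogeneous systems of
    parameters of a polynomial ring are regular sequences ([regular_parameters]),
    by exchanging their entries for linear forms with the help of the
    Nullstellensatz. The coefficients being uncountable, the latter has a short
    proof ([nullstellensatz]). Noether normalization and the Jacobian criterion
    give three linear parameters on the cone ([three_parameters]); with them,
    polynomials that vanish on the cone lie in the ideal of the equations
    ([cone_reduced]), because the equations generate, in its local ring,
    any prime that contains no nonzero polynomial in the parameters
    ([local_generators]).

    For the converse let [F] be the equation of a surface in space, of degree at
    most [d + 1], with a point at which the partial derivative [F_i] is nonzero.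
    The vector field [F_i D_j - F_j D_i], multiplied by a power of a coordinate
    [x_s] to reach degree [d], is tangent to the surface, and for suitable [j]
    and [s] it is not proportional to the Euler field at that point
    ([surface_foliation]). That it acts on quotients of forms on [X] uses once
    more that functions vanishing on [X] lie in the ideal of [F]. *)

(** * Ideals, primes and generated ideals *)

Section Ideals.
Variable A : comNzRingType.
Implicit Types (I P : set A) (u v a : A) (s : seq A).

Record is_ideal I : Prop := IsIdeal {
  ideal0 : I 0;
  idealD : forall u v, I u -> I v -> I (u + v);
  idealMl : forall a u, I u -> I (a * u) }.

Record is_prime P : Prop := IsPrime {
  prime_ideal :> is_ideal P;
  prime1 : ~ P 1;
  primeM : forall u v, P (u * v) -> P u \/ P v }.

Lemma idealN I u : is_ideal I -> I u -> I (- u).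
Proof. by move=> iI Iu; rewrite -mulN1r; apply: idealMl. Qed.

Lemma idealB I u v : is_ideal I -> I u -> I v -> I (u - v).
Proof. by move=> iI Iu Iv; apply: idealD => //; apply: idealN. Qed.

Lemma idealMr I a u : is_ideal I -> I u -> I (u * a).
Proof. by move=> iI Iu; rewrite mulrC; apply: idealMl. Qed.

Lemma ideal_sum I (T : Type) (r : seq T) (Q : pred T) (F : T -> A) :
  is_ideal I -> (forall i, Q i -> I (F i)) -> I (\sum_(i <- r | Q i) F i).
Proof.
move=> iI FI; elim/big_rec: _ => [|i x Qi Ix]; first exact: ideal0.
by apply: idealD => //; apply: FI.
Qed.

Lemma prime_exp P u k : is_prime P -> P (u ^+ k) -> P u.
Proof.
move=> pP; elim: k => [|k IH]; first by rewrite expr0 => /prime1.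
by rewrite exprS => /(primeM pP)[].
Qed.

Lemma prime_prodN P (T : Type) (r : seq T) (F : T -> A) :
  is_prime P -> (forall i, ~ P (F i)) -> ~ P (\prod_(i <- r) F i).
Proof.
move=> pP nF; elim/big_rec: _ => [|i x _ nx]; first exact: prime1.
by move/(primeM pP) => [/nF|].
Qed.

(** An ideal maximal among those that miss a multiplicative set is prime. The last
    clause records its maximality: adding any further [w] makes the ideal meet
    [M]. *)
Lemma prime_avoiding I (M : set A) : is_ideal I ->
  M 1 -> (forall u v, M u -> M v -> M (u * v)) -> (forall u, I u -> ~ M u) ->
  exists P, [/\ is_prime P, forall u, I u -> P u, forall u, P u -> ~ M u &
    forall w, ~ P w -> exists p a, P p /\ M (p + a * w)].
Proof.
move=> iI M1 MM IM.
pose good (J : set A) := J = set0 \/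
  [/\ is_ideal J, forall u, I u -> J u & forall u, J u -> ~ M u].
have [|P [gP Pmax]] := @Zorn_bigcup A good.
  move=> F FG totF.
  have [[J FJ [j Jj]]|noJ] := pselect (exists2 J, F J & exists j, J j); last first.
    left; apply/seteqP; split=> // x [J FJ Jx]; apply: noJ.
    by exists J => //; exists x.
  have gJ K x : F K -> K x ->
      [/\ is_ideal K, forall u, I u -> K u & forall u, K u -> ~ M u].
    by move=> FK Kx; case: (FG K FK) => // K0; move: Kx; rewrite K0.
  right; split.
  - split.
    + by exists J => //; case: (gJ J j FJ Jj) => /ideal0.
    + move=> u v [K1 F1 Ku] [K2 F2 Kv].
      have [i1 _ _] := gJ _ _ F1 Ku; have [i2 _ _] := gJ _ _ F2 Kv.
      case: (totF _ _ F1 F2) => sub.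
        by exists K2 => //; apply: idealD => //; apply: sub.
      by exists K1 => //; apply: idealD => //; apply: sub.
    + move=> a u [K FK Ku]; have [iK _ _] := gJ _ _ FK Ku.
      by exists K => //; apply: idealMl.
  - by move=> u Iu; exists J => //; case: (gJ J j FJ Jj) => _ /(_ _ Iu).
  - by move=> u [K FK Ku]; have [_ _] := gJ _ _ FK Ku; apply.
have [P0|[iP IP PM]] := gP.
  exfalso; apply: (Pmax I); last by right; split.
  rewrite P0; split=> // sub.
  by have := sub 0 (ideal0 iI).
pose add w : set A := [set z | exists p a, P p /\ z = p + a * w].
have addP w : ~ P w -> exists z, add w z /\ M z.
  move=> nw; apply: contrapT => /forallNP noz.
  apply: (Pmax (add w)).
    split=> [z Pz|sub]; first by exists z, 0; rewrite mul0r addr0.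
    apply: nw; apply: sub; exists 0, 1; split; first exact: ideal0.
    by rewrite mul1r add0r.
  right; split.
  - split.
    + by exists 0, 0; split; [exact: ideal0 | rewrite mul0r addr0].
    + move=> _ _ [p [a [Pp ->]]] [q [b [Pq ->]]].
      exists (p + q), (a + b); split; first exact: idealD.
      by rewrite mulrDl addrACA.
    + move=> b _ [p [a [Pp ->]]]; exists (b * p), (b * a); split.
        exact: idealMl.
      by rewrite mulrDr mulrA.
  - by move=> z /IP Pz; exists z, 0; rewrite mul0r addr0.
  - by move=> z az Mz; apply: (noz z).
exists P; split=> //; last first.
  by move=> w /addP[_ [[p [a [Pp ->]]] Mp]]; exists p, a.
split=> //; first by move/PM.
move=> u v Puv; apply: contrapT => /not_orP[nu nv].
have [_ [[p [a [Pp ->]]] M1u]] := addP u nu.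
have [_ [[q [b [Pq ->]]] M1v]] := addP v nv.
apply: (PM ((p + a * u) * (q + b * v))); last exact: MM.
have -> : (p + a * u) * (q + b * v) =
   (q + b * v) * p + (a * u) * q + (a * b) * (u * v) by ring.
by apply: idealD => //; [apply: idealD => //|]; apply: idealMl.
Qed.

(** The ideal generated by a list is presented by recursion, the head modulo the
    tail, because the definition of regular sequences follows the same recursion. *)
Fixpoint inI s u : Prop :=
  if s is a :: s' then exists v, inI s' (u - v * a) else u = 0.

Lemma inI_ideal s : is_ideal (inI s).
Proof.
elim: s => [|a s [I0 ID IM]].
  split; [by []|by move=> u v /= -> ->; rewrite addr0|].
  by move=> b u /= ->; rewrite mulr0.
split; first by exists 0; rewrite mul0r subr0.
- move=> u v [x xP] [y yP]; exists (x + y).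
  have -> : u + v - (x + y) * a = (u - x * a) + (v - y * a) by ring.
  exact: ID.
- move=> b u [x xP]; exists (b * x).
  have -> : b * u - b * x * a = b * (u - x * a) by ring.
  exact: IM.
Qed.

Lemma inI_cons a s u : inI s u -> inI (a :: s) u.
Proof. by move=> su; exists 0; rewrite mul0r subr0. Qed.

Lemma inI_mem s u : u \in s -> inI s u.
Proof.
elim: s => [//|a s IH]; rewrite inE => /predU1P[->|us].
  by exists 1; rewrite mul1r subrr; apply: ideal0; apply: inI_ideal.
exact/inI_cons/IH.
Qed.

Lemma inI_min s I u : is_ideal I -> (forall a, a \in s -> I a) -> inI s u -> I u.
Proof.
move=> iI; elim: s u => [|a s IH] u sI /=; first by move=> ->; apply: ideal0.
move=> [v /IH vI]; rewrite -(subrK (v * a) u); apply: idealD => //.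
  by apply: vI => b bs; apply: sI; rewrite inE bs orbT.
by apply: idealMl => //; apply: sI; rewrite mem_head.
Qed.

Lemma inI_sub s t u : (forall a, a \in s -> inI t a) -> inI s u -> inI t u.
Proof. by move=> st; apply: inI_min => //; apply: inI_ideal. Qed.

Lemma inI_codom (c : nat) (f : 'I_c -> A) u :
  inI (codom f) u <-> exists a : 'I_c -> A, u = \sum_j a j * f j.
Proof.
split=> [|[a ->]]; last first.
  apply: ideal_sum => [|j _]; first exact: inI_ideal.
  by apply: idealMl; [exact: inI_ideal | apply: inI_mem; apply: codom_f].
apply: (inI_min (I := [set u | exists a : 'I_c -> A, u = \sum_j a j * f j])).
  split.
  - by exists (fun _ => 0); rewrite big1 // => j _; rewrite mul0r.
  - move=> _ _ [a ->] [b ->]; exists (fun j => a j + b j).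
    by rewrite -big_split; apply: eq_bigr => j _; rewrite mulrDl.
  - move=> b _ [a ->]; exists (fun j => b * a j).
    by rewrite mulr_sumr; apply: eq_bigr => j _; rewrite mulrA.
move=> _ /codomP[j ->]; exists (fun i => (i == j)%:R).
rewrite (bigD1 j) //= eqxx mul1r big1 ?addr0 // => i /negPf ->.
by rewrite mul0r.
Qed.

End Ideals.

(** * The Nullstellensatz over an uncountable algebraically closed field *)

Section Congruences.
Variables (A : comNzRingType) (I : set A).
Hypothesis iI : is_ideal I.

Lemma ideal_congM (a b c d : A) : I (a - b) -> I (c - d) -> I (a * c - b * d).
Proof.
move=> ab cd; have -> : a * c - b * d = c * (a - b) + b * (c - d) by ring.
by apply: idealD => //; apply: idealMl.
Qed.

Lemma ideal_cong_prod (T : Type) (r : seq T) (F G : T -> A) :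
  (forall i, I (F i - G i)) -> I (\prod_(i <- r) F i - \prod_(i <- r) G i).
Proof.
move=> FG; elim/big_rec2: _ => [|i x y _ xy]; first by rewrite subrr; apply: ideal0.
exact: ideal_congM.
Qed.

Lemma ideal_cong_sum (T : eqType) (r : seq T) (F G : T -> A) :
  (forall i, i \in r -> I (F i - G i)) ->
  I (\sum_(i <- r) F i - \sum_(i <- r) G i).
Proof. by move=> FG; rewrite -sumrB big_seq; apply: ideal_sum. Qed.

Lemma ideal_cong_exp (a b : A) k : I (a - b) -> I (a ^+ k - b ^+ k).
Proof.
move=> ab; elim: k => [|k IH]; first by rewrite subrr; apply: ideal0.
by rewrite !exprS; apply: ideal_congM.
Qed.

Lemma ideal_trans (a b c : A) : I (a - b) -> I (b - c) -> I (a - c).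
Proof. by move=> ab bc; rewrite -(subrKA b); apply: idealD. Qed.

End Congruences.

Section CompCong.
Variables (K : fieldType) (m : nat).
Local Notation S := {mpoly K[m]}.

Lemma comp_mpoly_const (v : 'I_m -> K) (g : S) :
  g \mPo [tuple (v i)%:MP_[m] | i < m] = (g.@[v])%:MP.
Proof.
elim/mpolyind: g => [|c e p _ _ IH]; first by rewrite comp_mpoly0 meval0 mpolyC0.
rewrite comp_mpolyD mevalD mpolyCD IH comp_mpolyZ comp_mpolyX mevalZ mevalX; congr (_ + _).
rewrite mpolyCM -mul_mpolyC rmorph_prod; congr (_ * _).
by apply: eq_bigr => i _; rewrite tnth_mktuple rmorphXn.
Qed.

Lemma comp_mpoly_cong (I : set S) (lq : m.-tuple S) (g : S) : is_ideal I ->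
  (forall i, I ('X_i - tnth lq i)) -> I (g - (g \mPo lq)).
Proof.
move=> iI Il; elim/mpolyind: g => [|c e p _ _ IH].
  by rewrite comp_mpoly0 subrr; apply: ideal0.
rewrite comp_mpolyD comp_mpolyZ comp_mpolyX opprD addrACA; apply: idealD => //.
rewrite -scalerBr -mul_mpolyC; apply: idealMl => //.
rewrite mpolyXE_id; apply: ideal_cong_prod => // i; exact: ideal_cong_exp.
Qed.

End CompCong.

Section LinDep.
Variable K : fieldType.

Lemma wide_dependent (k l : nat) (C : 'M[K]_(k, l)) : (l < k)%N ->
  exists c : 'I_k -> K, (exists j, c j != 0) /\ forall i, \sum_j c j * C j i = 0.
Proof.
move=> lk; have : kermx C != 0.
  by rewrite kermx_eq0 /row_free neq_ltn (leq_ltn_trans (rank_leq_col C) lk).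
case/rowV0Pn => v /sub_kermxP vC v0; exists (v ord0); split.
  apply/existsP; apply: contraNT v0 => /existsPn v0.
  apply/eqP/rowP => j; rewrite mxE; apply/eqP.
  by have := v0 j; rewrite negbK.
by move=> i; have := congr1 (fun w : 'rV_l => w ord0 i) vC; rewrite !mxE.
Qed.

Lemma msize_dependent (m D k : nat) (y : 'I_k -> {mpoly K[m]}) :
  (forall j, (msize (y j) <= D)%N) -> (#|{: 'X_{1..m < D}}| < k)%N ->
  exists c : 'I_k -> K, (exists j, c j != 0) /\ \sum_j c j *: y j = 0.
Proof.
move=> yD /(@wide_dependent _ _
  (\matrix_(j < k, i < #|{: 'X_{1..m < D}}|) (y j)@_(enum_val i : 'X_{1..m < D}))).
move=> [c [c0 cP]]; exists c; split=> //.
apply/mpolyP => e; rewrite mcoeff0 raddf_sum /=.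
have [eD|De] := ltnP (mdeg e) D.
  rewrite -[RHS](cP (enum_rank (BMultinom eD : 'X_{1..m < D}))).
  by apply: eq_bigr => j _; rewrite mxE enum_rankK mcoeffZ.
apply: big1 => j _; rewrite mcoeffZ (memN_msupp_eq0 (p := y j)) ?mulr0 //.
by apply: msize_mdeg_ge; apply: leq_trans De; apply: yD.
Qed.

End LinDep.

Section Nullstellensatz.
Variables (K : closedFieldType) (m : nat).
Local Notation S := {mpoly K[m]}.

(** Stated with finite sets in place of points, since it serves to find an infinite
    fibre of a map from [K] to the natural numbers. *)
Definition uncountable := forall F : nat -> seq K, exists a, forall i, a \notin F i.

Lemma infinite_uniq (T : eqType) (X : set T) :
  (forall s : seq T, exists2 a, X a & a \notin s) ->
  forall k, exists s : seq T, [/\ size s = k, uniq s & forall a, a \in s -> X a].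
Proof.
move=> Xinf; elim=> [|k [s [sk us sX]]]; first by exists [::].
have [a Xa as_] := Xinf s; exists (a :: s); split; rewrite /= ?sk ?as_ //.
by move=> b; rewrite inE => /predU1P[->|/sX].
Qed.

Lemma uncountable_fibre (c : K -> nat) : uncountable ->
  exists d, forall s : seq K, exists2 a, c a = d & a \notin s.
Proof.
move=> hK; apply: contrapT => /forallNP no.
have {}no d : exists s : seq K, forall a, c a = d -> a \in s.
  have /existsNP[s sP] := no d; exists s => a ca.
  by apply: contrapT => /negP nas; apply: sP; exists a.
have [F FP] := choice no; have [a aP] := hK F.
by have /negP := aP (c a); apply; apply: FP.
Qed.

(** [q] splits into linear factors over [K], and a prime that contains a product
    contains a factor. *)
Lemma prime_mpoly_root (P : set S) (q : {poly K}) (i : 'I_m) :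
  is_prime P -> q != 0 -> P (map_poly (@mpolyC m K) q).['X_i] ->
  exists a, P ('X_i - a%:MP).
Proof.
move=> pP q0; have [r ->] := closed_field_poly_normal q.
rewrite map_polyZ hornerZ /= => /(primeM pP)[Pc|].
  exfalso; apply: (prime1 pP).
  have -> : 1 = (lead_coef q)^-1%:MP * (lead_coef q)%:MP :> S.
    by rewrite -mpolyCM mulVf ?lead_coef_eq0.
  exact: (idealMl pP).
rewrite rmorph_prod horner_prod => Pr.
apply: contrapT => /forallNP no; move: Pr.
apply: prime_prodN => // a.
by rewrite rmorphB /= map_polyX map_polyC /= hornerXsubC.
Qed.

(** Modulo [P], a power of [u] is a multiple of each ['X_i - a]. Infinitely many
    [a] give the same exponent and cofactors of the same size, hence a linear
    relation between cofactors; cleared of denominators, it is a polynomial in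
    ['X_i] that lies in [P]. *)
Lemma root_in_prime (P : set S) (u : S) (i : 'I_m) : uncountable ->
  is_prime P -> ~ P u ->
  (forall w, ~ P w -> exists p a k, P p /\ p + a * w = u ^+ k) ->
  exists a, P ('X_i - a%:MP).
Proof.
move=> hK pP nu Pmax; apply: contrapT => /forallNP no.
have inv a : exists pyk : S * S * nat,
    P pyk.1.1 /\ pyk.1.1 + pyk.1.2 * ('X_i - a%:MP) = u ^+ pyk.2.
  by have [p [y [k pyk]]] := Pmax _ (no a); exists (p, y, k).
have [pyk pykP] := choice inv.
pose code a := pickle ((pyk a).2, msize (pyk a).1.2).
have [d dP] := uncountable_fibre code hK.
have [a0 a0d _] := dP [::].
set D := msize (pyk a0).1.2; set N := (pyk a0).2.
have codeE a : code a = d -> (pyk a).2 = N /\ msize (pyk a).1.2 = D.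
  by rewrite -a0d => /(pcan_inj pickleK) [-> ->].
have [s [sk us sd]] := infinite_uniq dP #|{: 'X_{1..m < D}}|.+1.
pose a (j : 'I_#|{: 'X_{1..m < D}}|.+1) := nth 0 s j.
have aN j : (pyk (a j)).2 = N /\ msize (pyk (a j)).1.2 = D.
  by apply: codeE; apply: sd; apply: mem_nth; rewrite sk.
have [c [[j0 cj0] cy]] := @msize_dependent K m D _ (fun j => (pyk (a j)).1.2)
  (fun j => eq_leq (aN j).2) (ltnSn _).
(* The numerator of the linear combination of the fractions [1 / ('X - a j)] with
   coefficients [c j]; it is nonzero at [a j0]. *)
pose q := \sum_j c j *: \prod_(l | l != j) ('X - (a l)%:P).
have q0 : q != 0.
  apply/eqP => q0; have := congr1 (fun r => r.[a j0]) q0.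
  rewrite horner0 horner_sum (bigD1 j0) //= [X in _ + X]big1 ?addr0; last first.
    move=> j jj0; rewrite hornerZ horner_prod (bigD1 j0) 1?eq_sym //=.
    by rewrite hornerXsubC subrr mul0r mulr0.
  rewrite hornerZ => /eqP; rewrite mulf_eq0 (negPf cj0) /= horner_prod.
  rewrite prodf_seq_eq0 => /hasP[l _ /andP[lj0]].
  rewrite hornerXsubC subr_eq0 => /eqP; rewrite /a => /eqP.
  by rewrite nth_uniq ?sk // => /eqP /val_inj /eqP; rewrite eq_sym (negPf lj0).
have [b Pb] : exists b, P ('X_i - b%:MP); last exact: no Pb.
apply: (prime_mpoly_root pP q0).
pose x l : S := 'X_i - (a l)%:MP.
have -> : (map_poly (@mpolyC m K) q).['X_i] =
    \sum_j (c j)%:MP * \prod_(l | l != j) x l.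
  rewrite rmorph_sum horner_sum; apply: eq_bigr => j _.
  rewrite /= map_polyZ hornerZ rmorph_prod horner_prod; congr (_ * _).
  by apply: eq_bigr => l _; rewrite rmorphB /= map_polyX map_polyC /= hornerXsubC.
set Q := \sum_j _.
suff: P (u ^+ N * Q) by case/(primeM pP) => // /(prime_exp pP).
have -> : u ^+ N * Q = \sum_j (pyk (a j)).1.1 * ((c j)%:MP * \prod_(l | l != j) x l).
  suff -> : \sum_j (pyk (a j)).1.1 * ((c j)%:MP * \prod_(l | l != j) x l) =
      u ^+ N * Q - (\prod_l x l) * \sum_j c j *: (pyk (a j)).1.2.
    by rewrite cy mulr0 subr0.
  rewrite !mulr_sumr -sumrB; apply: eq_bigr => j _.
  have [_] := pykP (a j); rewrite (aN j).1 => <-.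
  have -> : \prod_l x l = x j * \prod_(l | l != j) x l by rewrite (bigD1 j).
  by rewrite -mul_mpolyC -/(x j); set X := \prod_(l | _) _; ring.
apply: ideal_sum => [|j _]; first exact: pP.
by apply: idealMr; [exact: pP | case: (pykP (a j))].
Qed.

(** The residue ring of a prime [P] that is maximal among the ideals missing the
    powers of [u] is, after inverting [u], a field of countable dimension over
    [K]. The elements [1 / ('X_i - a)], for uncountably many [a], would be
    linearly dependent, so some ['X_i - a] is in [P] for each [i]. *)
Theorem nullstellensatz (I : set S) (u : S) : uncountable ->
  is_ideal I -> (forall p : 'rV[K]_m, (forall g, I g -> g.@[p ord0] = 0) -> u.@[p ord0] = 0) ->
  exists k, I (u ^+ k).
Proof.
move=> hK iI Iu; apply: contrapT => /forallNP no.
pose M : set S := [set z | exists k, z = u ^+ k].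
have [|_ _ [k ->] [l ->]|z Iz [k zk]|P [pP IP PM Pmax]] := @prime_avoiding _ I M iI.
- by exists 0%N.
- by exists (k + l)%N; rewrite exprD.
- by apply: (no k); rewrite -zk.
have nu : ~ P u by move=> /PM; apply; exists 1%N.
have root i : exists a, P ('X_i - a%:MP).
  apply: (root_in_prime (u := u)) => // w /Pmax[p [a [Pp [k pk]]]].
  by exists p, a, k.
have [v vP] := choice root.
have Pv g : P (g - (g.@[v])%:MP).
  rewrite -comp_mpoly_const; apply: comp_mpoly_cong; first exact: pP.
  by move=> i; rewrite tnth_mktuple.
have vE g : g.@[(\row_i v i) ord0] = g.@[v].
  by apply: meval_eq => i; rewrite mxE.
have uv : u.@[v] = 0.
  rewrite -vE; apply: Iu => g /IP Pg; rewrite vE.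
  apply/eqP/negPn/negP => gv; apply: (prime1 pP).
  have -> : 1 = (g.@[v])^-1%:MP * (g - (g - (g.@[v])%:MP)) :> S.
    by rewrite opprB addrCA subrr addr0 -mpolyCM mulVf.
  by apply: idealMl; [exact: pP | apply: idealB => //; exact: pP].
by apply: nu; have := Pv u; rewrite uv mpolyC0 subr0.
Qed.

End Nullstellensatz.

(** * Homogeneous systems of parameters are regular sequences *)

Section Homogeneous.
Variables (K : closedFieldType) (m : nat).
Local Notation S := {mpoly K[m]}.
Local Notation hcomp e u := (pihomog mdeg e u).
Implicit Types (a b u v w : S) (s : seq S) (p : 'rV[K]_m).

Definition posdeg a := exists2 e, (0 < e)%N & a \is e.-homog.

Definition only_origin s := forall p, (forall a, a \in s -> a.@[p ord0] = 0) -> p = 0.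

Definition nzd s a := forall u, inI s (a * u) -> inI s u.

(** A regular sequence, listed from its last entry to its first. *)
Fixpoint regular_seq s : Prop :=
  if s is a :: s' then nzd s' a /\ regular_seq s' else True.

Lemma homog_scale e a p (t : K) : a \is e.-homog ->
  a.@[(t *: p) ord0] = t ^+ e * a.@[p ord0].
Proof.
move/dhomogP => ha; rewrite !mevalE mulr_sumr !big_seq.
apply: eq_bigr => x /ha <-; rewrite mulrCA; congr (_ * _).
rewrite /= mdegE -prodrXr -big_split; apply: eq_bigr => i _.
by rewrite mxE exprMn.
Qed.

Lemma posdeg_eval0 a : posdeg a -> a.@[(0 : 'rV_m) ord0] = 0.
Proof.
by move=> [e e0 ha]; rewrite -[0](scale0r 0) (homog_scale _ _ ha) expr0n gtn_eqF ?mul0r.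
Qed.

Lemma hcomp_homog e d a : a \is d.-homog -> hcomp e a = if d == e then a else 0.
Proof.
move=> ha; case: eqP => [<-|/eqP de]; first exact: pihomog_dE.
exact: pihomog_ne0 de ha.
Qed.

Lemma hcompM e d v a : a \is d.-homog ->
  hcomp e (v * a) = if (d <= e)%N then hcomp (e - d) v * a else 0.
Proof.
move=> ha; elim/mpolyind: v => [|c x v _ _ IH].
  by rewrite mul0r !pihomog0 mul0r if_same.
rewrite mulrDl !pihomogD mulrDl IH -scalerAl !linearZ /= pihomogX.
have hx : 'X_[x] * a \is (mdeg x + d).-homog by rewrite dhomogM // dhomogX.
rewrite (hcomp_homog _ hx); case: leqP => de; last first.
  by rewrite gtn_eqF ?scaler0 ?addr0 // (leq_trans de) ?leq_addl.
have -> : (mdeg x == e - d)%N = (mdeg x + d == e)%N.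
  by rewrite -(eqn_add2r d) subnK.
by case: eqP => _; rewrite ?scalerAl // !scaler0 mul0r.
Qed.

Lemma hcomp_sum u : u = \sum_(e < msize u) hcomp e u.
Proof. exact: pihomog_partitionE. Qed.

Lemma inI_hcomp s u e : (forall a, a \in s -> posdeg a) -> inI s u -> inI s (hcomp e u).
Proof.
elim: s u e => [|a s IH] u e hs /=; first by move=> ->; rewrite pihomog0.
have [d d0 ha] : posdeg a by apply: hs; rewrite mem_head.
have {}IH u' : inI s u' -> inI s (hcomp e u').
  by apply: IH => b bs; apply: hs; rewrite inE bs orbT.
move=> [v /IH]; rewrite pihomogB (hcompM _ _ ha); case: ifP => _ sv.
  by exists (hcomp (e - d) v).
by exists 0; rewrite mul0r.
Qed.

Lemma ideal_hcomp (I : set S) u : is_ideal I -> (forall e, I (hcomp e u)) -> I u.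
Proof. by move=> iI Iu; rewrite (hcomp_sum u); apply: ideal_sum. Qed.

(** The quotient by [b] can be replaced by its component of degree [e - d]. *)
Lemma inI_cons_homog b s u d e : (forall a, a \in s -> posdeg a) ->
  b \is d.-homog -> u \is e.-homog -> inI (b :: s) u ->
  exists v, [/\ inI s (u - v * b), v \is (e - d).-homog & (e < d)%N -> v = 0].
Proof.
move=> hs hb hu [v /(inI_hcomp e hs)].
rewrite pihomogB (hcompM _ _ hb) (pihomog_dE hu).
case: leqP => de; last by exists 0; rewrite mul0r rpred0.
by exists (hcomp (e - d) v); split=> //; exact: pihomogP.
Qed.

(** If [a * u] is zero modulo [s], then [u] is equal to some [v * b] modulo [s], and
    [a * v] is zero as well; the degree of [v] is smaller, because that
    of [b] is positive. *)
Lemma nzd_drop s a b : (forall a, a \in s -> posdeg a) -> posdeg a -> posdeg b ->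
  nzd (b :: s) a -> nzd s b -> nzd s a.
Proof.
move=> hs [da da0 ha] [db db0 hb] na nb u sau.
apply: ideal_hcomp => [|e]; first exact: inI_ideal.
have : inI s (a * hcomp e u).
  have := inI_hcomp (e + da) hs sau.
  by rewrite mulrC (hcompM _ _ ha) leq_addl addnK mulrC.
have := pihomogP mdeg e u; move: (hcomp e u) => {sau}u.
have is_ := inI_ideal s.
elim/ltn_ind: e u => e IH u hu sau.
have [v [sv hv v0]] := inI_cons_homog hs hb hu (na _ (inI_cons b sau)).
rewrite -(subrK (v * b) u); apply: idealD => //; apply: idealMr => //.
have [de|ed] := leqP db e; last by rewrite v0 //; apply: ideal0.
apply: (IH (e - db)%N) => //; first by rewrite ltn_subrL db0 (leq_trans db0).
apply: nb; have -> : b * (a * v) = a * u - a * (u - v * b) by ring.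
by apply: idealB => //; apply: idealMl.
Qed.

(** Only the regularity of [a] without [b] depends on the grading, by [nzd_drop]. *)
Lemma regular_swap a b s : (forall c, c \in [:: a, b & s] -> posdeg c) ->
  regular_seq [:: a, b & s] -> regular_seq [:: b, a & s].
Proof.
move=> hs [na [nb rs]].
have nsa : nzd s a.
  by apply: nzd_drop na nb => [c cs||]; apply: hs; rewrite !inE ?cs ?eqxx ?orbT.
split=> // u [w sw].
have /na[v sv] : inI (b :: s) (a * w).
  exists u; have -> : a * w - u * b = - (b * u - w * a) by ring.
  by apply: idealN => //; exact: inI_ideal.
exists v; apply: nb; have is_ := inI_ideal s.
have -> : b * (u - v * a) = (b * u - w * a) + a * (w - v * b) by ring.
by apply: idealD => //; apply: idealMl.
Qed.

Lemma nzd_eq s t a : s =i t -> nzd s a -> nzd t a.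
Proof.
move=> st na u; have sub s1 s2 v : s1 =i s2 -> inI s1 v -> inI s2 v.
  by move=> ss; apply: inI_sub => c cs; apply: inI_mem; rewrite -ss.
by move/(sub _ s _ (fsym st))/na; apply: sub.
Qed.

Lemma regular_front s t a : (forall c, c \in s ++ a :: t -> posdeg c) ->
  regular_seq (s ++ a :: t) -> regular_seq (a :: s ++ t).
Proof.
elim: s => // b s IH hs [nb rs]; apply: regular_swap.
  by move=> c cs; apply: hs; move: cs; rewrite !(inE, mem_cat) [X in _ || X]orbCA.
split; last by apply: IH => // c cs; apply: hs; rewrite inE cs orbT.
by apply: nzd_eq nb => c; rewrite !(inE, mem_cat) orbCA.
Qed.

(** A nonzerodivisor may be replaced by any element of which some power of it is a
    multiple: this is how a form is exchanged for a linear one. *)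
Lemma regular_exchange s a b k : inI (b :: s) (a ^+ k) -> regular_seq (a :: s) ->
  regular_seq (b :: s).
Proof.
move=> [v sv] [na rs]; split=> // u sbu; have is_ := inI_ideal s.
have : inI s (a ^+ k * u).
  have -> : a ^+ k * u = u * (a ^+ k - v * b) + v * (b * u) by ring.
  by apply: idealD => //; apply: idealMl.
by elim: k {sv} => [|k IH]; rewrite ?mul1r // exprS -mulrA => /na.
Qed.

Hypothesis hK : uncountable K.

Lemma only_origin_exp s a : only_origin s -> posdeg a -> exists k, inI s (a ^+ k).
Proof.
move=> os ha; apply: nullstellensatz => //; first exact: inI_ideal.
by move=> p ps; rewrite (os p) ?posdeg_eval0 // => c cs; apply: ps; apply: inI_mem.
Qed.

Lemma posdegX i : posdeg 'X_i.
Proof. by exists 1%N; rewrite // dhomogX /= mdeg1. Qed.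

(** The quotient by [s] has finite dimension: all monomials of large degree are
    zero in it. *)
Lemma only_origin_mdeg s : only_origin s ->
  exists N, forall x : 'X_{1..m}, (N <= mdeg x)%N -> inI s 'X_[x].
Proof.
move=> os; have [k kP] := choice (fun i => only_origin_exp os (posdegX i)).
exists (\sum_i k i).+1 => x; rewrite mdegE => kx.
have [i ki] : exists i, (k i <= x i)%N.
  apply/existsP; apply: contraTT kx => /existsPn xk; rewrite -leqNgt.
  by apply: leq_sum => i _; apply: ltnW; rewrite ltnNge; apply: xk.
rewrite mpolyXE_id (bigD1 i) //= -(subnK ki) exprD mulrAC.
by apply: idealMl; first exact: inI_ideal.
Qed.

Lemma msize_lin (T : Type) (r : seq T) (c : T -> K) (y : T -> S) t :
  (forall i, (msize (y i) <= t)%N) -> (msize (\sum_(i <- r) c i *: y i) <= t)%N.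
Proof.
move=> yt; elim/big_rec: _ => [|i x _ xt]; first by rewrite msize0.
apply: leq_trans (msizeD_le _ _) _; rewrite geq_max xt andbT.
exact: leq_trans (msizeZ_le _ _) (yt i).
Qed.

Lemma homog_msize_le t v : v \is t.-homog -> (msize v <= t.+1)%N.
Proof.
move/dhomogP => hv; rewrite msizeE; apply/bigmax_leqP_seq => x xv _.
by have /= -> := hv x xv.
Qed.

(** Since [b] is of positive degree and vanishes with [s] at the origin only,
    the points of the cone [s = 0] with [b = 1] are finitely many: the
    algebra of [s] and [b - 1] is finite-dimensional. *)
Lemma finite_section b s : (forall a, a \in b :: s -> posdeg a) ->
  only_origin (b :: s) ->
  exists D, forall k (y : 'I_k -> S), (D < k)%N ->
    exists c : 'I_k -> K, (exists j, c j != 0) /\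
      inI (b - 1 :: s) (\sum_j c j *: y j).
Proof.
move=> hs os; have [N NP] := only_origin_mdeg os.
set J := inI (b - 1 :: s); have iJ : is_ideal J by exact: inI_ideal.
have [d d0 hb] : posdeg b by apply: hs; rewrite mem_head.
have {}hs a : a \in s -> posdeg a by move=> as_; apply: hs; rewrite inE as_ orbT.
have sJ u : inI s u -> J u by exact: inI_cons.
(* A monomial of degree at least [N] is a multiple of [b] modulo [s], and [b] is
   one: it is congruent to a polynomial of smaller degree. *)
have red x : (N <= mdeg x)%N -> exists v, (msize v <= mdeg x)%N /\ J ('X_[x] - v).
  move=> Nx; have hx : ('X_[x] : S) \is (mdeg x).-homog by rewrite dhomogX.
  have [v [sv hv v0]] := inI_cons_homog hs hb hx (NP x Nx).
  exists v; split.
    case: (leqP d (mdeg x)) => dx; last by rewrite v0 ?msize0.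
    apply: leq_trans (homog_msize_le hv) _.
    by rewrite ltn_subrL d0 (leq_trans d0).
  have -> : 'X_[x] - v = ('X_[x] - v * b) + v * (b - 1) by ring.
  apply: idealD => //; first exact: sJ.
  by apply: idealMl => //; apply: inI_mem; rewrite mem_head.
have small t u : (msize u <= t)%N -> exists w, (msize w <= N)%N /\ J (u - w).
  elim: t u => [|t IH] u ut.
    by exists u; rewrite subrr (leq_trans ut) //; split=> //; apply: ideal0.
  have [tN|Nt] := ltnP t N.
    by exists u; rewrite subrr (leq_trans ut) //; split=> //; apply: ideal0.
  have one x : exists v, x \in msupp u -> (msize v <= t)%N /\ J ('X_[x] - v).
    have [xu|] := boolP (x \in msupp u); last by exists 0.
    have xt : (mdeg x <= t)%N by have := leq_trans (msize_mdeg_lt xu) ut.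
    have [xt'|tx] := ltnP (mdeg x) t.
      by exists 'X_[x]; rewrite msizeX subrr; split=> //; apply: ideal0.
    have [v [vx Jv]] := red x (leq_trans Nt tx).
    by exists v; split=> //; apply: leq_trans vx xt.
  have [v vP] := choice one.
  pose y x := if x \in msupp u then v x else 0.
  have yt x : (msize (y x) <= t)%N.
    by rewrite /y; case: ifP => [/vP[]//|]; rewrite msize0.
  have [w [wN Jw]] := IH _ (msize_lin (msupp u) (fun x => u@_x) yt).
  exists w; split=> //; apply: ideal_trans Jw => //.
  rewrite {1}[u]mpolyE; apply: ideal_cong_sum => // x xu.
  rewrite -scalerBr -mul_mpolyC; apply: idealMl => //.
  by rewrite /y xu; case: (vP x xu).
exists #|{: 'X_{1..m < N}}| => k y Dk.
have [w wP] := choice (fun j => small _ (y j) (leqnn _)).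
have [c [c0 cw]] := msize_dependent (fun j => (wP j).1) Dk.
exists c; split=> //.
have -> : \sum_j c j *: y j = \sum_j c j *: y j - \sum_j c j *: w j.
  by rewrite cw subr0.
apply: (ideal_cong_sum iJ) => j _; rewrite -scalerBr -mul_mpolyC.
by apply: idealMl => //; case: (wP j).
Qed.

(** ** Linear forms *)

Definition lin (a : 'rV[K]_m) : S := \sum_i a ord0 i *: 'X_i.

Lemma lin_is_linear : linear lin.
Proof.
move=> t a b; rewrite /lin scaler_sumr -big_split; apply: eq_bigr => i _.
by rewrite !mxE scalerDl scalerA.
Qed.
HB.instance Definition _ := GRing.isLinear.Build K 'rV[K]_m S _ lin lin_is_linear.

Lemma lin_homog (a : 'rV[K]_m) : lin a \is 1.-homog.
Proof. by apply: rpred_sum => i _; apply: rpredZ; rewrite dhomogX /= mdeg1. Qed.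

Lemma posdeg_lin (a : 'rV[K]_m) : posdeg (lin a).
Proof. by exists 1%N => //; exact: lin_homog. Qed.

Lemma lin_eval (a : 'rV[K]_m) (v : 'I_m -> K) : (lin a).@[v] = \sum_i a ord0 i * v i.
Proof. by rewrite raddf_sum; apply: eq_bigr => i _; rewrite /= mevalZ mevalXU. Qed.

Lemma lin_delta i : lin (delta_mx ord0 i) = 'X_i.
Proof.
rewrite /lin (bigD1 i) //= mxE !eqxx scale1r big1 ?addr0 // => j ji.
by rewrite mxE (negPf ji) andbF scale0r.
Qed.

Lemma inI_lin_eval s u (v : 'I_m -> K) :
  (forall a, a \in s -> a.@[v] = 0) -> inI s u -> u.@[v] = 0.
Proof.
move=> sv; apply: (inI_min (I := [set u | u.@[v] = 0])) => //; split=> /=.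
- exact: meval0.
- by move=> x y xv yv; rewrite mevalD xv yv addr0.
- by move=> x y yv; rewrite mevalM yv mulr0.
Qed.

(** Two linear forms satisfy a nontrivial binary form at the points where
    [s = 0]; replacing them by a linear combination that avoids its
    factors keeps the origin as only common zero. *)
Lemma only_origin_merge b s (a1 a2 : 'rV[K]_m) (L : seq S) :
  (forall a, a \in b :: s -> posdeg a) -> (forall a, a \in L -> posdeg a) ->
  only_origin (b :: s) -> only_origin (lin a1 :: lin a2 :: L ++ s) ->
  exists a : 'rV[K]_m, only_origin (lin a :: L ++ s).
Proof.
move=> hs hL os osL; have [D DP] := finite_section hs os.
have [c [[j0 cj0] cP]] :=
  DP D.+1 (fun j => lin a1 ^+ j * lin a2 ^+ (D - j)) (ltnSn D).
pose q := \poly_(j < D.+1) c (inord j).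
have q0 : q != 0.
  apply: contraNneq cj0 => /(congr1 (fun r : {poly K} => r`_j0)).
  by rewrite coef0 coef_poly ltn_ord inord_val => ->.
have [t tq] := closed_nonrootP _ q0.
exists (a1 - t *: a2) => p pz; apply/eqP/negPn/negP => p0.
have [d d0 hb] : posdeg b by apply: hs; rewrite mem_head.
have bp : b.@[p ord0] != 0.
  apply: contraNneq p0 => bp; apply/eqP/os => a; rewrite inE => /predU1P[->//|as_].
  by apply: pz; rewrite inE mem_cat as_ !orbT.
(* Rescaling [p] brings it to the section [b = 1]. *)
have [r rP] : exists r, r ^+ d * b.@[p ord0] = 1.
  have [r rP] := @solve_monicpoly K d (fun i => if i == 0%N then (b.@[p ord0])^-1 else 0) d0.
  exists r; rewrite rP -(prednK d0) big_ord_recl /= expr0 mulr1 big1 ?addr0 ?mulVf //.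
  by move=> i _; rewrite mul0r.
have r0 : r != 0.
  by apply: contra_eq_neq rP => ->; rewrite expr0n gtn_eqF // mul0r eq_sym oner_neq0.
have vz a : posdeg a -> a.@[p ord0] = 0 -> a.@[(r *: p) ord0] = 0.
  by move=> [e _ ha] ap; rewrite (homog_scale _ _ ha) ap mulr0.
have sz a : a \in L ++ s -> a.@[(r *: p) ord0] = 0.
  move=> aLs; apply: vz; last by apply: pz; rewrite inE aLs orbT.
  move: aLs; rewrite mem_cat => /orP[/hL//|as_].
  by apply: hs; rewrite inE as_ orbT.
set v := (r *: p) ord0 in vz sz.
have lin12 : (lin a1).@[v] = t * (lin a2).@[v].
  have : (lin (a1 - t *: a2)).@[v] = 0.
    by apply: vz; [exact: posdeg_lin | apply: pz; rewrite mem_head].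
  by rewrite linearB linearZ /= mevalB mevalZ => /eqP; rewrite subr_eq0 => /eqP.
have a2v : (lin a2).@[v] = 0.
  have : (\sum_j c j *: (lin a1 ^+ j * lin a2 ^+ (D - j))).@[v] = 0.
    apply: (inI_lin_eval _ cP) => a; rewrite inE => /predU1P[->|as_].
      by rewrite mevalB meval1 (homog_scale _ _ hb) rP subrr.
    by apply: sz; rewrite mem_cat as_ orbT.
  rewrite raddf_sum /=; have -> : \sum_j (c j *: (lin a1 ^+ j * lin a2 ^+ (D - j))).@[v]
      = q.[t] * (lin a2).@[v] ^+ D.
    rewrite horner_poly mulr_suml; apply: eq_bigr => j _.
    rewrite inord_val mevalZ mevalM !rmorphXn /= lin12 exprMn -!mulrA; congr (_ * (_ * _)).
    by rewrite -exprD subnKC // -ltnS.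
  move/eqP; rewrite mulf_eq0 (negPf (tq : q.[t] != 0)) /=.
  by rewrite expf_eq0 => /andP[_ /eqP].
have /eqP : r *: p = 0.
  apply: osL => a; rewrite !inE => /or3P[/eqP->|/eqP->|/sz//].
    by rewrite -/v lin12 a2v mulr0.
  exact: a2v.
by rewrite scaler_eq0 (negPf r0) (negPf p0).
Qed.

(** The coordinates together vanish at the origin only; merging them two at a time
    leaves a single linear form. *)
Lemma linear_parameter b s : (forall a, a \in b :: s -> posdeg a) ->
  only_origin (b :: s) -> exists a : 'rV[K]_m, only_origin (lin a :: s).
Proof.
move=> hs os.
suff H (L : seq 'rV[K]_m) : only_origin (map lin L ++ s) -> exists a : 'rV[K]_m, only_origin (lin a :: s).
  apply: (H [seq delta_mx ord0 i | i : 'I_m]) => p pz; apply/rowP => i; rewrite mxE.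
  have := pz 'X_i; rewrite mevalXU; apply; rewrite mem_cat -lin_delta; apply/orP; left.
  by apply: map_f; apply/mapP; exists i; rewrite ?mem_enum.
have [l] := ubnP (size L); elim: l L => // l IH [|a1 [|a2 L]] /=.
- by move=> _ os0; exists 0 => p pz; apply: os0 => a as_; apply: pz; rewrite inE as_ orbT.
- by move=> _ os1; exists a1.
rewrite !ltnS => Ll /(only_origin_merge hs _ os)[|a aP]; last exact: (IH (a :: L)).
by move=> _ /mapP[a _ ->]; exact: posdeg_lin.
Qed.

End Homogeneous.

Section LinearForms.
Variables (K : closedFieldType) (m : nat).
Local Notation S := {mpoly K[m]}.
Hypothesis hK : uncountable K.
Implicit Types (l : 'rV[K]_m) (L : seq 'rV[K]_m) (s : seq S).

Lemma lin_inj l : lin l = 0 -> l = 0.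
Proof.
move=> l0; apply/rowP => i; rewrite mxE.
have := congr1 (fun u => u.@[fun j => (j == i)%:R]) l0.
rewrite meval0 lin_eval (bigD1 i) //= eqxx mulr1 big1 ?addr0 // => j /negPf ->.
by rewrite mulr0.
Qed.

Definition rows L : 'M[K]_(size L, m) := \matrix_(i < size L) L`_i.

Definition linsub k (M : 'M[K]_(k, m)) : k.-tuple S := [tuple lin (row i M) | i < k].

Lemma lin_comp k (M : 'M[K]_(k, m)) (l : 'rV[K]_k) : lin l \mPo linsub M = lin (l *m M).
Proof.
rewrite /lin raddf_sum /=; under eq_bigr => i _.
  rewrite comp_mpolyZ comp_mpolyXU -tnth_nth tnth_mktuple -/(lin _) -linearZ; over.
rewrite -linear_sum /=; apply: eq_bigr => j _; congr (_ *: _).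
by rewrite summxE mxE; apply: eq_bigr => i _; rewrite !mxE.
Qed.

(** Composition with a projection onto the common kernel of [L] is a ring
    endomorphism whose kernel is the ideal of [L]. *)
Lemma nzd_lin L l : ~~ (l <= rows L)%MS -> nzd (map (@lin K m) L) (lin l).
Proof.
move=> nl; set N := rows L; pose G := pinvmx N^T; pose Pi := 1%:M - N^T *m G.
have NG : N^T *m G *m N^T = N^T by apply: mulmxKpV.
have NPi : N *m Pi^T = 0.
  by apply: trmx_inj; rewrite trmx_mul trmxK trmx0 mulmxBl mul1mx NG subrr.
pose rho := linsub Pi^T.
have iL := inI_ideal (map (@lin K m) L).
have rhoL u : inI (map (@lin K m) L) u -> u \mPo rho = 0.
  apply: (inI_min (I := [set u | u \mPo rho = 0])).
    split=> [|v w /= v0 w0|v w /= w0]; first exact: comp_mpoly0.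
      by rewrite comp_mpolyD v0 w0 addr0.
    by rewrite rmorphM /= w0 mulr0.
  move=> _ /mapP[l' lL ->] /=; rewrite lin_comp.
  suff -> : l' *m Pi^T = 0 by rewrite linear0.
  have li : (index l' L < size L)%N by rewrite index_mem.
  have -> : l' = row (Ordinal li) N by rewrite rowK nth_index.
  by rewrite -row_mul NPi row0.
have rhoE u : inI (map (@lin K m) L) (u - (u \mPo rho)).
  apply: comp_mpoly_cong => // i.
  rewrite tnth_mktuple -lin_delta -linearB /=.
  have -> : delta_mx ord0 i - row i Pi^T = \sum_j G j i *: L`_j.
    apply/rowP => j; rewrite summxE !mxE.
    rewrite eq_sym eqxx /= opprB addrCA [X in _ + X](_ : _ = 0) ?addr0.
      by apply: eq_bigr => k _; rewrite !mxE mulrC.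
    by rewrite eq_sym subrr.
  rewrite linear_sum; apply: ideal_sum => // j _.
  rewrite linearZ /= -mul_mpolyC; apply: idealMl => //.
  by apply: inI_mem; apply: map_f; apply: mem_nth.
move=> u /rhoL; rewrite rmorphM /= lin_comp => /eqP; rewrite mulf_eq0.
case/orP => [/eqP/lin_inj l0|/eqP u0]; last by have := rhoE u; rewrite u0 subr0.
case/negP: nl; rewrite -[l](subr0) -l0 linearB /= trmx1 mulmxBr mulmx1 subKr.
by rewrite trmx_mul trmxK mulmxA submxMl.
Qed.

Lemma only_origin_free L : size L = m -> only_origin (map (@lin K m) L) -> free L.
Proof.
move=> Lm os; apply/(@freeP _ _ _ (in_tuple L)) => k k0 i.
have fN : row_free (rows L).
  have : row_free (rows L)^T.
    rewrite -kermx_eq0; apply/eqP/row_matrixP => j; rewrite row0.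
    apply: os => _ /mapP[l lL ->]; rewrite lin_eval.
    have li : (index l L < size L)%N by rewrite index_mem.
    have := congr1 (fun M : 'M_(_, _) => M j (Ordinal li)) (mulmx_ker (rows L)^T).
    rewrite !mxE => kl; rewrite -[RHS]kl; apply: eq_bigr => x _.
    by rewrite !mxE nth_index // mulrC.
  by rewrite /row_free mxrank_tr => /eqP ->; rewrite Lm.
have : (\row_j k j) *m rows L = 0.
  apply/rowP => j; rewrite -[in RHS]k0 mxE summxE; apply: eq_bigr => x _.
  by rewrite !mxE.
move/eqP; rewrite -(mul0mx _ (rows L)) => /eqP/(row_free_inj fN)/rowP/(_ i).
by rewrite !mxE.
Qed.

Lemma regular_lin L : free L -> regular_seq (map (@lin K m) L).
Proof.
elim: L => // l L IH; rewrite free_cons => /andP[nl /IH rL]; split=> //.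
apply: nzd_lin; apply: contra nl => /submxP[D ->].
have -> : D *m rows L = \sum_i D ord0 i *: L`_i.
  by apply/rowP => j; rewrite mxE summxE; apply: eq_bigr => i _; rewrite !mxE.
by apply: memv_suml => i _; apply: memvZ; apply: memv_span; apply: mem_nth.
Qed.

(** The first entry [b] can be replaced by a linear form [l] such that the list
    still vanishes at the origin only. Once the shorter list of the remaining
    entries and [l] is known to be regular, so is the original one, because a
    power of [l] is a multiple of [b] modulo the others. What is left at the end
    is a list of independent linear forms. *)
Theorem regular_parameters s : size s = m -> (forall a, a \in s -> posdeg a) ->
  only_origin s -> regular_seq s.
Proof.
suff H L : (size s + size L = m)%N -> (forall a, a \in s -> posdeg a) ->
    only_origin (s ++ map (@lin K m) L) -> regular_seq (s ++ map (@lin K m) L).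
  by move=> sm hs os; have := H [::]; rewrite cats0 addn0; apply.
elim: s L => [|b s IH] L /= sLm hs os.
  by apply: regular_lin; apply: only_origin_free.
have hs' a : a \in s -> posdeg a by move=> as_; apply: hs; rewrite inE as_ orbT.
have hL a : a \in map (@lin K m) L -> posdeg a.
  by move=> /mapP[l _ ->]; exact: posdeg_lin.
have [|l lP] := linear_parameter hK _ os.
  by move=> a; rewrite inE mem_cat => /predU1P[->|/orP[/hs'|/hL]] //; apply: hs; rewrite mem_head.
have [k kP] := only_origin_exp hK os (posdeg_lin l).
apply: (regular_exchange kP); apply: regular_front.
  move=> a; rewrite mem_cat inE => /or3P[/hs'|/eqP->|/hL] //; exact: posdeg_lin.
apply: (IH (l :: L)) => //; first by rewrite /= addnS.
move=> p pz; apply: lP => a aP; apply: pz; move: aP.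
by rewrite /= !(inE, mem_cat) orbCA.
Qed.

End LinearForms.

(** * Noether normalization and triangular generators of primes *)

Section Normalization.
Variables (K : closedFieldType) (m : nat).
Local Notation S := {mpoly K[m]}.
Local Notation hcomp e u := (pihomog mdeg e u).
Hypothesis hK : uncountable K.
Implicit Types (u v w : S) (s : seq S).

Definition lins k (L : 'M[K]_(k, m)) : seq S := [seq lin (row i L) | i : 'I_k].

Lemma mem_lins k (L : 'M[K]_(k, m)) a : a \in lins L -> exists i, a = lin (row i L).
Proof. by move=> /mapP[i _ ->]; exists i. Qed.

Lemma lins_mem k (L : 'M[K]_(k, m)) i : lin (row i L) \in lins L.
Proof. by apply/mapP; exists i; rewrite ?mem_enum. Qed.

Lemma linsub_homog k (L : 'M[K]_(k, m)) e (g : {mpoly K[k]}) :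
  g \is e.-homog -> g \mPo linsub L \is e.-homog.
Proof.
move=> /dhomogP hg; rewrite comp_mpolyEX big_seq.
apply: rpred_sum => x xg; apply: rpredZ; rewrite comp_mpolyX.
rewrite -(hg x xg) /= mdegE.
elim/big_rec2: _ => [|i d a _ ha]; first exact: dhomog1.
apply: dhomogM => //; rewrite tnth_mktuple.
by have := dhomogMn (x i) (lin_homog (row i L)); rewrite mul1n.
Qed.

Lemma linsub_hcomp k (L : 'M[K]_(k, m)) e (g : {mpoly K[k]}) :
  hcomp e (g \mPo linsub L) = hcomp e g \mPo linsub L.
Proof.
elim/mpolyind: g => [|c x g _ _ IH]; first by rewrite comp_mpoly0 !pihomog0 comp_mpoly0.
rewrite comp_mpolyD !pihomogD comp_mpolyD IH comp_mpolyZ !linearZ /= pihomogX.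
have hx : ('X_[x] : {mpoly K[k]}) \is (mdeg x).-homog by rewrite dhomogX.
rewrite (hcomp_homog _ (linsub_homog L hx)) /=.
by case: eqP => // _; rewrite comp_mpoly0.
Qed.

Lemma linsub_eval k (L : 'M[K]_(k, m)) (g : {mpoly K[k]}) (v : 'I_m -> K) :
  (g \mPo linsub L).@[v] = g.@[(\row_i (lin (row i L)).@[v]) ord0].
Proof.
by rewrite comp_mpoly_meval; apply: meval_eq => i; rewrite tnth_mktuple mxE.
Qed.

Lemma mpoly_neq0_eval k (g : {mpoly K[k]}) : g != 0 -> exists l : 'rV_k, g.@[l ord0] != 0.
Proof.
move=> g0; apply: contrapT => /forallNP no.
have i0 : is_ideal (fun u : {mpoly K[k]} => u = 0).
  by split=> // [u v -> ->|a u ->]; rewrite ?addr0 ?mulr0.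
have [|n /eqP] := nullstellensatz (u := g) hK i0.
  by move=> p _; apply/eqP/negPn/negP/no.
by rewrite expf_eq0 (negPf g0) andbF.
Qed.

(** Let [l] be a vector at which [g] is nonzero. The linear forms that vanish on the
    line of [l] restrict the values of the rows of [L] to this line, where [g]
    vanishes at the origin only. *)
Lemma only_origin_form k (L : 'M[K]_(k.+1, m)) s e (g : {mpoly K[k.+1]}) :
  (0 < e)%N -> g \is e.-homog -> g != 0 -> only_origin (lins L ++ s) ->
  exists L' : 'M[K]_(k, m), only_origin (g \mPo linsub L :: lins L' ++ s).
Proof.
move=> e0 hg g0 os; have [l gl] := mpoly_neq0_eval g0.
have [i0 li0] : exists i, l ord0 i != 0.
  apply/existsP; apply: contraNT gl => /existsPn l0.
  have -> : l = 0 by apply/rowP => i; rewrite mxE; apply/eqP; have := l0 i; rewrite negbK.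
  by rewrite posdeg_eval0 //; exists e.
exists (\matrix_j (l ord0 i0 *: row (lift i0 j) L - l ord0 (lift i0 j) *: row i0 L)).
set L' := \matrix_j _ => p pz.
pose y : 'rV_k.+1 := \row_i (lin (row i L)).@[p ord0].
have yE : y = (y ord0 i0 / l ord0 i0) *: l.
  apply/rowP => i; rewrite [in RHS]mxE.
  have [j ->|->] := unliftP i0 i; last by rewrite mulfVK.
  have : (lin (row j L')).@[p ord0] = 0.
    by apply: pz; rewrite inE mem_cat lins_mem orbT.
  rewrite rowK linearB !linearZ /= mevalD !mevalZ mevalN mulrN => /eqP.
  rewrite subr_eq0 => /eqP yl; apply: (mulfI li0).
  by rewrite !mxE yl; field.
have gy : g.@[y ord0] = 0 by rewrite -linsub_eval; apply: pz; rewrite mem_head.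
have y0 : y = 0.
  move: gy; rewrite yE (homog_scale _ _ hg) => /eqP; rewrite mulf_eq0 (negPf gl) orbF.
  by rewrite expf_eq0 e0 => /eqP ->; rewrite scale0r.
apply: os => a; rewrite mem_cat => /orP[/mem_lins[i ->]|as_].
  by have := congr1 (fun z : 'rV_k.+1 => z ord0 i) y0; rewrite !mxE.
by apply: pz; rewrite inE mem_cat as_ !orbT.
Qed.

Lemma inI_eval0 s u : (forall a, a \in s -> posdeg a) -> inI s u ->
  u.@[(0 : 'rV_m) ord0] = 0.
Proof. by move=> hs; apply: inI_lin_eval => a /hs; exact: posdeg_eval0. Qed.

(** Noether normalization. Starting from all the coordinates, a homogeneous
    relation [g] between the linear forms modulo [s] makes one of them superfluous,
    by [only_origin_form]. *)
Lemma noether_normalization s : (forall a, a \in s -> posdeg a) ->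
  exists k (L : 'M[K]_(k, m)), only_origin (lins L ++ s) /\
    forall g, inI s (g \mPo linsub L) -> g = 0.
Proof.
move=> hs.
suff H k (L : 'M[K]_(k, m)) : only_origin (lins L ++ s) ->
    exists k (L : 'M[K]_(k, m)), only_origin (lins L ++ s) /\
    forall g, inI s (g \mPo linsub L) -> g = 0.
  apply: (H m 1%:M) => p pz; apply/rowP => i.
  have : (lin (row i 1%:M)).@[p ord0] = 0 by apply: pz; rewrite mem_cat lins_mem.
  by rewrite row1 lin_delta mevalXU mxE.
elim: k L => [|k IH] L os.
  exists 0%N, L; split=> // g /(inI_eval0 hs) g0; apply/mpolyP => x; rewrite mcoeff0.
  have x0 : x = 0%MM by apply/mnmP => -[].
  move: g0; rewrite linsub_eval.
  have {1}-> : g = (g@_0)%:MP.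
    by apply: msize1_polyC; rewrite msizeE; apply/bigmax_leqP_seq => z _ _; rewrite mdegE big_ord0.
  by rewrite mevalC x0.
have [indep|dep] := pselect (forall g, inI s (g \mPo linsub L) -> g = 0).
  by exists k.+1, L.
have /existsNP[g /not_implyP[gs g0]] := dep.
have [e ge0] : exists e, hcomp e g != 0.
  apply: contrapT => /forallNP ge0; apply: g0; rewrite (hcomp_sum g) big1 // => e _.
  by apply/eqP/negPn/negP/ge0.
have he := pihomogP mdeg e g.
have {}gs : inI s (hcomp e g \mPo linsub L) by rewrite -linsub_hcomp; apply: inI_hcomp.
move: (hcomp e g) he ge0 gs {g0} => {}g he ge0 gs; case: e he => [|e] he.
  have : g.@[(0 : 'rV_k.+1) ord0] = 0.
    rewrite -(inI_eval0 hs gs) linsub_eval; apply: meval_eq => i.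
    by rewrite !mxE posdeg_eval0 //; exact: posdeg_lin.
  have [l gl] := mpoly_neq0_eval ge0.
  by rewrite -[0](scale0r l) (homog_scale _ _ he) mul1r => g0'; rewrite g0' eqxx in gl.
have [L' osL'] := only_origin_form (ltn0Sn e) he ge0 os.
apply: (IH L') => p pz; apply: osL' => a; rewrite inE => /predU1P[->|]; last exact: pz.
by apply: inI_lin_eval gs => b bs; apply: pz; rewrite mem_cat bs orbT.
Qed.

End Normalization.

Section Triangular.
Variable A : idomainType.
Variables (P : set A) (R0 : set A).
Hypothesis pP : is_prime P.

Record is_subring (R : set A) : Prop := IsSubring {
  subring1 : R 1;
  subringB : forall u v, R u -> R v -> R (u - v);
  subringM : forall u v, R u -> R v -> R (u * v) }.

Fixpoint adjoin (ys : seq A) : set A :=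
  if ys is y :: ys' then
    [set u | exists p : {poly A}, (forall i, adjoin ys' p`_i) /\ u = p.[y]]
  else R0.

Lemma subring0 R : is_subring R -> R 0.
Proof. by move=> sR; rewrite -(subrr 1); apply: subringB => //; apply: subring1. Qed.

Lemma subringD R u v : is_subring R -> R u -> R v -> R (u + v).
Proof.
move=> sR Ru Rv; rewrite -[v]opprK -[- v]sub0r; do ?apply: subringB => //.
exact: subring0.
Qed.

Lemma subring_sum R (T : Type) (r : seq T) (Q : pred T) (F : T -> A) :
  is_subring R -> (forall i, R (F i)) -> R (\sum_(i <- r | Q i) F i).
Proof.
move=> sR RF; elim/big_rec: _ => [|i x _ Rx]; first exact: subring0.
exact: subringD.
Qed.

Lemma adjoin_subring ys : is_subring R0 -> is_subring (adjoin ys).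
Proof.
move=> sR0; elim: ys => //= y ys sR; split.
- exists 1; rewrite hornerC; split=> // i; rewrite coef1.
  by case: eqP => _; [apply: subring1 | apply: subring0].
- move=> _ _ [p [pR ->]] [q [qR ->]]; exists (p - q); rewrite hornerD hornerN.
  by split=> // i; rewrite coefB; apply: subringB.
- move=> _ _ [p [pR ->]] [q [qR ->]]; exists (p * q); rewrite hornerM.
  by split=> // i; rewrite coefM; apply: subring_sum => // j; apply: subringM.
Qed.

Lemma adjoin_cons y ys u : is_subring R0 -> adjoin ys u -> adjoin (y :: ys) u.
Proof.
move=> sR0 uR; exists u%:P; rewrite hornerC; split=> // i; rewrite coefC.
by case: eqP => // _; apply: subring0; apply: adjoin_subring.
Qed.

Lemma adjoin_mem y ys : is_subring R0 -> y \in ys -> adjoin ys y.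
Proof.
move=> sR0; elim: ys => // z ys IH; rewrite inE => /predU1P[->|/IH]; last exact: adjoin_cons.
exists 'X; rewrite hornerX; split=> // i; rewrite coefX.
have sR := adjoin_subring ys sR0.
by case: eqP => _; [apply: subring1 | apply: subring0].
Qed.

(** Pseudo-division of [p] by [p0], which has least degree among the polynomials
    that vanish at [y] modulo [P] and have their leading coefficient outside [P].
    A leading coefficient that lies in [P] is dealt with by [gs]. *)
Lemma triangular_step y ys gs (p0 : {poly A}) : is_subring R0 ->
  (forall u, P u -> adjoin ys u -> exists s, ~ P s /\ inI gs (s * u)) ->
  (forall i, adjoin ys p0`_i) -> P p0.[y] ->
  (forall p : {poly A}, (forall i, adjoin ys p`_i) -> P p.[y] ->
     ~ P (lead_coef p) -> (size p0 <= size p)%N /\ ~ P (lead_coef p0)) ->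
  forall p : {poly A}, (forall i, adjoin ys p`_i) -> P p.[y] ->
    exists s, ~ P s /\ inI (p0.[y] :: gs) (s * p.[y]).
Proof.
move=> sR0 gsP p0R Pp0 p0min p; have sR := adjoin_subring ys sR0.
have iG := inI_ideal (p0.[y] :: gs); have iP : is_ideal P by exact: pP.
have [n] := ubnP (size p); elim: n p => // n IH p pn pR Pp.
have [->|p_neq0] := eqVneq p 0.
  by exists 1; rewrite horner0 mulr0; split; [exact: prime1 | exact: ideal0].
have sp : (0 < size p)%N by rewrite size_poly_gt0.
have [lcP|lcP] := pselect (P (lead_coef p)).
  have [s1 [s1P s1G]] := gsP _ lcP (pR _).
  pose q := p - lead_coef p *: 'X^((size p).-1).
  have qE : q.[y] = p.[y] - lead_coef p * y ^+ (size p).-1.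
    by rewrite hornerD hornerN hornerZ hornerXn.
  have [|||s2 [s2P s2G]] := IH q.
  - rewrite -ltnS (leq_trans _ pn) // ltnS -(prednK sp) ltnS.
    apply/leq_sizeP => j; rewrite leq_eqVlt coefB coefZ coefXn => /predU1P[<-|sj].
      by rewrite eqxx mulr1 subrr.
    by rewrite gtn_eqF // mulr0 subr0 nth_default // -(prednK sp).
  - move=> i; rewrite coefB coefZ coefXn; apply: (subringB sR) => //.
    by case: eqP => _; rewrite ?mulr1 ?mulr0; [exact: pR | exact: subring0 sR].
  - by rewrite qE; apply: (idealB iP Pp); apply: (idealMr _ iP).
  exists (s1 * s2); split; first by case/(primeM pP).
  have -> : s1 * s2 * p.[y] = s1 * (s2 * q.[y]) + (s2 * y ^+ (size p).-1) * (s1 * lead_coef p).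
    by rewrite qE; ring.
  by apply: idealD => //; apply: idealMl => //; apply: inI_cons.
have [p0p lc0P] := p0min p pR Pp lcP.
pose q := lead_coef p0 *: p - lead_coef p *: ('X^(size p - size p0) * p0).
have qE : q.[y] = lead_coef p0 * p.[y] - lead_coef p * y ^+ (size p - size p0) * p0.[y].
  by rewrite hornerD hornerN !hornerZ hornerM hornerXn mulrA.
have p0_neq0 : p0 != 0.
  by apply: contra_not_neq lc0P => ->; rewrite lead_coef0; apply: ideal0; exact: pP.
have sp0 : (0 < size p0)%N by rewrite size_poly_gt0.
have [|||s2 [s2P s2G]] := IH q.
- rewrite -ltnS (leq_trans _ pn) // ltnS -(prednK sp) ltnS.
  apply/leq_sizeP => j pj; rewrite coefB !coefZ coefXnM.
  have -> : (j < size p - size p0)%N = false.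
    by apply/negbTE; rewrite -leqNgt (leq_trans _ pj) // -subn1 leq_sub2l.
  move: pj; rewrite leq_eqVlt => /predU1P[<-|pj].
    have -> : ((size p).-1 - (size p - size p0) = (size p0).-1)%N.
      by move: p0p sp sp0; move: (size p) (size p0) => a b; lia.
    by rewrite -!lead_coefE mulrC subrr.
  rewrite !nth_default ?mulr0 ?subrr //; last by rewrite -(prednK sp).
  by move: p0p sp sp0 pj; move: (size p) (size p0) => a b; lia.
- move=> i; rewrite coefB !coefZ coefXnM; apply: (subringB sR); apply: (subringM sR).
  + exact: p0R.
  + exact: pR.
  + exact: pR.
  + by case: ifP => _; [exact: subring0 sR | exact: p0R].
- by rewrite qE; apply: (idealB iP); apply: (idealMl iP).
exists (s2 * lead_coef p0); split; first by case/(primeM pP).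
have -> : s2 * lead_coef p0 * p.[y] =
    s2 * q.[y] + s2 * (lead_coef p * y ^+ (size p - size p0)) * p0.[y].
  by rewrite qE; ring.
apply: idealD => //; apply: idealMl => //; apply: inI_mem; exact: mem_head.
Qed.

(** Each adjoined element [y] requires one generator more of [P] in its local ring:
    the value at [y] of a polynomial of least degree that vanishes there modulo
    [P], or zero if [y] is transcendental. *)
Lemma triangular_generators ys : is_subring R0 ->
  (forall u, R0 u -> P u -> u = 0) ->
  exists gs, [/\ size gs = size ys, forall g, g \in gs -> P g &
    forall u, P u -> adjoin ys u -> exists s, ~ P s /\ inI gs (s * u)].
Proof.
move=> sR0 P0; elim: ys => [|y ys [gs [sgs gsP gsG]]].
  exists [::]; split=> // u Pu /= /P0 u0; exists 1; split; first exact: prime1.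
  by rewrite /= u0 ?mulr0.
have sR := adjoin_subring ys sR0.
pose cand n := exists p : {poly A},
  [/\ forall i, adjoin ys p`_i, P p.[y], ~ P (lead_coef p) & size p = n].
suff [p0 [p0R Pp0 p0min]] : exists p0 : {poly A}, [/\ forall i, adjoin ys p0`_i, P p0.[y] &
    forall p : {poly A}, (forall i, adjoin ys p`_i) -> P p.[y] ->
     ~ P (lead_coef p) -> (size p0 <= size p)%N /\ ~ P (lead_coef p0)].
  exists (p0.[y] :: gs); split; first by rewrite /= sgs.
    by move=> g; rewrite inE => /predU1P[->|/gsP].
  by move=> u Pu [p [pR uE]]; rewrite uE in Pu *; apply: (triangular_step (ys := ys)).
have [[n nc]|noc] := pselect (exists n, cand n); last first.
  exists 0; split=> [i||p pR Pp lcp]; rewrite ?coef0 ?horner0.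
  - exact: subring0.
  - by apply: ideal0; exact: pP.
  - by case: noc; exists (size p), p.
have exc : exists n, `[< cand n >] by exists n; apply/asboolP.
case: (ex_minnP exc) => k /asboolP[p0 [p0R Pp0 lc0 sp0]] kmin.
exists p0; split=> // p pR Pp lcp; split=> //; rewrite sp0; apply: kmin.
by apply/asboolP; exists p.
Qed.

End Triangular.

(** * Smooth complete intersections are reduced of the expected dimension *)

Section DetCong.
Variables (A : comNzRingType) (P : set A).
Hypothesis iP : is_ideal P.

Lemma ideal_cong_det c (M N : 'M[A]_c) :
  (forall i j, P (M i j - N i j)) -> P (\det M - \det N).
Proof.
move=> MN; rewrite /determinant; apply: ideal_cong_sum => // s _.
by rewrite -mulrBr; apply: idealMl => //; apply: ideal_cong_prod.
Qed.

End DetCong.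

Section Smooth.
Variables (K : closedFieldType) (m c : nat).
Local Notation S := {mpoly K[m]}.
Local Notation hcomp e u := (pihomog mdeg e u).
Hypothesis hK : uncountable K.
Variable f : 'I_c -> S.
Hypothesis hf : forall j, posdeg (f j).
Implicit Types (u v w : S) (P : set S) (p : 'rV[K]_m).

Definition jac : 'M[S]_(c, m) := \matrix_(j, k) (f j)^`M(k).

(** Minors after a linear change of coordinates: when the Jacobian matrix has full
    rank at a point, one of them is nonzero there. *)
Definition jminor (E : 'M[K]_(m, c)) : S := \det (jac *m map_mx (@mpolyC m K) E).

Let F := codom f.

Lemma posdeg_codom a : a \in F -> posdeg a.
Proof. by move=> /codomP[j ->]. Qed.

Lemma inI_cone u (v : 'I_m -> K) : (forall j, (f j).@[v] = 0) -> inI F u -> u.@[v] = 0.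
Proof. by move=> fv; apply: inI_lin_eval => a /codomP[j ->]. Qed.

(** The local ring of a prime [P] that has no more triangular generators than
    there are equations has its maximal ideal generated by the equations: both systems have [c]
    elements and the matrix [W] that relates them is invertible at [P],
    because it relates their Jacobian matrices modulo [P]. *)
Lemma local_generators P gs E : is_prime P -> (forall j, P (f j)) ->
  ~ P (jminor E) -> (size gs <= c)%N -> (forall g, g \in gs -> P g) ->
  (forall u, P u -> exists s, ~ P s /\ inI gs (s * u)) ->
  size gs = c /\ forall u, P u -> exists t, ~ P t /\ inI F (t * u).
Proof.
move=> pP fP EP sgs gsP gsG; have iP : is_ideal P by exact: pP.
pose g (i : 'I_c) := gs`_i.
have gP i : P (g i).
  rewrite /g; have [igs|gsi] := ltnP i (size gs); first exact/gsP/mem_nth.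
  by rewrite nth_default //; apply: ideal0.
have gsE u : inI gs u -> exists a : 'I_c -> S, u = \sum_i a i * g i.
  move=> gu; apply/inI_codom; apply: inI_sub gu => a /(nthP 0)[i igs <-].
  by apply: inI_mem; apply/codomP; exists (Ordinal (leq_trans igs sgs)).
have [s sP] := choice (fun j => gsG (f j) (fP j)).
have [W0 W0E] := choice (fun j => gsE _ (sP j).2).
pose r := \prod_j s j.
have rP : ~ P r by apply: prime_prodN => // j; case: (sP j).
pose W : 'M[S]_c := \matrix_(j, i) (\prod_(l | l != j) s l * W0 j i).
have WE j : r * f j = \sum_i W j i * g i.
  rewrite /r (bigD1 j) //= mulrC mulrA mulrAC -mulrA mulrCA -[f j * _]mulrC W0E mulr_sumr.
  by apply: eq_bigr => i _; rewrite mxE mulrA.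
pose Jg : 'M[S]_(c, m) := \matrix_(i, k) (g i)^`M(k).
pose EE := map_mx (@mpolyC m K) E.
have JW j k : P (r * jac j k - (W *m Jg) j k).
  have : (r * f j)^`M(k) = (\sum_i W j i * g i)^`M(k) by rewrite WE.
  rewrite mderivM raddf_sum /= => dE; rewrite !mxE.
  have -> : r * (f j)^`M(k) - \sum_i W j i * Jg i k =
      \sum_i (W j i)^`M(k) * g i - r^`M(k) * f j.
    have sE : \sum_i (W j i * g i)^`M(k) =
        \sum_i (W j i)^`M(k) * g i + \sum_i W j i * Jg i k.
      by rewrite -big_split; apply: eq_bigr => i _; rewrite mderivM [Jg i k]mxE.
    move: dE; rewrite sE; set B := \sum_i W j i * _; set C := \sum_i _ => dE.
    have -> : C = r^`M(k) * f j + r * (f j)^`M(k) - B by rewrite dE addrK.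
    by ring.
  apply: idealB => //; last exact: idealMl.
  by apply: ideal_sum => // i _; apply: idealMl.
have detP : P (r ^+ c * jminor E - \det W * \det (Jg *m EE)).
  rewrite -detZ -det_mulmx mulmxA; apply: ideal_cong_det => // j k.
  rewrite [X in X - _]mxE [X in r * X]mxE [X in _ - X]mxE mulr_sumr.
  apply: ideal_cong_sum => // i _; rewrite mulrA -mulrBl.
  by apply: idealMr.
have WP : ~ P (\det W).
  move=> PW; have : P (r ^+ c * jminor E).
    by rewrite -(subrK (\det W * \det (Jg *m EE)) (_ * _)); apply: idealD => //; apply: idealMr.
  by case/(primeM pP) => // /(prime_exp pP).
split.
  apply/eqP; rewrite eqn_leq sgs /= leqNgt; apply/negP => gsc.
  case: WP; suff: P (r ^+ c * jminor E) by case/(primeM pP) => // /(prime_exp pP).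
  have /det0P : exists2 v : 'rV[S]_c, v != 0 & v *m (Jg *m EE) = 0.
    exists (delta_mx ord0 (Ordinal gsc)).
      by apply/eqP => /rowP/(_ (Ordinal gsc)); rewrite !mxE !eqxx => /eqP; rewrite oner_eq0.
    rewrite mulmxA -rowE; have -> : row (Ordinal gsc) Jg = 0.
      by apply/rowP => k; rewrite !mxE /g nth_default // mderiv0.
    by rewrite mul0mx.
  by move=> /eqP d0; move: detP; rewrite d0 mulr0 subr0.
move=> u /gsG[s' [s'P /gsE[a aE]]].
exists (\det W * s'); split; first by case/(primeM pP).
rewrite -mulrA aE mulr_sumr; apply: ideal_sum => [|i _]; first exact: inI_ideal.
rewrite mulrCA; apply: idealMl; first exact: inI_ideal.
have -> : \det W * g i = \sum_j (\adj W i j * r) * f j.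
  under eq_bigr => j _ do rewrite -mulrA WE mulr_sumr.
  rewrite exchange_big /= (bigD1 i) //= [X in _ + X]big1 ?addr0.
    under eq_bigr => j _ do rewrite mulrA.
    rewrite -mulr_suml; congr (_ * _).
    have := congr1 (fun M : 'M_c => M i i) (mul_adj_mx W).
    by rewrite !mxE eqxx mulr1n.
  move=> l li; under eq_bigr => j _ do rewrite mulrA.
  rewrite -mulr_suml.
  have := congr1 (fun M : 'M_c => M i l) (mul_adj_mx W).
  by rewrite !mxE eq_sym (negPf li) mulr0n => ->; rewrite mul0r.
by apply/inI_codom; exists (fun j => \adj W i j * r).
Qed.

Hypothesis smooth : forall p, p != 0 -> (forall j, (f j).@[p ord0] = 0) ->
  row_free (\matrix_(j, k) ((f j)^`M(k)).@[p ord0]).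

(** An ideal without zeros off the origin contains a power of every polynomial that
    vanishes at the origin. *)
Lemma cone_ideal (I : set S) u : is_ideal I -> (forall j, I (f j)) ->
  (forall p, p != 0 -> (forall j, (f j).@[p ord0] = 0) ->
     exists2 g, I g & g.@[p ord0] != 0) ->
  u.@[(0 : 'rV_m) ord0] = 0 -> exists k, I (u ^+ k).
Proof.
move=> iI fI sep u0; apply: nullstellensatz => // p pI.
have [-> //|p0] := eqVneq p 0.
have [|g Ig] := sep p p0; first by move=> j; apply: pI.
by rewrite pI ?eqxx.
Qed.

Lemma jminor_eval E p :
  (jminor E).@[p ord0] = \det ((\matrix_(j, k) ((f j)^`M(k)).@[p ord0]) *m E).
Proof.
rewrite /jminor -det_map_mx map_mxM; congr (\det (_ *m _)).
  by apply/matrixP => j k; rewrite !mxE.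
by apply/matrixP => j k; rewrite !mxE /= mevalC.
Qed.

Lemma jminor_neq0 p : p != 0 -> (forall j, (f j).@[p ord0] = 0) ->
  exists E, (jminor E).@[p ord0] != 0.
Proof.
move=> p0 fp; have := smooth p0 fp; set J := \matrix_(j, k) _ => fJ.
by exists (pinvmx J); rewrite jminor_eval mulmxVp // det1 oner_neq0.
Qed.

(** The cone is smooth off its vertex, so the minors and the equations have no
    common zero but the origin. *)
Lemma prime_jminor P : is_prime P -> (forall j, P (f j)) -> (exists i, ~ P 'X_i) ->
  exists E, ~ P (jminor E).
Proof.
move=> pP fP [i Xi]; apply: contrapT => /forallNP noE; apply: Xi.
have [||||k /(prime_exp pP)//] := @cone_ideal P 'X_i; rewrite ?mevalXU ?mxE //.
  exact: pP.
move=> p p0 /(jminor_neq0 p0)[E Ep]; exists (jminor E) => //.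
exact: contrapT (noE E).
Qed.

Definition linset k (L : 'M[K]_(k, m)) : set S := [set u | exists g, u = g \mPo linsub L].

Lemma linset_subring k (L : 'M[K]_(k, m)) : is_subring (linset L).
Proof.
split.
- by exists 1; rewrite comp_mpoly1.
- by move=> _ _ [g ->] [h ->]; exists (g - h); rewrite comp_mpolyB.
- by move=> _ _ [g ->] [h ->]; exists (g * h); rewrite rmorphM.
Qed.

Lemma independent_row_free k (L : 'M[K]_(k, m)) :
  (forall g, inI F (g \mPo linsub L) -> g = 0) -> row_free L.
Proof.
move=> indep; rewrite -kermx_eq0; apply/eqP/row_matrixP => i; rewrite row0.
apply: lin_inj; apply: indep; rewrite lin_comp -row_mul mulmx_ker row0 linear0.
by apply: ideal0; exact: inI_ideal.
Qed.

(** Completing [L] to a coordinate system leaves [m - k] coordinates to be adjoined,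
    each with one generator. *)
Lemma prime_generators P k (L : 'M[K]_(k, m)) : is_prime P -> row_free L ->
  (forall g, P (g \mPo linsub L) -> g = 0) ->
  exists gs, [/\ size gs = (m - k)%N, forall g, g \in gs -> P g &
    forall u, P u -> exists s, ~ P s /\ inI gs (s * u)].
Proof.
move=> pP fL PL; pose ys := lins (row_base L^C%MS).
have sL := linset_subring L.
have [|gs [sgs gsP gsG]] := triangular_generators pP ys sL.
  by move=> _ [g ->] /PL ->; rewrite comp_mpoly0.
exists gs; split=> //.
  by rewrite sgs size_map size_enum_ord mxrank_compl (eqP fL).
have sR := adjoin_subring ys sL.
have constR a : adjoin (linset L) ys a%:MP.
  elim: (ys) => [|y ys' IH]; first by exists a%:MP; rewrite comp_mpolyC.
  exact: adjoin_cons.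
have linR k' (N : 'M[K]_(k', m)) (l : 'rV[K]_m) : (l <= N)%MS ->
    (forall i, adjoin (linset L) ys (lin (row i N))) -> adjoin (linset L) ys (lin l).
  move=> /submxP[D ->] NR; rewrite -lin_comp /lin raddf_sum /=.
  apply: subring_sum => // i; rewrite comp_mpolyZ comp_mpolyXU -tnth_nth tnth_mktuple.
  by rewrite -mul_mpolyC; apply: (subringM sR).
have LR i : adjoin (linset L) ys (lin (row i L)).
  have : linset L (lin (row i L)).
    by exists 'X_i; rewrite comp_mpolyXU -tnth_nth tnth_mktuple.
  by elim: (ys) => [//|y ys' IH] /IH; exact: adjoin_cons.
have CR i : adjoin (linset L) ys (lin (row i (row_base L^C%MS))).
  by apply: adjoin_mem => //; exact: lins_mem.
have XR i : adjoin (linset L) ys 'X_i.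
  rewrite -lin_delta; set l := delta_mx _ _.
  have /sub_addsmxP[[D1 D2] /= ->] : (l <= L + L^C)%MS.
    by rewrite submx_full // addsmx_compl_full.
  rewrite linearD /=; apply: subringD => //; first by apply: (linR _ L) => //; exact: submxMl.
  by apply: (linR _ (row_base L^C%MS)) => //; rewrite eq_row_base submxMl.
move=> u Pu; apply: gsG => //; rewrite [u]mpolyE; apply: subring_sum => // x.
rewrite -mul_mpolyC; apply: (subringM sR) => //; rewrite mpolyXE_id.
elim/big_rec: _ => [|i v _ vR]; first exact: (subring1 sR).
apply: (subringM sR) => //; elim: (x i) => [|d IH]; first exact: (subring1 sR).
by rewrite exprS; apply: (subringM sR).
Qed.

Hypothesis (hm : m = (3 + c)%N) (hc : (0 < c)%N).

Lemma linset_prime k (L : 'M[K]_(k, m)) (I : set S) : is_ideal I ->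
  (forall g, I (g \mPo linsub L) -> g = 0) ->
  exists P, [/\ is_prime P, forall u, I u -> P u &
    forall g, P (g \mPo linsub L) -> g = 0].
Proof.
move=> iI indep.
pose M : set S := [set u | exists2 g, g != 0 & u = g \mPo linsub L].
have [|_ _ [g g0 ->] [h h0 ->]|u Iu [g g0 uE]|P [pP IP PM _]] := @prime_avoiding _ I M iI.
- by exists 1; rewrite ?oner_neq0 // comp_mpoly1.
- by exists (g * h); rewrite ?mulf_neq0 // rmorphM.
- by move: g0; rewrite (indep g) ?eqxx // -uE.
exists P; split=> // g Pg; apply/eqP/negPn/negP => g0.
by apply: (PM _ Pg); exists g.
Qed.

Lemma independent_prime_jminor k (L : 'M[K]_(k.+1, m)) P : is_prime P ->
  (forall j, P (f j)) -> (forall g, P (g \mPo linsub L) -> g = 0) ->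
  exists E, ~ P (jminor E).
Proof.
move=> pP fP PL; apply: prime_jminor => //.
apply: contrapT => /forallNP noX.
have /PL/eqP : P ('X_ord0 \mPo linsub L).
  rewrite comp_mpolyXU -tnth_nth tnth_mktuple; apply: ideal_sum; first exact: pP.
  move=> i _; rewrite -mul_mpolyC; apply: idealMl; first exact: pP.
  exact: contrapT (noX i).
by rewrite -msize_poly_eq0 msizeX mdeg1.
Qed.

(** The dimension [k] of the cone is at most three: a prime over the equations that
    is disjoint from the polynomials in [k] independent linear forms needs only
    [m - k] local generators, and by the Jacobian criterion it needs [c]. *)
Lemma three_parameters : exists L : 'M[K]_(3, m), only_origin (lins L ++ F).
Proof.
have [k [L [osL indep]]] := noether_normalization hK posdeg_codom.
have k3 : (k <= 3)%N.
  rewrite leqNgt; apply/negP; case: k L osL indep => // k L osL indep k3.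
  have [P [pP FP PL]] := linset_prime (inI_ideal F) indep.
  have fP j : P (f j) by apply/FP/inI_mem/codom_f.
  have [E EP] := independent_prime_jminor pP fP PL.
  have [gs [sgs gsP gsG]] := prime_generators pP (independent_row_free indep) PL.
  have mk : (size gs < c)%N by rewrite sgs; move: hm hc k3; clear; lia.
  have [sc _] := local_generators pP fP EP (ltnW mk) gsP gsG.
  by rewrite sc ltnn in mk.
exists (\matrix_(i < 3) if insub (i : nat) is Some j then row j L else 0) => p pz.
apply: osL => a; rewrite mem_cat => /orP[/mem_lins[i ->]|aF]; last first.
  by apply: pz; rewrite mem_cat aF orbT.
have := pz _ _; apply; rewrite mem_cat; apply/orP; left.
have i3 : (i < 3)%N by apply: leq_trans k3.
apply/mapP; exists (Ordinal i3); rewrite ?mem_enum // rowK /=; congr lin.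
by case: insubP => [j _ ji|]; rewrite ?ltn_ord //; congr row; apply: val_inj.
Qed.

Section ThreeParameters.
Variable L : 'M[K]_(3, m).
Hypothesis osL : only_origin (lins L ++ F).

Lemma parameters_regular (a b d : S) :
  posdeg a -> posdeg b -> posdeg d -> only_origin ([:: a; b; d] ++ F) ->
  regular_seq ([:: a; b; d] ++ F).
Proof.
move=> ha hb hd os; apply: regular_parameters => //.
  by rewrite size_cat size_codom card_ord; exact: esym hm.
by move=> u; rewrite !inE => /or4P[/eqP->|/eqP->|/eqP->|/posdeg_codom].
Qed.

(** A nonzero form in the parameters is part of a system of parameters, hence of a
    regular sequence; [nzd_drop] removes the two other entries. *)
Lemma nzd_form e (g : {mpoly K[3]}) : g \is e.-homog -> g != 0 ->
  nzd F (g \mPo linsub L).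
Proof.
case: e => [|e] hg g0.
  have [t t0 ->] : exists2 t, t != 0 & g = t%:MP.
    have gE : g = (g@_0)%:MP.
      by apply: msize1_polyC; exact: homog_msize_le hg.
    by exists g@_0 => //; rewrite -(mpolyC_eq0 3) -gE.
  move=> u; rewrite comp_mpolyC => uF.
  have -> : u = t^-1%:MP * (t%:MP * u) by rewrite mulrA -mpolyCM mulVf // mul1r.
  by apply: idealMl; first exact: inI_ideal.
have [L' os] := only_origin_form hK (ltn0Sn e) hg g0 osL.
set a := g \mPo _ in os *; pose l i := lin (row i L').
have ha : posdeg a by exists e.+1 => //; exact: linsub_homog.
have hl i : posdeg (l i) by exact: posdeg_lin.
have {}os : only_origin ([:: a; l ord0; l ord_max] ++ F).
  move=> p pz; apply: os => b; rewrite inE mem_cat.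
  move=> /or3P[/eqP->|/mem_lins[i ->]|bF]; apply: pz; rewrite !inE ?eqxx ?bF ?orbT //.
  by case: i => -[|[|//]] i2; apply/or4P; [apply: Or42 | apply: Or43];
    apply/eqP; congr l; apply: val_inj.
have [na [n1 [n2 _]]] := parameters_regular ha (hl _) (hl _) os.
apply: (nzd_drop posdeg_codom ha (hl ord_max)) n2.
apply: (nzd_drop _ ha (hl ord0)) na n1 => b; rewrite inE.
by move=> /predU1P[->//|/posdeg_codom].
Qed.

Lemma inI1 : ~ inI F 1.
Proof.
by move=> /(inI_eval0 posdeg_codom); rewrite meval1 => /eqP; rewrite oner_eq0.
Qed.

Lemma mulIn_linset e u (g : {mpoly K[3]}) : u \is e.-homog -> g != 0 ->
  inI F ((g \mPo linsub L) * u) -> inI F u.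
Proof.
move=> hu g0 gu.
have [d gd0] : exists d, hcomp d g != 0.
  apply: contrapT => /forallNP gd0; case/eqP: g0; rewrite (hcomp_sum g) big1 // => d _.
  by apply/eqP/negPn/negP/gd0.
apply: (nzd_form (pihomogP mdeg d g) gd0).
have := inI_hcomp (d + e) posdeg_codom gu.
by rewrite (hcompM _ _ hu) leq_addl addnK linsub_hcomp.
Qed.

Lemma parameters_independent (g : {mpoly K[3]}) : inI F (g \mPo linsub L) -> g = 0.
Proof.
move=> gF; apply/eqP/negPn/negP => g0; apply: inI1.
by apply: (mulIn_linset (e := 0%N) _ g0); rewrite ?mulr1 ?dhomog1.
Qed.

Lemma cone_nonempty : exists2 p : 'rV[K]_m, p != 0 & forall j, (f j).@[p ord0] = 0.
Proof.
apply: contrapT => /forall2NP noP.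
have [||p p0 fp||k lF] := @cone_ideal (inI F) ('X_ord0 \mPo linsub L).
- exact: inI_ideal.
- by move=> j; apply/inI_mem/codom_f.
- by case: (noP p).
- by rewrite comp_mpolyXU -tnth_nth tnth_mktuple posdeg_eval0 //; exact: posdeg_lin.
have /parameters_independent/eqP : inI F ('X_ord0 ^+ k \mPo linsub L) by rewrite rmorphXn.
by rewrite expf_eq0 -msize_poly_eq0 msizeX mdeg1 andbF.
Qed.

Lemma eval_scale u p (t : K) :
  u.@[(t *: p) ord0] = (\poly_(e < msize u) (hcomp e u).@[p ord0]).[t].
Proof.
rewrite {1}(hcomp_sum u) raddf_sum horner_poly; apply: eq_bigr => e _.
by rewrite /= (homog_scale _ _ (pihomogP mdeg e u)) mulrC.
Qed.

Lemma poly_eq0_off0 (q : {poly K}) : (forall t, t != 0 -> q.[t] = 0) -> q = 0.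
Proof.
move=> q0; apply/eqP/negPn/negP => qn0.
have : 'X * q != 0 by rewrite mulf_neq0 // polyX_eq0.
case/closed_nonrootP => t; rewrite rootE hornerM hornerX mulf_eq0 negb_or.
by case/andP => /q0 ->; rewrite eqxx.
Qed.

(** Along the line of [p], both sides are Laurent polynomials in [t], whose
    coefficients can be compared. *)
Lemma cone_hcomp u p (d : int) (z : K) :
  (forall t, t != 0 -> u.@[(t *: p) ord0] = t ^ d * z) ->
  z = if d is Posz e then (hcomp e u).@[p ord0] else 0.
Proof.
move=> uz; set q := \poly_(e < msize u) (hcomp e u).@[p ord0].
have big e : (msize u <= e)%N -> hcomp e u = 0.
  move=> ue; rewrite /pihomog big1_seq // => x /andP[/eqP xe xu].
  by move: (msize_mdeg_lt xu); rewrite (_ : mdeg x = e) // ltnNge ue.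
have qE e : q`_e = (hcomp e u).@[p ord0].
  by rewrite coef_poly; case: ltnP => // /big ->; rewrite meval0.
case: d uz => e uz.
  have : q - z *: 'X^e = 0.
    apply: poly_eq0_off0 => t t0; rewrite hornerD hornerN hornerZ hornerXn.
    by rewrite -eval_scale uz // mulrC subrr.
  move/eqP; rewrite subr_eq0 => /eqP/(congr1 (fun r : {poly K} => r`_e)).
  by rewrite qE coefZ coefXn eqxx mulr1.
have : 'X^(e.+1) * q - z%:P = 0.
  apply: poly_eq0_off0 => t t0; rewrite hornerD hornerN hornerM hornerXn hornerC.
  by rewrite -eval_scale uz // /exprz mulrA mulfV ?expf_neq0 // mul1r subrr.
move/eqP; rewrite subr_eq0 => /eqP/(congr1 (fun r : {poly K} => r`_0)).
by rewrite coefXnM coefC /= => <-.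
Qed.

Lemma cone_scale p (t : K) : (forall j, (f j).@[p ord0] = 0) ->
  forall j, (f j).@[(t *: p) ord0] = 0.
Proof. by move=> fp j; have [e _ he] := hf j; rewrite (homog_scale _ _ he) fp mulr0. Qed.

(** Suppose that [u] is not in the ideal, and let [P] be a prime that contains the
    annihilator of [u] modulo the equations and no nonzero polynomial in the
    parameters. Since a power of [u] is in the ideal, [P] contains [u]. By the
    Jacobian criterion, the equations generate [P] in its local ring; so some
    element outside [P] annihilates [u] modulo the equations, a contradiction. *)
Lemma cone_reduced u :
  (forall p, p != 0 -> (forall j, (f j).@[p ord0] = 0) -> u.@[p ord0] = 0) ->
  inI F u.
Proof.
move=> uz; apply: ideal_hcomp => [|e]; first exact: inI_ideal.
have iF := inI_ideal F.
have {}uz p : p != 0 -> (forall j, (f j).@[p ord0] = 0) -> (hcomp e u).@[p ord0] = 0.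
  move=> p0 fp; have := @cone_hcomp u p e 0; rewrite /= => <- // t t0.
  by rewrite uz ?mulr0 ?scaler_eq0 ?negb_or ?t0 //; exact: cone_scale.
move: (hcomp e u) (pihomogP mdeg e u) uz => {}u hu uz.
apply: contrapT => nu.
have u0 : u.@[(0 : 'rV_m) ord0] = 0.
  case: e hu => [|e] hu; last by apply: posdeg_eval0; exists e.+1.
  have [p p0 fp] := cone_nonempty.
  by rewrite -(uz p p0 fp) -[0](scale0r p) (homog_scale _ _ hu) mul1r.
have [k uk] : exists k, inI F (u ^+ k).
  apply: nullstellensatz => // p pF.
  have [->//|p0] := eqVneq p 0; apply: uz => // j.
  by apply: pF; apply/inI_mem/codom_f.
pose I : set S := [set v | inI F (v * u)].
have iI : is_ideal I.
  split=> [|v w Iv Iw|a v Iv]; rewrite /I /=.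
  - by rewrite mul0r; apply: ideal0.
  - by rewrite mulrDl; apply: idealD.
  - by rewrite -mulrA; apply: idealMl.
have FI v : inI F v -> I v by move=> Fv; apply: idealMr.
have [|P [pP IP PL]] := @linset_prime 3 L I iI.
  move=> g Ig; apply/eqP/negPn/negP => g0; apply: nu.
  exact: (mulIn_linset hu g0 Ig).
have fP j : P (f j) by apply/IP/FI/inI_mem/codom_f.
have [E EP] := independent_prime_jminor pP fP PL.
have fL : row_free L by apply: independent_row_free => g; exact: parameters_independent.
have [gs [sgs gsP gsG]] := prime_generators pP fL PL.
have gsc : (size gs <= c)%N by rewrite sgs; move: hm; clear; lia.
have [_ FP] := local_generators pP fP EP gsc gsP gsG.
have [t [tP tu]] := FP u (prime_exp pP (IP _ (FI _ uk))).
by apply: tP; apply: IP.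
Qed.

End ThreeParameters.
End Smooth.

(** * Division of bivectors by the equations *)

Section Division.
Variables (A : comNzRingType) (c : nat).
Variable J : 'M[A]_(c, 3 + c).
Implicit Types (E : 'M[A]_(3, 3 + c)) (G : 'M[A]_(3 + c)) (h : 'rV[A]_(3 + c)).

Let nx (b : 'I_3) : 'I_3 := inord ((b.+1) %% 3).
Let pv (b : 'I_3) : 'I_3 := inord ((b.+2) %% 3).

Definition cross (u v : 'I_3 -> A) (b : 'I_3) : A :=
  u (nx b) * v (pv b) - u (pv b) * v (nx b).

Let o0 : 'I_3 := ord0.
Let o1 : 'I_3 := inord 1.
Let o2 : 'I_3 := inord 2.

Lemma sum3 (V : nmodType) (F : 'I_3 -> V) : \sum_b F b = F o0 + F o1 + F o2.
Proof.
rewrite !big_ord_recl big_ord0 addr0 addrA.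
by congr (F _ + F _ + F _); apply: val_inj; rewrite /= inordK.
Qed.

Lemma nxpvE : [/\ nx o0 = o1, nx o1 = o2 & nx o2 = o0] /\
  [/\ pv o0 = o2, pv o1 = o0 & pv o2 = o1].
Proof. by split; split; apply: val_inj; rewrite /nx /pv /o1 /o2 /= !inordK. Qed.

Lemma det33 (M : 'M[A]_3) : \det M = \sum_b M o2 b * cross (M o0) (M o1) b.
Proof.
have [[n0 n1 n2] [p0 p1 p2]] := nxpvE.
rewrite sum3 /cross n0 n1 n2 p0 p1 p2.
pose e (i j : nat) := M (inord i) (inord j).
have eE i j : M i j = e i j by rewrite /e !inord_val.
rewrite (expand_det_row _ ord0) !big_ord_recl big_ord0 /cofactor.
rewrite !(expand_det_row _ ord0) !big_ord_recl !big_ord0 /cofactor !det_mx11 !mxE.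
rewrite !eE /= /bump /= !inordK // !addn0 !addn1 /= !(expr0, expr1, expr2).
by ring.
Qed.

(** Where its determinant is invertible, the rows of [col_mx E J] are a basis;
    [alpha E] and [beta E] are, up to this determinant, the coordinates along
    the rows of [E] and those of [J]. *)
Let T E : 'M[A]_(3 + c) := col_mx E J.
Definition bdet E : A := \det (T E).
Definition alpha E : 'M[A]_(3 + c, 3) := lsubmx (\adj (T E)).
Definition beta E : 'M[A]_(3 + c, c) := rsubmx (\adj (T E)).

Lemma adjT E : \adj (T E) = row_mx (alpha E) (beta E).
Proof. by rewrite hsubmxK. Qed.

Lemma T_adj E : [/\ E *m alpha E = (bdet E)%:M, E *m beta E = 0,
  J *m alpha E = 0 & J *m beta E = (bdet E)%:M].
Proof.
have := mul_mx_adj (T E); rewrite adjT mul_col_row scalar_mx_block.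
by case/eq_block_mx.
Qed.

Lemma adj_T E : alpha E *m E + beta E *m J = (bdet E)%:M.
Proof. by rewrite -mul_row_col -adjT mul_adj_mx. Qed.

(** In the basis given by [E] and [J], the determinant of [R] and [J] only involves
    the coordinates of [R] along [E]. This reduces computations with [contr] to
    vectors of length three. *)
Lemma bdet_col E (R : 'M[A]_(3, 3 + c)) :
  bdet E ^+ 3 * \det (col_mx R J) = bdet E * \det (R *m alpha E).
Proof.
have -> : bdet E ^+ 3 * \det (col_mx R J) = \det (col_mx (bdet E *: R) J).
  have -> : col_mx (bdet E *: R) J = block_mx (bdet E)%:M 0 0 1%:M *m col_mx R J.
    by rewrite mul_block_col !mul0mx mul1mx mul_scalar_mx addr0 add0r.
  by rewrite det_mulmx det_ublock det_scalar det1 mulr1.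
have -> : col_mx (bdet E *: R) J =
    block_mx (R *m alpha E) (R *m beta E) 0 1%:M *m T E.
  by rewrite mul_block_col mul0mx mul1mx add0r -!mulmxA -mulmxDr adj_T mul_mx_scalar.
by rewrite det_mulmx det_ublock det1 mulr1 mulrC.
Qed.

(** The maximal minors of [J], with signs; [contr h] is the bivector dual to the wedge
    product of [h] with the rows of [J]. *)
Definition ctensor (i j l : 'I_(3 + c)) : A :=
  \det (col_mx (\matrix_(a < 3, k < 3 + c) (k == nth i [:: i; j; l] a)%:R) J).

Definition contr h : 'M[A]_(3 + c) := \matrix_(i, j) \sum_l h ord0 l * ctensor i j l.

Lemma contr_linear : linear contr.
Proof.
move=> a h k; apply/matrixP => i j; rewrite !mxE mulr_sumr -big_split.
by apply: eq_bigr => l _; rewrite !mxE mulrDl mulrA.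
Qed.
HB.instance Definition _ :=
  GRing.isLinear.Build A 'rV[A]_(3 + c) 'M[A]_(3 + c) _ contr contr_linear.

Lemma bdet_ctensor E i j l : bdet E ^+ 3 * ctensor i j l =
  bdet E * \sum_b alpha E l b * cross (alpha E i) (alpha E j) b.
Proof.
rewrite bdet_col det33; set R := \matrix_(a, k) _.
have RE a b : (R *m alpha E) a b = alpha E (nth i [:: i; j; l] a) b.
  rewrite mxE (bigD1 (nth i [:: i; j; l] a)) //= mxE eqxx mul1r big1 ?addr0 // => k.
  by rewrite mxE => /negPf ->; rewrite mul0r.
congr (_ * _); apply: eq_bigr => b _; rewrite /cross !RE /o0 /o1 /o2 /= !inordK //.
Qed.

Lemma bdet_contr E h i j : bdet E ^+ 3 * contr h i j =
  bdet E * \sum_b (h *m alpha E) ord0 b * cross (alpha E i) (alpha E j) b.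
Proof.
rewrite mxE mulr_sumr; under eq_bigr => l _ do rewrite mulrCA bdet_ctensor.
under [in RHS]eq_bigr => b _ do rewrite mxE mulr_suml.
rewrite exchange_big mulr_sumr; apply: eq_bigr => l _ /=.
by rewrite mulrCA mulr_sumr; congr (_ * _); apply: eq_bigr => b _; rewrite mulrA.
Qed.

Let gE E G : 'M[A]_3 := E *m G *m E^T.

Lemma cross_mulmx k l (X : 'M[A]_(k, l)) (Y : 'M[A]_(l, 3)) p q b :
  \sum_j \sum_i X p i * X q j * cross (Y i) (Y j) b = cross ((X *m Y) p) ((X *m Y) q) b.
Proof.
rewrite /cross ![(X *m Y) _ _]mxE.
set F := nx b; set H := pv b.
rewrite [LHS]exchange_big /= !mulr_suml -[RHS]sumrB; apply: eq_bigr => i _.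
rewrite !mulr_sumr -[RHS]sumrB; apply: eq_bigr => j _.
by ring.
Qed.

Lemma cross_scalar (a : A) b b' :
  cross ((a%:M : 'M_3) (nx b)) ((a%:M : 'M_3) (pv b)) b' = (a ^+ 2) *+ (b == b').
Proof.
rewrite /cross !mxE /nx /pv -!val_eqE.
case: b b' => [[|[|[|b]]] bP] [[|[|[|b']]] b'P] //=; rewrite !inordK //=;
  by rewrite ?mulr1n ?mulr0n ?mul0r ?mulr0 ?subr0 ?sub0r ?expr2 ?oppr0.
Qed.

Lemma gEE E G p q : gE E G p q = \sum_j \sum_i E p i * E q j * G i j.
Proof.
rewrite /gE mxE; apply: eq_bigr => j _; rewrite !mxE mulr_suml.
by apply: eq_bigr => i _; rewrite mulrAC.
Qed.

(** The three entries of the bivector of [h] on the rows of [E] are the coordinates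
    of [h] along [E], by Cramer's rule. *)
Lemma gE_contr E h b :
  bdet E ^+ 3 * gE E (contr h) (nx b) (pv b) = bdet E ^+ 3 * (h *m alpha E) ord0 b.
Proof.
have [Ea _ _ _] := T_adj E.
transitivity (bdet E * \sum_b' (h *m alpha E) ord0 b' *
    \sum_j \sum_i E (nx b) i * E (pv b) j * cross (alpha E i) (alpha E j) b').
  rewrite gEE [LHS]mulr_sumr [RHS]mulr_sumr.
  under [in RHS]eq_bigr => b' _ do rewrite mulr_sumr mulr_sumr.
  rewrite [RHS]exchange_big /=; apply: eq_bigr => j _.
  rewrite mulr_sumr; under [in RHS]eq_bigr => b' _ do rewrite mulr_sumr mulr_sumr.
  rewrite [RHS]exchange_big /=; apply: eq_bigr => i _.
  transitivity (E (nx b) i * E (pv b) j * (bdet E ^+ 3 * contr h i j)); first by ring.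
  rewrite bdet_contr mulr_sumr mulr_sumr; apply: eq_bigr => b' _.
  by ring.
under eq_bigr => b' _ do rewrite cross_mulmx Ea cross_scalar.
rewrite (bigD1 b) //= eqxx mulr1n [X in _ + X]big1 ?addr0; first by ring.
by move=> b' /negPf bb; rewrite eq_sym bb mulr0n mulr0.
Qed.

Lemma alternating_cross (g : 'M[A]_3) (u v : 'I_3 -> A) :
  (forall i, g i i = 0) -> (forall i j, g i j = - g j i) ->
  \sum_b \sum_a u a * g a b * v b = \sum_b g (nx b) (pv b) * cross u v b.
Proof.
move=> g0 ga; have [[n0 n1 n2] [p0 p1 p2]] := nxpvE.
rewrite !sum3 /cross n0 n1 n2 p0 p1 p2 !g0 (ga o1 o0) (ga o2 o1) (ga o0 o2).
by ring.
Qed.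

Lemma sum_alternating n (F : 'I_n -> 'I_n -> A) :
  (forall i, F i i = 0) -> (forall i j, F i j = - F j i) ->
  \sum_j \sum_i F i j = 0.
Proof.
elim: n F => [|n IH] F F0 Fa; first by rewrite big_ord0.
rewrite big_ord_recr /=; under eq_bigr => j _ do rewrite big_ord_recr /=.
rewrite big_split /= IH // add0r big_ord_recr /= F0 addr0 -big_split big1 // => i _.
by rewrite /= (Fa ord_max) addNr.
Qed.

(** A bivector that is orthogonal to the rows of [J] is determined by its values on
    the rows of [E]. *)
Lemma bdet_bivector E G i j : (forall i, G i i = 0) -> (forall i j, G i j = - G j i) ->
  G *m J^T = 0 ->
  bdet E ^+ 2 * G i j = \sum_b gE E G (nx b) (pv b) * cross (alpha E i) (alpha E j) b.
Proof.
move=> G0 Ga GJ; have JG : J *m G = 0.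
  have GT : G = - G^T by apply/matrixP => k l; rewrite !mxE.
  by apply: trmx_inj; rewrite trmx_mul trmx0 -[G^T]opprK -raddfN /= -GT mulNmx GJ oppr0.
have -> : bdet E ^+ 2 * G i j = (alpha E *m gE E G *m (alpha E)^T) i j.
  have -> : alpha E *m gE E G *m (alpha E)^T = (bdet E ^+ 2) *: G; last by rewrite mxE.
  rewrite /gE !mulmxA -[X in X = _]mulmxA -trmx_mul.
  have -> : alpha E *m E = (bdet E)%:M - beta E *m J by rewrite -(adj_T E) addrK.
  rewrite mulmxBl -mulmxA JG mulmx0 subr0 mul_scalar_mx raddfB /= tr_scalar_mx.
  by rewrite mulmxBr mul_mx_scalar -scalemxAl trmx_mul mulmxA GJ mul0mx scaler0 subr0 scalerA.
rewrite mxE; under eq_bigr => b _ do rewrite mxE mulr_suml.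
under eq_bigr => b _ do (under eq_bigr => a _ do rewrite [_^T _ _]mxE).
apply: alternating_cross => [k|k l]; rewrite !gEE.
  apply: sum_alternating => [x|x y]; first by rewrite G0 mulr0.
  by rewrite (Ga x) mulrN [E k y * _]mulrC.
rewrite exchange_big -sumrN; apply: eq_bigr => x _; rewrite -sumrN; apply: eq_bigr => y _.
by rewrite (Ga x) mulrN [E k x * _]mulrC.
Qed.

(** In three dimensions, a bivector is the cross product with a vector, whose
    coordinates are its three entries. *)
Lemma contr_of_bivector E G : (forall i, G i i = 0) -> (forall i j, G i j = - G j i) ->
  G *m J^T = 0 -> exists h, bdet E ^+ 4 *: G = contr h.
Proof.
move=> G0 Ga GJ; have [Ea _ _ _] := T_adj E.
pose g : 'rV[A]_3 := \row_b gE E G (nx b) (pv b).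
exists (bdet E ^+ 3 *: (g *m E)); rewrite linearZ; apply/matrixP => i j; rewrite mxE [RHS]mxE.
rewrite bdet_contr -mulmxA Ea mul_mx_scalar.
rewrite (_ : 4 = 2 + 2)%N // exprD -mulrA (bdet_bivector E i j G0 Ga GJ).
rewrite expr2 -mulrA; congr (_ * _); rewrite mulr_sumr; apply: eq_bigr => b _.
by rewrite !mxE mulrA.
Qed.

Lemma contr_rows E (l : 'rV[A]_c) : bdet E ^+ 3 *: contr (l *m J) = 0.
Proof.
have [_ _ Ja _] := T_adj E; apply/matrixP => i j; rewrite mxE bdet_contr -mulmxA Ja mulmx0.
by rewrite mxE big1 ?mulr0 // => b _; rewrite mxE mul0r.
Qed.

(** [h /\ J = 0] holds, where [bdet E] is invertible, only for combinations of the
    rows of [J]. *)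
Lemma rows_of_contr E h : contr h = 0 -> exists l : 'rV[A]_c, bdet E ^+ 4 *: h = l *m J.
Proof.
move=> h0; have ha : bdet E ^+ 3 *: (h *m alpha E) = 0.
  apply/rowP => b; rewrite mxE -gE_contr h0 gEE big1 ?mulr0 ?mxE // => j _.
  by rewrite big1 // => i _; rewrite mxE mulr0.
exists (bdet E ^+ 3 *: (h *m beta E)).
have -> : bdet E ^+ 4 *: h = bdet E ^+ 3 *: (h *m (bdet E)%:M).
  by rewrite mul_mx_scalar scalerA -exprSr.
by rewrite -(adj_T E) mulmxDr scalerDr !mulmxA scalemxAl ha mul0mx add0r scalemxAl.
Qed.

(** [beta E] inverts [J] on the right, up to [bdet E]. *)
Lemma rows_cancel E (I : set A) (l : 'rV[A]_c) : is_ideal I ->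
  (forall k, I ((l *m J) ord0 k)) -> forall j, I (bdet E * l ord0 j).
Proof.
move=> iI lI j; have [_ _ _ Jb] := T_adj E.
have -> : bdet E * l ord0 j = (l *m J *m beta E) ord0 j.
  by rewrite -mulmxA Jb mul_mx_scalar mxE.
by rewrite mxE; apply: ideal_sum => // k _; apply: idealMr.
Qed.

Lemma sum_rotate n (H : 'I_n -> 'I_n -> 'I_n -> A) :
  \sum_j \sum_i \sum_l H l i j = \sum_j \sum_i \sum_l H i j l.
Proof. by rewrite exchange_big; apply: eq_bigr => j _; rewrite exchange_big. Qed.

(** If the wedge product of the bivector of [h] with [x] is zero, so is the pairing
    of [h] with [x], to which it is proportional. *)
Lemma contr_pairing E h (x : 'cV[A]_(3 + c)) : J *m x = 0 ->
  (forall i j l, x l ord0 * contr h i j + x i ord0 * contr h j l + x j ord0 * contr h l i = 0) ->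
  bdet E ^+ 4 * (h *m x) ord0 ord0 = 0.
Proof.
move=> Jx xG.
have hx : bdet E * (h *m x) ord0 ord0 = \sum_b (h *m alpha E) ord0 b * (E *m x) b ord0.
  have -> : bdet E * (h *m x) ord0 ord0 = (h *m (bdet E)%:M *m x) ord0 ord0.
    by rewrite mul_mx_scalar -scalemxAl [RHS]mxE.
  by rewrite -(adj_T E) mulmxDr mulmxDl -!mulmxA Jx !mulmx0 addr0 mulmxA mxE.
rewrite exprSr -mulrA hx mulr_sumr.
under eq_bigr => b _ do rewrite mulrA -gE_contr -mulrA.
rewrite -mulr_sumr; set s := \sum_b _; suff -> : s = 0 by rewrite mulr0.
have [[n0 n1 n2] [p0 p1 p2]] := nxpvE.
have term b : gE E (contr h) (nx b) (pv b) * (E *m x) b ord0 =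
   \sum_j \sum_i \sum_l E (nx b) i * E (pv b) j * E b l * (x l ord0 * contr h i j).
  rewrite gEE [LHS]mulr_suml; apply: eq_bigr => j _; rewrite [LHS]mulr_suml; apply: eq_bigr => i _.
  by rewrite [(E *m x) _ _]mxE [LHS]mulr_sumr; apply: eq_bigr => l _; ring.
rewrite /s sum3 !term n0 n1 n2 p0 p1 p2; set C := contr h.
rewrite (sum_rotate (fun a b d => E o2 b * E o0 d * E o1 a * (x a ord0 * C b d))).
rewrite (sum_rotate (fun a b d => E o0 b * E o1 d * E o2 a * (x a ord0 * C b d))).
rewrite (sum_rotate (fun a b d => E o0 d * E o1 a * E o2 b * (x b ord0 * C d a))).
rewrite -!big_split big1 // => j _; rewrite -!big_split big1 // => i _.
rewrite -!big_split big1 // => l _ /=.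
transitivity (E o1 i * E o2 j * E o0 l *
  (x l ord0 * C i j + x i ord0 * C j l + x j ord0 * C l i)); first by ring.
by rewrite xG mulr0.
Qed.

(** The open sets where some [bdet E] is invertible cover the complement of the
    common zeros of [x], [y] and [z], which form a regular sequence. *)
Variables (EE : set 'M[A]_(3, 3 + c)) (x y z : A).
Hypothesis sat : forall I : set A, is_ideal I ->
  (forall E, EE E -> exists k, I (bdet E ^+ k)) ->
  exists N, [/\ I (x ^+ N.+1), I (y ^+ N.+1) & I (z ^+ N.+1)].
Hypothesis rx : forall N u, x ^+ N.+1 * u = 0 -> u = 0.
Hypothesis ry : forall N M u v, y ^+ M.+1 * u = x ^+ N.+1 * v ->
  exists w, u = x ^+ N.+1 * w.
Hypothesis rz : forall N M u v w, z ^+ M.+1 * u = x ^+ N.+1 * v + y ^+ N.+1 * w ->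
  exists v' w', u = x ^+ N.+1 * v' + y ^+ N.+1 * w'.

Lemma bdet_regular u : (forall E, EE E -> exists k, bdet E ^+ k * u = 0) -> u = 0.
Proof.
move=> u0; have [||N [xu _ _]] := @sat [set v | v * u = 0].
- split=> [|v w /= v0 w0|a v /= v0]; first by rewrite /= mul0r.
    by rewrite mulrDl v0 w0 addr0.
  by rewrite -mulrA v0 mulr0.
- by move=> E /u0[k uk]; exists k.
exact: rx xu.
Qed.

Lemma contr_rows0 (l : 'rV[A]_c) : contr (l *m J) = 0.
Proof.
apply/matrixP => i j; rewrite [RHS]mxE; apply: bdet_regular => E _; exists 3.
by have /matrixP/(_ i j) := contr_rows E l; rewrite mxE [RHS]mxE.
Qed.

Lemma rx_row N n (v w : 'rV[A]_n) : x ^+ N.+1 *: v = x ^+ N.+1 *: w -> v = w.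
Proof.
move=> /rowP vw; apply/rowP => j; apply/eqP; rewrite -subr_eq0; apply/eqP.
by apply: (@rx N); rewrite mulrBr; have := vw j; rewrite !mxE => ->; rewrite subrr.
Qed.

Lemma ry_row N M n (v w : 'rV[A]_n) : y ^+ M.+1 *: v = x ^+ N.+1 *: w ->
  exists v', v = x ^+ N.+1 *: v'.
Proof.
move=> /rowP vw.
have vx j : exists t, v ord0 j = x ^+ N.+1 * t.
  by apply: (@ry N M _ (w ord0 j)); have := vw j; rewrite !mxE.
have [t tP] := choice vx.
by exists (\row_j t j); apply/rowP => j; rewrite !mxE.
Qed.

Lemma contr_kernel h : contr h = 0 -> exists l : 'rV[A]_c, h = l *m J.
Proof.
move=> h0; have [||N [[l xl] _ _]] := @sat [set u | exists l : 'rV[A]_c, u *: h = l *m J].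
- split=> [|u v [k uk] [l vl]|a u [k uk]]; first by exists 0; rewrite scale0r mul0mx.
    by exists (k + l); rewrite scalerDl uk vl mulmxDl.
  by exists (a *: k); rewrite -scalerA uk scalemxAl.
- by move=> E _; exists 4; exact: rows_of_contr.
have [||M [_ yl _]] := @sat [set u | forall j, exists t, u * l ord0 j = x ^+ N.+1 * t].
- split=> [j|u v ul vl j|a u ul j]; first by exists 0; rewrite mul0r mulr0.
    have [s us] := ul j; have [t vt] := vl j.
    by exists (s + t); rewrite mulrDl us vt mulrDr.
  by have [s us] := ul j; exists (a * s); rewrite -mulrA us mulrCA.
- move=> E _; exists 1%N => j; rewrite expr1.
  apply: (@rows_cancel E [set u | exists t, u = x ^+ N.+1 * t]).
    split=> [|_ _ [s ->] [t ->]|a _ [s ->]]; first by exists 0; rewrite mulr0.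
      by exists (s + t); rewrite mulrDr.
    by exists (a * s); rewrite mulrCA.
  by move=> k; rewrite -xl mxE; exists (h ord0 k).
have [t tP] := choice yl.
have [|l' lE] := @ry_row N M c l (\row_j t j).
  by apply/rowP => j; rewrite !mxE tP.
exists l'; apply: (@rx_row N); rewrite xl lE.
by rewrite scalemxAl.
Qed.

(** On the open sets of [x] and [y], lifts [h1] and [h2] of [G] exist, and they
    differ by a combination of the rows of [J]. The coefficients [l] of this
    combination define a class of degree one for the covering by these two sets;
    they extend over the open set of [z], so the regularity of [z] splits them as
    a sum of coefficients defined on either set, which correct the lifts. *)
Theorem bivector_division G : (forall i, G i i = 0) ->
  (forall i j, G i j = - G j i) -> G *m J^T = 0 -> exists h, G = contr h.
Proof.
move=> G0 Ga GJ.
have [||N [[h1 h1E] [h2 h2E] _]] := @sat [set u | exists h, u *: G = contr h].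
- split=> [|u v [h uh] [k vk]|a u [h uh]]; first by exists 0; rewrite scale0r linear0.
    by exists (h + k); rewrite scalerDl uh vk linearD.
  by exists (a *: h); rewrite -scalerA uh linearZ.
- by move=> E _; exists 4; exact: contr_of_bivector.
have [l lE] : exists l : 'rV[A]_c, y ^+ N.+1 *: h1 - x ^+ N.+1 *: h2 = l *m J.
  apply: contr_kernel; rewrite linearB !linearZ /= -h1E -h2E scalerN !scalerA.
  by rewrite [x ^+ _ * _]mulrC subrr.
have [||M [_ _ zl]] := @sat [set u | forall j, exists s t,
    u * l ord0 j = x ^+ N.+1 * s + y ^+ N.+1 * t].
- split=> [j|u v ul vl j|a u ul j]; first by exists 0, 0; rewrite mul0r !mulr0 addr0.
    have [s [t us]] := ul j; have [s' [t' vs]] := vl j.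
    by exists (s + s'), (t + t'); rewrite mulrDl us vs; ring.
  by have [s [t us]] := ul j; exists (a * s), (a * t); rewrite -mulrA us; ring.
- move=> E _; exists 1%N => j; rewrite expr1.
  apply: (@rows_cancel E [set u | exists s t, u = x ^+ N.+1 * s + y ^+ N.+1 * t]).
    split=> [|_ _ [s [t ->]] [s' [t' ->]]|a _ [s [t ->]]].
    + by exists 0, 0; rewrite !mulr0 addr0.
    + by exists (s + s'), (t + t'); ring.
    + by exists (a * s), (a * t); ring.
  by move=> k; rewrite -lE !mxE; exists (- h2 ord0 k), (h1 ord0 k); ring.
have zl' j : exists st, l ord0 j = x ^+ N.+1 * st.1 + y ^+ N.+1 * st.2.
  have [s [t zst]] := zl j; have [s' [t' ->]] := rz zst.
  by exists (s', t').
have [st stP] := choice zl'.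
pose l1 := \row_j (st j).2; pose l2 := \row_j (st j).1.
have lE' : l = x ^+ N.+1 *: l2 + y ^+ N.+1 *: l1.
  by apply/rowP => j; rewrite !mxE stP.
have [|h' h'E] := @ry_row N N _ (h1 - l1 *m J) (h2 + l2 *m J).
  have yh : y ^+ N.+1 *: h1 = l *m J + x ^+ N.+1 *: h2 by rewrite -lE subrK.
  rewrite scalerBr scalerDr yh lE' mulmxDl !scalemxAl.
  by rewrite [X in X - _]addrAC addrK addrC.
exists h'; apply/matrixP => i j; apply/eqP; rewrite -subr_eq0; apply/eqP.
apply: (@rx N); rewrite mulrBr.
have /matrixP/(_ i j) : x ^+ N.+1 *: G = x ^+ N.+1 *: contr h'.
  by rewrite -linearZ /= -h'E linearB /= contr_rows0 subr0.
by rewrite !mxE => ->; rewrite subrr.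
Qed.

Lemma contr_pairing0 h (t : 'cV[A]_(3 + c)) : J *m t = 0 ->
  (forall i j l, t l ord0 * contr h i j + t i ord0 * contr h j l + t j ord0 * contr h l i = 0) ->
  (h *m t) ord0 ord0 = 0.
Proof. by move=> Jt tG; apply: bdet_regular => E _; exists 4; exact: contr_pairing. Qed.

End Division.

(** * The degree bound for bivectors on a smooth complete intersection *)

Section Quotient.
Variables (S : comNzRingType) (I : set S).
Hypotheses (iI : is_ideal I) (I1 : ~ I 1).

Definition ideal_pred : pred S := fun u => `[< I u >].

Lemma ideal_pred_closed : idealr_closed ideal_pred.
Proof.
split; rewrite ?unfold_in; first by apply/asboolP; apply: ideal0.
- by apply/asboolPn.
- move=> a u v; rewrite !unfold_in => /asboolP Iu /asboolP Iv.
  by apply/asboolP; apply: idealD => //; apply: idealMl.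
Qed.

Lemma quotient_ring : exists (A : comNzRingType) (pi : {rmorphism S -> A}),
  (forall a, exists u, a = pi u) /\ (forall u, pi u = 0 <-> I u).
Proof.
pose II : idealr S := HB.pack ideal_pred (isIdealr.Build S ideal_pred ideal_pred_closed).
pose Q := {ideal_quot II}; exists Q.
pose pi : S -> Q := \pi_Q%qT.
have pi_zmod : zmod_morphism pi by move=> u v; rewrite /pi !piE.
have pi_mon : monoid_morphism pi by split=> [|u v]; rewrite /pi !piE.
pose pM : {rmorphism S -> Q} := HB.pack pi
  (GRing.isZmodMorphism.Build _ _ pi pi_zmod) (GRing.isMonoidMorphism.Build _ _ pi pi_mon).
exists pM; split=> [a|u]; first by exists (repr a); rewrite /pM /= /pi reprK.
have piE0 : (pi u == pi 0) = (u \in ideal_pred).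
  by rewrite -(subr0 u) [RHS](Quotient.idealrBE II) subr0.
rewrite -(rmorph0 pM); split.
  by move=> /eqP; rewrite piE0 unfold_in => /asboolP.
by move=> Iu; apply/eqP; rewrite piE0 unfold_in; apply/asboolP.
Qed.

End Quotient.

Section HomogeneousDet.
Variables (K : closedFieldType) (m : nat).
Local Notation S := {mpoly K[m]}.
Local Notation hcomp e u := (pihomog mdeg e u).

Lemma mderiv_homog e (u : S) k : u \is e.-homog -> u^`M(k) \is e.-1.-homog.
Proof.
move=> hu; apply/dhomogP => x; rewrite mcoeff_msupp mcoeff_deriv => x0.
have : (x + U_(k))%MM \in msupp u.
  by rewrite mcoeff_msupp; apply: contraNneq x0 => ->; rewrite mul0rn.
by move=> /(dhomogP _ _ _ hu) /= <-; rewrite mdegD mdeg1 addn1.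
Qed.

Lemma euler e (u : S) : u \is e.-homog -> \sum_k 'X_k * u^`M(k) = u *+ e.
Proof.
move=> /dhomogP hu; rewrite {2}[u]mpolyE.
transitivity (\sum_(x <- msupp u) \sum_k 'X_k * (u@_x *: 'X_[x])^`M(k)).
  rewrite exchange_big /=; apply: eq_bigr => k _.
  by rewrite {1}[u]mpolyE raddf_sum mulr_sumr.
rewrite -sumrMnl; apply: eq_big_seq => x /hu /= <-.
rewrite mdegE -sumrMnr; apply: eq_bigr => k _.
rewrite mderivZ mderivX -scalerAr -scalerAr -mpolyXD.
have [->|xk] := eqVneq (x k) 0%N; first by rewrite scale0r scaler0.
rewrite addmC submK ?lep1mP // -scaler_nat scalerA mulrC -scalerA scaler_nat.
by rewrite scalerMnr.
Qed.

Lemma prod_homog (T : Type) (r : seq T) (d : T -> nat) (F : T -> S) :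
  (forall i, F i \is (d i).-homog) ->
  \prod_(i <- r) F i \is (\sum_(i <- r) d i).-homog.
Proof.
move=> hF; elim/big_rec2: _ => [|i e a _ ha]; first exact: dhomog1.
exact: dhomogM.
Qed.

Lemma det_homog n (M : 'M[S]_n) (d : 'I_n -> nat) :
  (forall i j, M i j \is (d i).-homog) -> \det M \is (\sum_i d i).-homog.
Proof.
move=> hM; apply: rpred_sum => s _; rewrite mulr_sign.
by case: ifP => _; rewrite ?dhomogN; apply: prod_homog.
Qed.

Lemma inI_hcomp1 (s : seq S) u :
  (forall a, a \in s -> exists2 e, (2 <= e)%N & a \is e.-homog) ->
  inI s u -> hcomp 1 u = 0.
Proof.
elim: s u => [|a s IH] u hs /=; first by move=> ->; rewrite pihomog0.
have [e e2 ha] : exists2 e, (2 <= e)%N & a \is e.-homog by apply: hs; rewrite mem_head.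
move=> [v /IH]; rewrite pihomogB (hcompM _ _ ha) leqNgt e2 subr0; apply.
by move=> b bs; apply: hs; rewrite inE bs orbT.
Qed.

End HomogeneousDet.

Section Bound.
Variables (K : closedFieldType) (c : nat).
Local Notation m := (3 + c)%N.
Local Notation S := {mpoly K[m]}.
Local Notation hcomp e u := (pihomog mdeg e u).
Hypotheses (hK : uncountable K) (hc : (0 < c)%N).
Variables (f : 'I_c -> S) (dg : 'I_c -> nat).
Hypotheses (hf : forall j, f j \is (dg j).-homog) (hdg : forall j, (2 <= dg j)%N).
Hypothesis smooth : forall p : 'rV[K]_m, p != 0 -> (forall j, (f j).@[p ord0] = 0) ->
  row_free (\matrix_(j, k) ((f j)^`M(k)).@[p ord0]).
Let F := codom f.
Let sigma := (\sum_j (dg j).-1)%N.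

Let pf j : posdeg (f j).
Proof. by exists (dg j) => //; apply: leq_trans (hdg j). Qed.

(** The determinant has one row of degree [dg j - 1] for each equation, and three
    constant rows. *)
Lemma ctensor_homog i j l : ctensor (jac f) i j l \is sigma.-homog.
Proof.
have := @det_homog K m _ (col_mx (\matrix_(a < 3, k < 3 + c) (k == nth i [:: i; j; l] a)%:R) (jac f))
  (fun x => match split x with inl _ => 0%N | inr a => (dg a).-1 end).
rewrite big_split_ord /= big1 ?add0n => [|a _]; last by rewrite (unsplitK (inl a)).
have -> : (\sum_(a < c) match split (rshift 3 a) with inl _ => 0 | inr b => (dg b).-1 end = sigma)%N.
  by apply: eq_bigr => a _; rewrite (unsplitK (inr a)).
apply=> x k; rewrite mxE; case: split => a; rewrite mxE.
  by case: eqP => _; [exact: dhomog1 | exact: rpred0].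
exact: mderiv_homog.
Qed.

Lemma complement_row n k (J : 'M[K]_(n, k + n)) : row_free J ->
  exists E : 'M[K]_(k, k + n), \det (col_mx E J) != 0.
Proof.
move=> fJ; have rk : \rank (J^C)%MS = k by rewrite mxrank_compl (eqP fJ) addnK.
exists (castmx (rk, erefl) (row_base J^C%MS)).
rewrite -unitfE -unitmxE -row_full_unit -sub1mx.
apply: submx_trans (_ : (J + J^C <= _)%MS); first by rewrite sub1mx addsmx_compl_full.
rewrite addsmxC -addsmxE; apply: addsmxS => //.
by rewrite eqmx_cast eq_row_base.
Qed.

Section Transfer.
Variables (A : comNzRingType) (pi : {rmorphism S -> A}).
Hypotheses (pis : forall a, exists u, a = pi u) (pi0 : forall u, pi u = 0 <-> inI F u).
Variable L : 'M[K]_(3, m).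
Hypothesis osL : only_origin (lins L ++ F).

Let l i := lin (row i L).
Let JA := map_mx pi (jac f).
Let constE : set 'M[A]_(3, m) :=
  [set E | exists E' : 'M[K]_(3, m), E = map_mx pi (map_mx (@mpolyC m K) E')].

Lemma pi_ctensor i j k : pi (ctensor (jac f) i j k) = ctensor JA i j k.
Proof.
rewrite /ctensor -det_map_mx map_col_mx; congr (\det (col_mx _ _)).
by apply/matrixP => a b; rewrite !mxE rmorph_nat.
Qed.

(** At a point of the cone off the vertex, constant vectors complete the rows of the
    Jacobian matrix to a basis. By the Nullstellensatz, the ideal thus contains
    powers of the parameters. *)
Lemma bdet_saturation (I : set A) : is_ideal I ->
  (forall E, constE E -> exists k, I (bdet JA E ^+ k)) ->
  exists N, [/\ I (pi (l ord0) ^+ N.+1), I (pi (l (inord 1)) ^+ N.+1) &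
    I (pi (l (inord 2)) ^+ N.+1)].
Proof.
move=> iI bI; pose I' : set S := [set u | I (pi u)].
have iI' : is_ideal I'.
  split=> [|u v Iu Iv|a u Iu]; rewrite /I' /= ?rmorph0 ?rmorphD ?rmorphM.
  - exact: ideal0.
  - exact: idealD.
  - exact: idealMl.
have fI' j : I' (f j).
  rewrite /I' /= (_ : pi (f j) = 0); first exact: ideal0.
  by apply/pi0/inI_mem/codom_f.
have ex i : exists k, I' (l i ^+ k).
  apply: (cone_ideal hK iI' fI') => [p p0 fp|]; last first.
    by apply: posdeg_eval0; exact: posdeg_lin.
  have [E Ep] := complement_row (smooth p0 fp).
  have [k bk] := bI (map_mx pi (map_mx (@mpolyC m K) E)) (ex_intro _ E erefl).
  exists (\det (col_mx (map_mx (@mpolyC m K) E) (jac f)) ^+ k).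
    rewrite /I' /= rmorphXn /= -det_map_mx map_col_mx; exact: bk.
  rewrite rmorphXn /= expf_neq0 // -det_map_mx map_col_mx.
  have -> : map_mx (meval (p ord0)) (map_mx (@mpolyC m K) E) = E.
    by apply/matrixP => a b; rewrite !mxE mevalC.
  have -> // : map_mx (meval (p ord0)) (jac f) = \matrix_(j, k) ((f j)^`M(k)).@[p ord0].
  by apply/matrixP => a b; rewrite !mxE.
have [k kP] := choice ex.
exists (\sum_i k i)%N.
have lI i : I (pi (l i) ^+ (\sum_i k i).+1).
  have ki : (k i <= (\sum_i k i).+1)%N by rewrite (bigD1 i) //= -addnS leq_addr.
  rewrite -(subnK ki) exprD; apply: idealMl => //.
  by rewrite -rmorphXn; exact: kP.
by split.
Qed.

Lemma posdeg_exp (u : S) k : posdeg u -> posdeg (u ^+ k.+1).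
Proof. by move=> [e e0 hu]; exists (e * k.+1)%N; rewrite ?muln_gt0 ?e0 // dhomogMn. Qed.

Lemma powers_regular N1 N2 N3 :
  regular_seq ([:: l (inord 2) ^+ N3.+1; l (inord 1) ^+ N2.+1; l ord0 ^+ N1.+1] ++ F).
Proof.
have pl i k : posdeg (l i ^+ k.+1) by apply: posdeg_exp; exact: posdeg_lin.
apply: (parameters_regular hK pf) => // p pz; apply: osL => a.
rewrite mem_cat => /orP[/mem_lins[i ->]|aF]; last by apply: pz; rewrite mem_cat aF orbT.
have ev j k : (l j ^+ k.+1).@[p ord0] = 0 -> (l j).@[p ord0] = 0.
  by rewrite rmorphXn /= => /eqP; rewrite expf_eq0 => /andP[_ /eqP].
have [->|->|->] : [\/ i = ord0, i = inord 1 | i = inord 2].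
  case: i => -[|[|[|//]]] i3; [apply: Or31|apply: Or32|apply: Or33]; apply: val_inj;
    by rewrite /= ?inordK.
- by apply: (ev _ N1); apply: pz; rewrite !inE eqxx !orbT.
- by apply: (ev _ N2); apply: pz; rewrite !inE eqxx !orbT.
- by apply: (ev _ N3); apply: pz; rewrite !inE eqxx.
Qed.

Let x := pi (l ord0).
Let y := pi (l (inord 1)).
Let z := pi (l (inord 2)).

Lemma quot_rx N u : x ^+ N.+1 * u = 0 -> u = 0.
Proof.
have [_ [_ [nx _]]] := powers_regular N 0 0; have [v ->] := pis u.
by rewrite -rmorphXn -rmorphM => /pi0/nx/pi0.
Qed.

Lemma quot_ry N M u v : y ^+ M.+1 * u = x ^+ N.+1 * v -> exists w, u = x ^+ N.+1 * w.
Proof.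
have [_ [ny _]] := powers_regular N M 0; have [u' ->] := pis u; have [v' ->] := pis v.
rewrite -!rmorphXn -!rmorphM => yx.
have [|w /pi0] := ny u'.
  by exists v'; apply/pi0; rewrite rmorphB yx mulrC subrr.
rewrite rmorphB => /eqP; rewrite subr_eq0 => /eqP ->.
by exists (pi w); rewrite !rmorphM mulrC.
Qed.

Lemma quot_rz N M u v w : z ^+ M.+1 * u = x ^+ N.+1 * v + y ^+ N.+1 * w ->
  exists v' w', u = x ^+ N.+1 * v' + y ^+ N.+1 * w'.
Proof.
have [nz _] := powers_regular N N M.
have [u' ->] := pis u; have [v' ->] := pis v; have [w' ->] := pis w.
rewrite -!rmorphXn -!rmorphM -rmorphD => zxy.
have [|b [a /pi0 uE]] := nz u'.
  exists w', v'; apply/pi0; rewrite !rmorphB zxy rmorphD /=.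
  by rewrite ![_ ^+ _ * _]mulrC addrK subrr.
exists (pi a), (pi b); move: uE; rewrite !rmorphB !rmorphM /= => /eqP.
rewrite subr_eq add0r subr_eq => /eqP ->.
by rewrite [X in X + _]mulrC [X in _ + X]mulrC.
Qed.

End Transfer.

Definition on_cone (p : 'rV[K]_m) := p != 0 /\ forall j, (f j).@[p ord0] = 0.

(** A bivector [G] tangent to the cone is [contr h] for a vector [h] of forms of
    degree [e - sigma]: it is zero if [e < sigma], and if [e = sigma] then [h]
    is a constant vector and [G /\ x = 0] forces the linear form of [h] to
    vanish on the cone, which lies on no hyperplane since its equations have
    degree at least two. *)
Theorem bivector_degree (G : 'M[S]_m) e :
  (forall i j, G i j \is e.-homog) ->
  (forall p, on_cone p -> forall i, (G i i).@[p ord0] = 0) ->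
  (forall p, on_cone p -> forall i j, (G i j).@[p ord0] = - (G j i).@[p ord0]) ->
  (forall p, on_cone p -> forall i q,
     \sum_j (G i j).@[p ord0] * ((f q)^`M(j)).@[p ord0] = 0) ->
  (forall p, on_cone p -> forall i j l, p ord0 l * (G i j).@[p ord0] +
     p ord0 i * (G j l).@[p ord0] + p ord0 j * (G l i).@[p ord0] = 0) ->
  (exists p i j, on_cone p /\ (G i j).@[p ord0] != 0) ->
  (sigma < e)%N.
Proof.
move=> hG G0 Ga GJ Gx [p0 [i0 [j0 [[p00 fp0] Gp0]]]].
have [L osL] := three_parameters hK pf smooth erefl hc.
have F1 : ~ inI F 1 by exact: inI1.
have [A [pi [pis pi0]]] := quotient_ring (inI_ideal F) F1.
have red u : (forall p, on_cone p -> u.@[p ord0] = 0) -> pi u = 0.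
  move=> u0; apply/pi0/(cone_reduced hK pf smooth erefl osL) => p pn0 fp.
  by apply: u0.
have sat := bdet_saturation pi0 L.
have rx := quot_rx pis pi0 osL.
have nzF u : inI F u -> u.@[p0 ord0] = 0 by exact: inI_cone.
pose GA := map_mx pi G; pose JA := map_mx pi (jac f).
have [h0 h0E] : exists h, GA = contr JA h.
  apply: (bivector_division sat rx (quot_ry pis pi0 osL) (quot_rz pis pi0 osL)).
  - by move=> i; rewrite mxE red // => p /G0.
  - move=> i j; rewrite !mxE; apply/eqP; rewrite -subr_eq0 opprK -rmorphD red // => p cp.
    by rewrite mevalD (Ga p cp i j) addNr.
  - apply/matrixP => i q; rewrite !mxE -[RHS](red (\sum_j G i j * (f q)^`M(j))).
      by rewrite rmorph_sum; apply: eq_bigr => j _; rewrite !mxE rmorphM.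
    move=> p cp; rewrite -[RHS](GJ p cp i q) raddf_sum; apply: eq_bigr => j _.
    by rewrite /= mevalM.
have [u uE] := choice (fun l => pis (h0 ord0 l)).
have GE i j : inI F (G i j - \sum_l u l * ctensor (jac f) i j l).
  apply/pi0; rewrite rmorphB rmorph_sum /=.
  have /matrixP/(_ i j) := h0E; rewrite !mxE => ->; apply/eqP; rewrite subr_eq0; apply/eqP.
  by apply: eq_bigr => l _; rewrite rmorphM /= -uE pi_ctensor.
have GEe i j : inI F (G i j - \sum_l
    (if (sigma <= e)%N then hcomp (e - sigma) (u l) * ctensor (jac f) i j l else 0)).
  have := inI_hcomp e (posdeg_codom pf) (GE i j).
  have cE : hcomp e (\sum_l u l * ctensor (jac f) i j l) = \sum_l
      (if (sigma <= e)%N then hcomp (e - sigma) (u l) * ctensor (jac f) i j l else 0).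
    rewrite (linear_sum (pihomog mdeg e)); apply: eq_bigr => l _.
    exact: (hcompM e (u l) (ctensor_homog i j l)).
  by rewrite pihomogB (pihomog_dE (hG i j)) cE.
case: (ltngtP sigma e) => // es; [have := GEe i0 j0 | ].
  rewrite leqNgt es /= big1 // subr0 => /nzF G00.
  by rewrite G00 eqxx in Gp0.
pose h := \row_l pi (hcomp 0 (u l)).
have hE : GA = contr JA h.
  apply/matrixP => i j; apply/eqP; rewrite -subr_eq0; apply/eqP.
  rewrite !mxE -[RHS](iffRL (pi0 _) (GEe i j)) es leqnn subnn rmorphB rmorph_sum /=.
  by congr (_ - _); apply: eq_bigr => l _; rewrite mxE rmorphM /= pi_ctensor.
pose t : 'cV[A]_m := \col_k pi 'X_k.
have ht : (h *m t) ord0 ord0 = 0.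
  apply: (contr_pairing0 sat rx (J := JA)).
    apply/matrixP => q k; rewrite !mxE -[RHS](red (f q *+ dg q)) => [|p [_ fp]].
      rewrite -(euler (hf q)) rmorph_sum; apply: eq_bigr => j _.
      by rewrite !mxE -rmorphM mulrC.
    by rewrite mevalMn fp mul0rn.
  move=> i j l; rewrite -hE !mxE -!rmorphM -!rmorphD red // => p cp.
  by rewrite !mevalD !mevalM !mevalXU Gx.
pose w : 'rV[K]_m := \row_l (hcomp 0 (u l))@_0.
have uw l : hcomp 0 (u l) = (w ord0 l)%:MP.
  by rewrite mxE; apply: msize1_polyC; apply: homog_msize_le; exact: pihomogP.
have w0 : w = 0.
  apply: lin_inj; rewrite -(pihomog_dE (lin_homog w)).
  apply: (@inI_hcomp1 _ _ F) => [_ /codomP[j ->]|]; first by exists (dg j).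
  apply/pi0; rewrite -ht mxE rmorph_sum; apply: eq_bigr => l _.
  by rewrite -mul_mpolyC rmorphM -uw [h _ _]mxE [t _ _]mxE.
have /pi0/nzF G00 : pi (G i0 j0) = 0.
  have /matrixP/(_ i0 j0) := hE; rewrite !mxE => ->; apply: big1 => l _.
  by rewrite mxE uw w0 mxE mpolyC0 rmorph0 mul0r.
by rewrite G00 eqxx in Gp0.
Qed.

End Bound.

(** * Tangent fields in homogeneous coordinates *)

Section Sheaf.
Variables (K : closedFieldType) (n c : nat).
Variable f : 'I_c -> {mpoly K[n.+1]}.
Local Notation S := {mpoly K[n.+1]}.
Local Notation P := 'rV[K]_n.+1.
Hypothesis fhom : forall j, exists e, f j \is e.-homog.
Implicit Types (U V W : set P) (phi psi : P -> K) (p q : P).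

Lemma open_basic (h : S) e : h \is e.-homog ->
  zariski_open f [set p | cone f p /\ h.@[p ord0] != 0].
Proof.
move=> hh; exists [set b | b = h]; first by move=> b /= ->; exists e.
apply/seteqP; split=> p [fp]; first by split=> //; exists h.
by case=> b /= ->.
Qed.

Lemma open_cone V p : zariski_open f V -> V p -> cone f p.
Proof. by move=> [B _ ->] []. Qed.

Lemma open_nbhs V p : zariski_open f V -> V p ->
  exists2 h : S, (exists e, h \is e.-homog) /\ h.@[p ord0] != 0 &
    forall q, cone f q -> h.@[q ord0] != 0 -> V q.
Proof.
by move=> [B BH ->] [fp [h Bh hp]]; exists h => [|q fq hq]; [split=> //; exact: BH|split=> //; exists h].
Qed.

Lemma open_setI U V : zariski_open f U -> zariski_open f V -> zariski_open f (U `&` V).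
Proof.
move=> [B BH ->] [C CH ->].
exists [set h | exists b c, [/\ B b, C c & h = b * c]].
  move=> _ [b [d [/BH[e1 hb] /CH[e2 hd] ->]]]; exists (e1 + e2)%N; exact: dhomogM.
apply/seteqP; split=> p.
  move=> [[fp [b Bb bp]] [_ [d Cd dp]]]; split=> //; exists (b * d).
    by exists b, d.
  by rewrite mevalM mulf_neq0.
move=> [fp [_ [b [d [Bb Cd ->]]]]]; rewrite mevalM mulf_eq0 negb_or => /andP[bp dp].
by split; split=> //; [exists b | exists d].
Qed.

Lemma open_chart i : zariski_open f (chart f i).
Proof.
have hX : ('X_i : S) \is 1.-homog by rewrite dhomogX /= mdeg1.
have -> : chart f i = [set p | cone f p /\ ('X_i : S).@[p ord0] != 0].
  by apply/seteqP; split=> p [fp] /= pi0; split; rewrite // mevalXU in pi0 *.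
exact: open_basic hX.
Qed.

Lemma coneZ p (t : K) : t != 0 -> cone f p -> cone f (t *: p).
Proof.
move=> t0 [p0 fp]; split; first by rewrite scaler_eq0 negb_or t0.
by move=> j; have [e he] := fhom j; rewrite (homog_scale _ _ he) fp mulr0.
Qed.

Lemma openZ V p (t : K) : zariski_open f V -> t != 0 -> V p -> V (t *: p).
Proof.
move=> [B BH ->] t0 [fp [h Bh hp]]; split; first exact: coneZ.
exists h => //; have [e hh] := BH h Bh.
by rewrite (homog_scale _ _ hh) mulf_neq0 // expf_neq0.
Qed.

Lemma regular_eq U phi psi : (forall p, U p -> phi p = psi p) ->
  regular f U phi -> regular f U psi.
Proof.
move=> pp rp p Up; have [V [e [g [h [[oV Vp VU] [hg hh gh]]]]]] := rp p Up.
exists V, e, g, h; split=> //; split=> // q Vq.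
by rewrite -pp; [exact: gh | exact: VU].
Qed.

Lemma regular_sub U W phi : zariski_open f W -> W `<=` U ->
  regular f U phi -> regular f W phi.
Proof.
move=> oW WU rp p Wp; have [V [e [g [h [[oV Vp VU] [hg hh gh]]]]]] := rp p (WU p Wp).
exists (V `&` W), e, g, h; split; last by split=> // q [/gh].
by split; [exact: open_setI | split | move=> q []].
Qed.

Lemma regular_quot U e (g h : S) phi : zariski_open f U -> g \is e.-homog -> h \is e.-homog ->
  (forall q, U q -> h.@[q ord0] != 0 /\ phi q = g.@[q ord0] / h.@[q ord0]) ->
  regular f U phi.
Proof. by move=> oU hg hh gh p Up; exists U, e, g, h; split; split. Qed.

Lemma regular_cst U (a : K) : zariski_open f U -> regular f U (fun=> a).
Proof.
move=> oU; apply: (@regular_quot _ 0 a%:MP 1) => //; last first.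
- by move=> q _; rewrite meval1 mevalC oner_neq0 divr1.
- exact: dhomog1.
- have -> : a%:MP = a *: (1 : S) by rewrite -mul_mpolyC mulr1.
  by apply: rpredZ; exact: dhomog1.
Qed.

Lemma regularD U phi psi : regular f U phi -> regular f U psi ->
  regular f U (fun q => phi q + psi q).
Proof.
move=> r1 r2 p Up; have [V1 [e1 [g1 [h1 [[o1 V1p VU1] [hg1 hh1 gh1]]]]]] := r1 p Up.
have [V2 [e2 [g2 [h2 [[o2 V2p VU2] [hg2 hh2 gh2]]]]]] := r2 p Up.
exists (V1 `&` V2), (e1 + e2)%N, (g1 * h2 + g2 * h1), (h1 * h2); split.
  by split; [exact: open_setI | split | move=> q [/VU1]].
split; [|exact: dhomogM|].
  by apply: rpredD; [|rewrite addnC]; apply: dhomogM.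
move=> q [/gh1[h1q ->] /gh2[h2q ->]]; rewrite !(mevalM, mevalD) mulf_neq0 //.
by split=> //; field; rewrite h1q h2q.
Qed.

Lemma regularM U phi psi : regular f U phi -> regular f U psi ->
  regular f U (fun q => phi q * psi q).
Proof.
move=> r1 r2 p Up; have [V1 [e1 [g1 [h1 [[o1 V1p VU1] [hg1 hh1 gh1]]]]]] := r1 p Up.
have [V2 [e2 [g2 [h2 [[o2 V2p VU2] [hg2 hh2 gh2]]]]]] := r2 p Up.
exists (V1 `&` V2), (e1 + e2)%N, (g1 * g2), (h1 * h2); split.
  by split; [exact: open_setI | split | move=> q [/VU1]].
split; [exact: dhomogM | exact: dhomogM |].
move=> q [/gh1[h1q ->] /gh2[h2q ->]]; rewrite !mevalM mulf_neq0 //.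
by split=> //; rewrite mulf_div.
Qed.

Lemma regularZ U phi p (t : K) : t != 0 -> U p -> regular f U phi -> phi (t *: p) = phi p.
Proof.
move=> t0 Up r; have [V [e [g [h [[oV Vp VU] [hg hh gh]]]]]] := r p Up.
have [hp ->] := gh p Vp; have [_ ->] := gh _ (openZ oV t0 Vp).
rewrite (homog_scale _ _ hg) (homog_scale _ _ hh) invfM mulrACA mulfV ?mul1r //.
by rewrite expf_neq0.
Qed.

Definition dehom i (g : S) q : K := g.@[fun k => q ord0 k / q ord0 i].

Lemma dehomE i e (g : S) q : g \is e.-homog -> dehom i g q = g.@[q ord0] / q ord0 i ^+ e.
Proof.
move=> hg; rewrite mulrC -exprVn -(homog_scale _ _ hg); apply: meval_eq => k.
by rewrite mxE mulrC.
Qed.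

Lemma dehom_regular i g : regular f (chart f i) (dehom i g).
Proof.
rewrite (hcomp_sum g).
elim: (msize g) => [|d IH].
  rewrite big_ord0; apply: (regular_eq _ (regular_cst 0 (open_chart i))) => p _.
  by rewrite /dehom meval0.
rewrite big_ord_recr /=; set u := \sum_(_ < d) _ in IH *.
have hd := pihomogP mdeg d g; set v := pihomog mdeg d g in hd *.
apply: (@regular_eq _ (fun q => dehom i u q + dehom i v q)).
  by move=> p _; rewrite /dehom mevalD.
apply: regularD => //.
apply: (@regular_quot _ d v ('X_i ^+ d)) => [||| q [fq qi]] //.
- exact: open_chart.
- by have := @dhomogMn _ _ mdeg 1 ('X_i : S) d; rewrite mul1n; apply; rewrite dhomogX /= mdeg1.
- by rewrite (dehomE _ _ hd) rmorphXn /= mevalXU expf_neq0.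
Qed.

Section Derivation.
Variables (U : set P) (D : tangent_field f U).

Lemma td_sub V W phi p : zariski_open f V -> zariski_open f W -> W `<=` V -> V `<=` U ->
  regular f V phi -> W p -> D W phi p = D V phi p.
Proof. by move=> oV oW WV VU r Wp; apply: td_local => //; exact: regular_sub r. Qed.

Lemma td_eq V phi psi p : zariski_open f V -> V `<=` U -> regular f V phi ->
  (forall q, V q -> psi q = phi q) -> V p -> D V psi p = D V phi p.
Proof.
move=> oV VU r pp Vp; apply: td_local => //.
by apply: regular_eq r => q Vq; rewrite pp.
Qed.

Lemma td_cst V (a : K) p : zariski_open f V -> V `<=` U -> V p -> D V (fun=> a) p = 0.
Proof.
move=> oV VU Vp; have rc b := regular_cst b oV.
have D0 : D V (fun=> 0) p = 0.
  have := td_linear D 1 oV VU (rc 0) (rc 0) Vp.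
  rewrite (@td_eq V (fun=> 0) _ p oV VU (rc 0)) // => [|q _]; last by rewrite mul1r addr0.
  by rewrite mul1r => /eqP; rewrite -subr_eq0 opprD addNKr oppr_eq0 => /eqP.
have D1 : D V (fun=> 1) p = 0.
  have := td_leibniz D oV VU (rc 1) (rc 1) Vp.
  rewrite (@td_eq V (fun=> 1) _ p oV VU (rc 1)) // => [|q _]; last by rewrite mul1r.
  by rewrite mul1r mulr1 => /eqP; rewrite -subr_eq0 opprD addNKr oppr_eq0 => /eqP.
have := td_linear D a oV VU (rc 1) (rc 0) Vp.
rewrite (@td_eq V (fun=> a) _ p oV VU (rc a)) // => [->|q _]; last by rewrite mulr1 addr0.
by rewrite D1 D0 mulr0 addr0.
Qed.

Lemma td_add V phi psi p : zariski_open f V -> V `<=` U -> regular f V phi -> regular f V psi ->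
  V p -> D V (fun q => phi q + psi q) p = D V phi p + D V psi p.
Proof.
move=> oV VU r1 r2 Vp; have := td_linear D 1 oV VU r1 r2 Vp; rewrite mul1r => <-.
apply: td_eq => // [|q _]; last by rewrite mul1r.
by apply: regularD => //; apply: regularM => //; exact: regular_cst.
Qed.

(** The chain rule in the affine coordinates of a chart. *)
Lemma td_dehom i (g : S) p : chart f i `<=` U -> chart f i p ->
  D (chart f i) (dehom i g) p =
  \sum_k dehom i g^`M(k) p * D (chart f i) (fun q => q ord0 k / q ord0 i) p.
Proof.
move=> iU ip; set V := chart f i; have oV : zariski_open f V by exact: open_chart.
set th := fun k => D V (fun q => q ord0 k / q ord0 i) p.
have st2 (u v : S) : D V (dehom i u) p = \sum_k dehom i u^`M(k) p * th k ->
    D V (dehom i v) p = \sum_k dehom i v^`M(k) p * th k ->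
    D V (dehom i (u * v)) p = \sum_k dehom i (u * v)^`M(k) p * th k.
  move=> IHu IHv.
  rewrite (@td_eq V (fun q => dehom i u q * dehom i v q)) //; first last.
  - by move=> q _; rewrite /dehom mevalM.
  - by apply: regularM; exact: dehom_regular.
  rewrite (td_leibniz D oV iU (@dehom_regular _ _) (@dehom_regular _ _) ip) IHu IHv.
  rewrite mulr_suml mulr_sumr -big_split; apply: eq_bigr => k _.
  by rewrite /dehom mderivM mevalD !mevalM /=; ring.
have stC (a : K) : D V (dehom i a%:MP) p = \sum_k dehom i (a%:MP : S)^`M(k) p * th k.
  rewrite (@td_eq V (fun=> a)) //; first last.
  - by move=> q _; rewrite /dehom mevalC.
  - exact: regular_cst.
  by rewrite td_cst // big1 // => k _; rewrite mderivC /dehom meval0 mul0r.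
have stX k : D V (dehom i 'X_k) p = \sum_l dehom i ('X_k : S)^`M(l) p * th l.
  have -> : D V (dehom i 'X_k) p = th k.
    rewrite /th; congr (D V _ p); apply/funext => q; by rewrite /dehom mevalXU.
  rewrite (bigD1 k) //= big1 ?addr0 => [|l lk].
    by rewrite mderivX mnm1E eqxx scale1r -{1}[U_(k)%MM]add0m addmK /dehom mpolyX0 meval1 mul1r.
  by rewrite mderivX mnm1E eq_sym (negPf lk) scale0r /dehom meval0 mul0r.
elim/mpolyind: g => [|a x g _ _ IH].
  by rewrite -mpolyC0; exact: stC.
rewrite (@td_eq V (fun q => dehom i (a *: 'X_[x]) q + dehom i g q)) //; first last.
- by move=> q _; rewrite /dehom mevalD.
- by apply: regularD; exact: dehom_regular.
rewrite td_add //; try exact: dehom_regular.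
rewrite IH -mul_mpolyC (st2 a%:MP) //; last first.
  rewrite mpolyXE_id; elim/big_rec: _ => [|k u _ IHu]; first exact: (stC 1).
  apply: (st2) => //; elim: (x k) => [|b IHb]; first exact: (stC 1).
  by rewrite exprS; apply: st2.
rewrite -big_split; apply: eq_bigr => k _.
by rewrite /dehom mderivD mevalD mulrDl.
Qed.

End Derivation.
End Sheaf.

Section Bivector.
Variables (K : closedFieldType) (n c : nat).
Variable f : 'I_c -> {mpoly K[n.+1]}.
Local Notation S := {mpoly K[n.+1]}.
Local Notation P := 'rV[K]_n.+1.
Variable dg : 'I_c -> nat.
Hypothesis fdg : forall j, f j \is (dg j).-homog.
Variables (m : int) (s : twisted_field f m).
Implicit Types (p q : P) (i k a b : 'I_n.+1).

Let fhom j : exists e, f j \is e.-homog.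
Proof. by exists (dg j). Qed.

Definition acoord i k : P -> K := fun q => q ord0 k / q ord0 i.

(** The coordinates, in the chart [i], of the vector field in which the [i]-th
    homogeneous coordinate is kept constant. *)
Definition theta i k p : K := s i (chart f i) (acoord i k) p.

Lemma acoord_regular i k : regular f (chart f i) (acoord i k).
Proof.
apply: (regular_eq _ (@dehom_regular _ _ _ f i 'X_k)) => q _.
by rewrite /dehom mevalXU.
Qed.

Lemma theta_regular i k : regular f (chart f i) (theta i k).
Proof. by apply: td_regular => //; [exact: open_chart | exact: acoord_regular]. Qed.

Lemma theta_diag i p : chart f i p -> theta i i p = 0.
Proof.
move=> ip; have oV := open_chart f i.
rewrite /theta (@td_eq _ _ _ _ _ (s i) (chart f i) (fun=> 1) _ p oV) //.
- exact: td_cst.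
- exact: regular_cst.
- by move=> q [_ qi]; rewrite /acoord divff.
Qed.

(** The power of [p ord0 i] turns the local trivialization of the twist into one that
    is independent of [i]; the vector is taken modulo the Euler field. *)
Definition bivec i a b p : K :=
  p ord0 i ^ (m + 1) * (theta i a p * p ord0 b - theta i b p * p ord0 a).

(** From the chart [i] to [j], the vector of coordinates changes by a factor and by a
    multiple of the Euler field, which the wedge product cancels. *)
Lemma bivec_chart i j a b p : chart f i p -> chart f j p ->
  bivec i a b p = bivec j a b p.
Proof.
move=> ip jp; have [[fp pi0] [_ pj0]] := (ip, jp).
pose V := chart f i `&` chart f j.
have oi := open_chart f i; have oj := open_chart f j.
have oV : zariski_open f V by exact: open_setI.
have Vi : V `<=` chart f i by move=> q [].
have Vj : V `<=` chart f j by move=> q [].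
have Vp : V p by split.
have ri k : regular f V (acoord i k) by exact: (regular_sub oV Vi (@acoord_regular i k)).
have rj k : regular f V (acoord j k) by exact: (regular_sub oV Vj (@acoord_regular j k)).
have thi k : s i V (acoord i k) p = theta i k p.
  by apply: td_sub => //; exact: acoord_regular.
have thj k : s j V (acoord j k) p = theta j k p.
  by apply: td_sub => //; exact: acoord_regular.
have glue k : theta i k p * p ord0 i ^ m = s j V (acoord i k) p * p ord0 j ^ m.
  by rewrite -thi; apply: (tw_glue s (V := V)).
have leib k : theta j k p =
    s j V (acoord i k) p * acoord j i p + acoord i k p * theta j i p.
  rewrite -!thj -(td_leibniz (s j) oV Vj (ri k) (rj i) Vp).
  apply: td_eq => //; first exact: regularM.
  by move=> q [[_ qi] [_ qj]]; rewrite /acoord; field; rewrite qi qj.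
have xi0 : p ord0 i ^ m != 0 by rewrite expfz_neq0.
have xj0 : p ord0 j ^ m != 0 by rewrite expfz_neq0.
have sjE k : s j V (acoord i k) p = theta i k p * p ord0 i ^ m / p ord0 j ^ m.
  by rewrite glue mulfK.
rewrite /bivec (leib a) (leib b) !sjE /acoord !expfzDr // !expr1z.
set X := _ ^ m in xi0 *; set Y := _ ^ m in xj0 *.
by field; rewrite xj0 pi0 pj0.
Qed.

Lemma bivec_scale i a b p (t : K) : t != 0 -> chart f i p ->
  bivec i a b (t *: p) = t ^ (m + 2) * bivec i a b p.
Proof.
move=> t0 ip; rewrite /bivec.
rewrite !(regularZ fhom t0 ip (@theta_regular i _)) !mxE expfzMl.
have -> : t ^ (m + 2) = t ^ (m + 1) * t.
  by rewrite -[X in _ * X]expr1z -expfzDr // -addrA.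
by move: (t ^ (m + 1)) (p ord0 i ^ (m + 1)) => T X; ring.
Qed.

(** A derivation maps the function of the equation, which is zero, to zero. *)
Lemma theta_tangent i p j : chart f i p ->
  \sum_k ((f j)^`M(k)).@[p ord0] * theta i k p = 0.
Proof.
move=> ip; have [fp pi0] := ip; have oV := open_chart f i.
have := td_dehom (s i) (f j) (fun q iq => iq) ip.
rewrite (@td_eq _ _ _ _ _ (s i) (chart f i) (fun=> 0) _ p oV) //; first last.
- by move=> q [[_ fq] _]; rewrite (dehomE i _ (fdg j)) fq mul0r.
- exact: regular_cst.
rewrite td_cst // => dE.
have : (p ord0 i ^+ (dg j).-1)^-1 * \sum_k ((f j)^`M(k)).@[p ord0] * theta i k p = 0.
  rewrite [RHS]dE mulr_sumr; apply: eq_bigr => k _.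
  by rewrite (dehomE i _ (mderiv_homog k (fdg j))) mulrA [_^-1 * _]mulrC.
by move/eqP; rewrite mulf_eq0 invr_eq0 expf_eq0 (negPf pi0) andbF => /eqP.
Qed.

Lemma euler_cone p j : cone f p -> \sum_k p ord0 k * ((f j)^`M(k)).@[p ord0] = 0.
Proof.
move=> [_ fp]; transitivity ((f j *+ dg j).@[p ord0]); last first.
  by rewrite mevalMn fp mul0rn.
rewrite -(euler (fdg j)) raddf_sum; apply: eq_bigr => k _.
by rewrite /= mevalM mevalXU.
Qed.

Lemma bivec_tangent i a p j : chart f i p ->
  \sum_k bivec i a k p * ((f j)^`M(k)).@[p ord0] = 0.
Proof.
move=> ip; transitivity (p ord0 i ^ (m + 1) *
  (theta i a p * (\sum_k p ord0 k * ((f j)^`M(k)).@[p ord0]) -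
   p ord0 a * \sum_k ((f j)^`M(k)).@[p ord0] * theta i k p)).
  rewrite !mulr_sumr -sumrB mulr_sumr; apply: eq_bigr => k _.
  by rewrite /bivec; ring.
by rewrite (euler_cone _ (proj1 ip)) theta_tangent // !mulr0 subrr mulr0.
Qed.

Lemma bivec_alt i a p : bivec i a a p = 0.
Proof. by rewrite /bivec subrr mulr0. Qed.

Lemma bivec_anti i a b p : bivec i a b p = - bivec i b a p.
Proof. by rewrite /bivec; ring. Qed.

Lemma bivec_plucker i a b k p :
  p ord0 k * bivec i a b p + p ord0 a * bivec i b k p + p ord0 b * bivec i k a p = 0.
Proof. by rewrite /bivec; ring. Qed.

(** If [bivec i a i p] is zero for all [a], the section kills the affine coordinates
    at [p], and so all quotients of forms. *)
Lemma bivec_neq0 i V phi p : zariski_open f V -> V `<=` chart f i -> regular f V phi ->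
  V p -> s i V phi p != 0 -> exists a, bivec i a i p != 0.
Proof.
move=> oV Vi rphi Vp; apply: contra_neqP => /forallNP bz.
have ip := Vi p Vp; have [fp pi0] := ip.
have th0 k : theta i k p = 0.
  have /negP/negPn/eqP := bz k.
  rewrite /bivec (theta_diag ip) mul0r subr0 => /eqP.
  by rewrite !mulf_eq0 (negPf pi0) orbF (negPf (expfz_neq0 _ pi0)) => /eqP.
have d0 (g : S) : s i (chart f i) (dehom i g) p = 0.
  by rewrite td_dehom // big1 // => k _; rewrite -/(acoord i k) -/(theta i k p) th0 mulr0.
have [W [e [g [h [[oW Wp WV] [hg hh gh]]]]]] := rphi p Vp.
have Wi : W `<=` chart f i by move=> q /WV/Vi.
have rW : regular f W phi by exact: (regular_sub oW WV rphi).
have rd u : regular f W (dehom i u).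
  exact: (regular_sub oW Wi (@dehom_regular _ _ _ f i u)).
have dW u : s i W (dehom i u) p = 0.
  by rewrite (@td_sub _ _ _ f _ (s i) (chart f i)) //; [exact: open_chart | exact: dehom_regular].
have := td_leibniz (s i) oW Wi rW (rd h) Wp.
rewrite dW mulr0 addr0 (@td_eq _ _ _ _ _ (s i) W (dehom i g) _ p oW) //; last first.
  move=> q Wq; have [hq ->] := gh q Wq; have [_ qi] := Wi q Wq.
  by rewrite !(dehomE i _ hg, dehomE i _ hh) mulrA mulfVK.
have dWV : s i W phi p = s i V phi p by apply: td_sub.
rewrite dW dWV => /esym/eqP; rewrite mulf_eq0 (dehomE i _ hh) => /orP[/eqP //|].
have [hp _] := gh p Wp.
by rewrite mulf_eq0 (negPf hp) invr_eq0 expf_eq0 (negPf pi0) andbF.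
Qed.

(** The denominator [B] is made to vanish off the neighbourhood where the coordinates
    of the section are quotients of forms, so that the equation holds on the whole
    cone. *)
Lemma bivec_quot i a b p : chart f i p -> exists B g : S, B.@[p ord0] != 0 /\
  forall q, cone f q -> B.@[q ord0] * (if q ord0 i == 0 then 0 else bivec i a b q) = g.@[q ord0] /\
    (q ord0 i = 0 -> B.@[q ord0] = 0).
Proof.
move=> ip; have [fp pi0] := ip.
have [V1 [e1 [g1 [h1 [[o1 V1p _] [_ _ gh1]]]]]] := @theta_regular i a p ip.
have [V2 [e2 [g2 [h2 [[o2 V2p _] [_ _ gh2]]]]]] := @theta_regular i b p ip.
have [B1 [_ B1p] B1V] := open_nbhs o1 V1p.
have [B2 [_ B2p] B2V] := open_nbhs o2 V2p.
have [r [t mE]] : exists r t : nat, m + 1 = r%:Z - t%:Z.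
  by case: (m + 1) => k; [exists k, 0%N; rewrite subr0 | exists 0%N, k.+1; rewrite sub0r NegzE].
exists (B1 * B2 * 'X_i * (h1 * h2 * 'X_i ^+ t)).
exists (B1 * B2 * 'X_i * 'X_i ^+ r * (g1 * h2 * 'X_b - g2 * h1 * 'X_a)).
have [h1p _] := gh1 p V1p; have [h2p _] := gh2 p V2p.
split; first by rewrite !mevalM rmorphXn /= !mevalXU !mulf_neq0 ?expf_neq0.
move=> q fq; split; last first.
  by move=> qi; rewrite !mevalM mevalXU qi mulr0 mul0r.
have [qi|qi] := eqVneq (q ord0 i) 0.
  by rewrite mulr0 !mevalM mevalXU qi !(mulr0, mul0r).
have [B1q|B1q] := eqVneq B1.@[q ord0] 0; first by rewrite !mevalM B1q !mul0r.
have [B2q|B2q] := eqVneq B2.@[q ord0] 0; first by rewrite !mevalM B2q !(mulr0, mul0r).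
have [h1q th1] := gh1 q (B1V q fq B1q); have [h2q th2] := gh2 q (B2V q fq B2q).
rewrite /bivec mE expfzDr // -exprnN -exprnP th1 th2.
rewrite !(mevalM, mevalB) !rmorphXn /= !mevalXU.
by field; rewrite h1q h2q expf_neq0.
Qed.

End Bivector.

Section Glue.
Variables (K : closedFieldType) (c : nat).
Local Notation m := (3 + c)%N.
Local Notation S := {mpoly K[m]}.
Hypotheses (hK : uncountable K) (hc : (0 < c)%N).
Variables (f : 'I_c -> S) (dg : 'I_c -> nat).
Hypotheses (hf : forall j, f j \is (dg j).-homog) (hdg : forall j, (2 <= dg j)%N).
Hypothesis smooth : forall p : 'rV[K]_m, p != 0 -> (forall j, (f j).@[p ord0] = 0) ->
  row_free (\matrix_(j, k) ((f j)^`M(k)).@[p ord0]).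
Let F := codom f.

Lemma posdeg_equations j : posdeg (f j).
Proof. by exists (dg j) => //; apply: leq_trans (hdg j). Qed.
Let pf := posdeg_equations.

(** The denominators of [gam] form an ideal that contains powers [x] and [y] of two
    parameters. Modulo the equations, [x * g1 = y * g0] for the two numerators, so
    regularity makes [g0] a multiple of [x], and the quotient is [gam]. *)
Lemma glue (gam : 'rV[K]_m -> K) :
  (forall p, on_cone f p -> exists B g : S, B.@[p ord0] != 0 /\
     forall q, on_cone f q -> B.@[q ord0] * gam q = g.@[q ord0]) ->
  exists u : S, forall p, on_cone f p -> gam p = u.@[p ord0].
Proof.
move=> loc; have [L osL] := three_parameters hK pf smooth erefl hc.
have red u : (forall p, on_cone f p -> u.@[p ord0] = 0) -> inI F u.
  move=> u0; apply: (cone_reduced hK pf smooth erefl osL) => p p0 fp.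
  by apply: u0.
pose I : set S := [set v | exists g : S, forall q, on_cone f q -> v.@[q ord0] * gam q = g.@[q ord0]].
have iI : is_ideal I.
  split=> [|u v [g ug] [h vh]|a u [g ug]].
  - by exists 0 => q _; rewrite meval0 mul0r.
  - by exists (g + h) => q cq; rewrite !mevalD mulrDl ug // vh.
  - by exists (a * g) => q cq; rewrite !mevalM -mulrA ug.
have fI j : I (f j) by exists 0 => q [_ fq]; rewrite fq mul0r; exact/esym/meval0.
have ex i : exists k, I (lin (row i L) ^+ k).
  apply: (cone_ideal hK iI fI) => [p p0 fp|]; last first.
    by apply: posdeg_eval0; exact: posdeg_lin.
  have [B [g [Bp Bg]]] := loc p (conj p0 fp).
  by exists B => //; exists g.
have [k kP] := choice ex; set N := (k ord0 + k (inord 1))%N.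
have [g0 g0E] : I (lin (row ord0 L) ^+ N.+1).
  rewrite -(@subnK (k ord0) N.+1) ?exprD; first exact: idealMl.
  by rewrite -addnS leq_addr.
have [g1 g1E] : I (lin (row (inord 1) L) ^+ N.+1).
  rewrite -(@subnK (k (inord 1)) N.+1) ?exprD; first exact: idealMl.
  by rewrite /N -addSn leq_addl.
have [_ [n1 [n0 _]]] := powers_regular hK hf hdg osL N N 0.
set x := _ ^+ _ in g0E n0 n1; set y := _ ^+ _ in g1E n1.
have [|u gu] := n1 g0.
  exists g1; apply: red => q cq; rewrite mevalB !mevalM -g0E // -g1E //.
  by ring.
exists u => p cp; have [B [g [Bp Bg]]] := loc p cp.
have : inI F (g - B * u).
  apply: n0; apply: red => q cq.
  have := inI_cone (proj2 cq) gu; rewrite mevalB mevalM -g0E // => xu.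
  have -> : (x * (g - B * u)).@[q ord0] =
      B.@[q ord0] * (x.@[q ord0] * gam q - u.@[q ord0] * x.@[q ord0]).
    by rewrite !(mevalM, mevalB) -Bg //; ring.
  by rewrite xu mulr0.
move/(inI_cone (proj2 cp)); rewrite mevalB mevalM -Bg // -mulrBr => /eqP.
by rewrite mulf_eq0 (negPf Bp) subr_eq0 => /eqP.
Qed.

End Glue.

Section Foliation.
Variables (K : closedFieldType) (c : nat).
Hypotheses (hK : uncountable K) (hc : (0 < c)%N).
Variables (f : 'I_c -> {mpoly K[c.+2.+1]}) (dg : 'I_c -> nat).
Hypotheses (hf : forall j, f j \is (dg j).-homog) (hdg : forall j, (2 <= dg j)%N).
Hypothesis smooth : forall p, cone f p -> \rank (jacobian f p) = c.

Lemma smooth_row_free (p : 'rV[K]_(3 + c)) : p != 0 -> (forall j, (f j).@[p ord0] = 0) ->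
  row_free (\matrix_(j, k) ((f j)^`M(k)).@[p ord0]).
Proof. by move=> p0 fp; apply/eqP/smooth. Qed.

(** The bivector of the section is glued to forms of degree [m + 2]; a nonzero
    function on the cone cannot have negative degree. *)
Theorem foliation_degree (m : int) (s : twisted_field f m) :
  twisted_field_nonzero s -> ((\sum_j (dg j).-1)%N%:Z < m + 2)%R.
Proof.
move=> [i0 [V0 [phi0 [p0 [oV0 Vi0 r0 Vp0 s0]]]]].
have fh j : exists e, f j \is e.-homog by exists (dg j).
pose gam (a b : 'I_c.+2.+1) (p : 'rV[K]_c.+2.+1) :=
  if [pick i | p ord0 i != 0] is Some i then bivec s i a b p else 0.
have gamE a b p i : chart f i p -> gam a b p = bivec s i a b p.
  move=> ip; rewrite /gam; case: pickP => [j pj|/(_ i)]; last by rewrite (proj2 ip).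
  by apply: bivec_chart => //; split; [case: ip | ].
have chartP p : cone f p -> exists i, chart f i p.
  move=> fp; have [pn0 _] := fp; suff [i pi] : exists i, p ord0 i != 0 by exists i.
  apply/existsP; apply: contraNT pn0 => /existsPn pz; apply/eqP/rowP => i.
  by rewrite mxE; apply/eqP; have := pz i; rewrite negbK.
have gl a b : exists u : {mpoly K[3 + c]}, forall p, on_cone f p -> gam a b p = u.@[p ord0].
  apply: (glue hK hc hf hdg smooth_row_free) => p fp.
  have [i ip] := chartP p fp.
  have [B [g [Bp Bg]]] := bivec_quot s a b ip; exists B, g; split=> // q fq.
  have [<- B0] := Bg q fq; case: eqP => [/B0 ->|/eqP qi]; first by rewrite !mul0r.
  by rewrite (gamE _ _ _ i).
have [u uP] := choice (fun ab : 'I_c.+2.+1 * 'I_c.+2.+1 => gl ab.1 ab.2).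
have hcomp_gam a b p : cone f p ->
    gam a b p = if m + 2 is Posz e then (pihomog mdeg e (u (a, b))).@[p ord0] else 0.
  move=> fp; apply: cone_hcomp => t t0; rewrite -(uP (a, b)); last exact: (coneZ fh t0 fp).
  have [i ip] := chartP p fp.
  have itp : chart f i (t *: p).
    by have [_ pi] := ip; split; [exact: (coneZ fh) | rewrite mxE mulf_neq0].
  by rewrite (gamE _ _ _ i) // (gamE _ _ _ i ip) (bivec_scale hf).
have ip0 := Vi0 p0 Vp0; have [fp0 _] := ip0.
have [a0 ga0] := bivec_neq0 oV0 Vi0 r0 Vp0 s0.
case: (m + 2) hcomp_gam => e hg; last first.
  by move: ga0; rewrite -(gamE _ _ _ _ ip0) hg // eqxx.
pose G : 'M[{mpoly K[3 + c]}]_(3 + c) := \matrix_(a, b) pihomog mdeg e (u (a, b)).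
have GE a b p : cone f p -> (G a b).@[p ord0] = gam a b p by move=> fp; rewrite mxE -hg.
rewrite ltz_nat; apply: (bivector_degree hK hc hf hdg smooth_row_free (G := G)).
- by move=> a b; rewrite mxE; exact: pihomogP.
- move=> p fp a; rewrite GE //; have [i ip] := chartP p fp.
  by rewrite (gamE _ _ _ i) // bivec_alt.
- move=> p fp a b; rewrite !GE //; have [i ip] := chartP p fp.
  by rewrite !(gamE _ _ _ i) // bivec_anti.
- move=> p fp a q; have [i ip] := chartP p fp.
  rewrite -[RHS](bivec_tangent hf s a q ip); apply: eq_bigr => b _.
  by rewrite GE // (gamE _ _ _ i).
- move=> p fp a b k; rewrite !GE //; have [i ip] := chartP p fp.
  by rewrite !(gamE _ _ _ i) // bivec_plucker.
exists p0, a0, i0; split=> //.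
by rewrite GE // (gamE _ _ _ i0).
Qed.

End Foliation.

(** * Foliations defined by homogeneous vector fields *)

Section VectorField.
Variables (K : closedFieldType) (n c : nat).
Variable f : 'I_c -> {mpoly K[n.+1]}.
Local Notation S := {mpoly K[n.+1]}.
Local Notation P := 'rV[K]_n.+1.
Hypothesis reduced : forall u : S, (forall p, cone f p -> u.@[p ord0] = 0) -> inI (codom f) u.
Variables (e : nat) (a : 'I_n.+1 -> S).
Hypothesis ha : forall k, a k \is (e.+1).-homog.
Implicit Types (u v g h : S) (p q : P) (phi psi : P -> K) (V W : set P).

Definition vder u : S := \sum_k a k * u^`M(k).

Hypothesis tangent : forall j p, cone f p -> (vder (f j)).@[p ord0] = 0.

Lemma vderB u v : vder (u - v) = vder u - vder v.
Proof. by rewrite -sumrB; apply: eq_bigr => k _; rewrite mderivB mulrBr. Qed.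

Lemma vderD u v : vder (u + v) = vder u + vder v.
Proof. by rewrite -big_split; apply: eq_bigr => k _; rewrite mderivD mulrDr. Qed.

Lemma vderM u v : vder (u * v) = vder u * v + u * vder v.
Proof.
rewrite mulr_suml mulr_sumr -big_split; apply: eq_bigr => k _.
by rewrite mderivM /=; ring.
Qed.

Lemma vderZ (t : K) u : vder (t *: u) = t *: vder u.
Proof. by rewrite scaler_sumr; apply: eq_bigr => k _; rewrite mderivZ scalerAr. Qed.

Lemma vder_homog d u : u \is d.-homog -> vder u \is (d + e).-homog.
Proof.
case: d => [|d] hu.
  rewrite /vder big1 ?rpred0 // => k _.
  by rewrite (msize1_polyC (homog_msize_le hu)) mderivC mulr0.
apply: rpred_sum => k _; rewrite addSnnS addnC.
by apply: dhomogM => //; exact: mderiv_homog k hu.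
Qed.

(** Since the cone is reduced, a field tangent to the equations preserves the ideal
    of all polynomials that vanish on the cone. *)
Lemma vder_cone u : (forall p, cone f p -> u.@[p ord0] = 0) ->
  forall p, cone f p -> (vder u).@[p ord0] = 0.
Proof.
move=> u0 p fp; have /inI_codom[w ->] := reduced u0.
have -> : vder (\sum_j w j * f j) = \sum_j vder (w j * f j).
  elim/big_rec2: _ => [|j x y _ <-]; last by rewrite vderD.
  by rewrite /vder big1 // => k _; rewrite mderiv0 mulr0.
rewrite raddf_sum big1 // => j _; rewrite /= vderM mevalD !mevalM tangent //.
by case: fp => _ ->; rewrite !mulr0 addr0.
Qed.

Definition local_quot p phi (gh : S * S) : Prop :=
  exists V d, [/\ zariski_open f V, V p, gh.1 \is d.-homog, gh.2 \is d.-homog &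
    forall q, V q -> gh.2.@[q ord0] != 0 /\ phi q = gh.1.@[q ord0] / gh.2.@[q ord0]].

Definition quot_der (gh : S * S) p : K :=
  (vder gh.1 * gh.2 - gh.1 * vder gh.2).@[p ord0] / gh.2.@[p ord0] ^+ 2.

Definition germ_der p phi : K := quot_der (xget (0, 0) [set gh | local_quot p phi gh]) p.

(** The quotient rule does not depend on the fraction: the difference of two cross
    products vanishes on the cone after multiplication by a form [B] supported in
    the common neighbourhood, and [vder_cone] applies to the product. *)
Lemma quot_der_eq p phi gh gh' : local_quot p phi gh -> local_quot p phi gh' ->
  quot_der gh p = quot_der gh' p.
Proof.
case: gh gh' => [g h] [g' h'] [V [d [oV Vp /= hg hh gh]]] [V' [d' [oV' V'p /= hg' hh' gh']]].
have [hp pE] := gh p Vp; have [h'p pE'] := gh' p V'p.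
have [B [_ Bp] BV] := open_nbhs (open_setI oV oV') (conj Vp V'p).
have u0 q : cone f q -> ((g * h' - g' * h) * B).@[q ord0] = 0.
  move=> fq; have [Bq|Bq] := eqVneq B.@[q ord0] 0; first by rewrite mevalM Bq mulr0.
  have [Vq V'q] := BV q fq Bq; have [hq qE] := gh q Vq; have [h'q qE'] := gh' q V'q.
  have gE : g.@[q ord0] = phi q * h.@[q ord0] by rewrite qE divfK.
  have gE' : g'.@[q ord0] = phi q * h'.@[q ord0] by rewrite qE' divfK.
  by rewrite !(mevalM, mevalB) gE gE'; ring.
have gE : g.@[p ord0] = phi p * h.@[p ord0] by rewrite pE divfK.
have gE' : g'.@[p ord0] = phi p * h'.@[p ord0] by rewrite pE' divfK.
have /eqP := vder_cone u0 (open_cone oV Vp).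
rewrite vderM vderB !vderM !(mevalM, mevalN, mevalD) gE gE'.
set x := (vder g).@[_]; set y := (vder h).@[_]; set x' := (vder g').@[_]; set y' := (vder h').@[_].
set z := h.@[_] in hp *; set z' := h'.@[_] in h'p *; set b := B.@[_] in Bp *.
set w := phi p.
have -> : phi p * z * z' - phi p * z' * z = 0 by ring.
rewrite mul0r addr0 mulf_eq0 (negPf Bp) orbF => /eqP xy.
rewrite /quot_der /= !(mevalM, mevalB) -/x -/y -/x' -/y' -/z -/z' gE gE' -/z -/z' -/w.
have xE : x * z' = w * z' * y + x' * z - w * z * y'.
  by apply/eqP; rewrite -subr_eq0 -[X in _ == X]xy; apply/eqP; rewrite -/w; ring.
apply: (mulfI (mulf_neq0 (expf_neq0 2 hp) (expf_neq0 2 h'p))).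
have -> : z ^+ 2 * z' ^+ 2 * ((x * z - w * z * y) / z ^+ 2) = z * z' * (x * z') - w * z * z' ^+ 2 * y.
  by field.
by rewrite xE; field.
Qed.

Lemma germ_derE p phi gh : local_quot p phi gh -> germ_der p phi = quot_der gh p.
Proof.
move=> lgh; apply: (quot_der_eq (phi := phi)) => //.
by apply: (@xgetPex _ (0, 0) [set gh | local_quot p phi gh]); exists gh.
Qed.

Lemma regular_local V phi p : regular f V phi -> V p -> exists gh, local_quot p phi gh.
Proof.
move=> r Vp; have [W [d [g [h [[oW Wp _] [hg hh gh]]]]]] := r p Vp.
by exists (g, h), W, d.
Qed.

Lemma local_quot_eq V p phi psi gh : zariski_open f V -> V p ->
  (forall q, V q -> psi q = phi q) -> local_quot p phi gh -> local_quot p psi gh.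
Proof.
move=> oV Vp pp [W [d [oW Wp hg hh gE]]]; exists (W `&` V), d; split=> //.
- exact: open_setI.
- by move=> q [/gE[hq qE] Vq]; rewrite pp.
Qed.

Section Chart.
Variable i : 'I_n.+1.

(** A field with coordinates of degree [e + 1] raises the degree of a quotient of
    forms by [e]; the power of the coordinate brings it back to zero. *)
Definition vtd V phi p : K := germ_der p phi / p ord0 i ^+ e.

Lemma vtd_regular V phi : zariski_open f V -> V `<=` chart f i ->
  regular f V phi -> regular f V (vtd V phi).
Proof.
move=> oV Vi r p Vp; have [W [d [g [h [[oW Wp WV] [hg hh gh]]]]]] := r p Vp.
exists W, (d + d + e)%N, (vder g * h - g * vder h), (h * h * 'X_i ^+ e); split=> //.
split.
- apply: rpredB; first by rewrite addnAC; apply: dhomogM => //; exact: vder_homog.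
  by rewrite -addnA; apply: dhomogM => //; exact: vder_homog.
- apply: dhomogM; first exact: dhomogM.
  by have := @dhomogMn _ _ mdeg 1 ('X_i : S) e; rewrite mul1n; apply; rewrite dhomogX /= mdeg1.
move=> q Wq; have [hq _] := gh q Wq; have [_ qi] := Vi q (WV q Wq).
rewrite !mevalM rmorphXn /= mevalXU !mulf_neq0 ?expf_neq0 //; split=> //.
rewrite /vtd (germ_derE (gh := (g, h))); last by exists W, d.
by rewrite /quot_der /= expr2 -[LHS]mulrA -invfM.
Qed.

Lemma vtd_local V W phi psi : zariski_open f V -> zariski_open f W -> W `<=` V ->
  V `<=` chart f i -> regular f V phi -> regular f W psi ->
  (forall p, W p -> psi p = phi p) -> forall p, W p -> vtd W psi p = vtd V phi p.
Proof.
move=> oV oW WV Vi r r' pp p Wp; have [gh ghP] := regular_local r (WV p Wp).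
by rewrite /vtd (germ_derE ghP) (germ_derE (local_quot_eq oW Wp pp ghP)).
Qed.

Lemma vtd_linear V (t : K) phi psi : zariski_open f V -> V `<=` chart f i ->
  regular f V phi -> regular f V psi -> forall p, V p ->
  vtd V (fun q => t * phi q + psi q) p = t * vtd V phi p + vtd V psi p.
Proof.
move=> oV Vi r r' p Vp; have [[g h] lgh] := regular_local r Vp.
have [[g' h'] lgh'] := regular_local r' Vp.
rewrite /vtd (germ_derE lgh) (germ_derE lgh') (germ_derE (gh := (t *: g * h' + g' * h, h * h'))).
  move: lgh lgh' => [W [d [_ Wp _ _ gh]]] [W' [d' [_ W'p _ _ gh']]].
  have [hp _] := gh p Wp; have [h'p _] := gh' p W'p; move: hp h'p => /= hp h'p.
  have [_ pi0] := Vi p Vp.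
  rewrite /quot_der /= vderD !vderM vderZ !(mevalM, mevalN, mevalD, mevalZ).
  by field; rewrite expf_neq0 // hp h'p.
move: lgh lgh' => [W [d [oW Wp /= hg hh gh]]] [W' [d' [oW' W'p /= hg' hh' gh']]].
exists (W `&` W'), (d + d')%N; split=> /=.
- exact: open_setI.
- by split.
- by apply: rpredD; [apply: dhomogM => //; exact: rpredZ | rewrite addnC; apply: dhomogM].
- exact: dhomogM.
move=> q [/gh[hq ->] /gh'[h'q ->]]; rewrite !(mevalM, mevalD, mevalZ) mulf_neq0 //.
by split=> //; field; rewrite hq h'q.
Qed.

Lemma vtd_leibniz V phi psi : zariski_open f V -> V `<=` chart f i ->
  regular f V phi -> regular f V psi -> forall p, V p ->
  vtd V (fun q => phi q * psi q) p = vtd V phi p * psi p + phi p * vtd V psi p.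
Proof.
move=> oV Vi r r' p Vp; have [[g h] lgh] := regular_local r Vp.
have [[g' h'] lgh'] := regular_local r' Vp.
rewrite /vtd (germ_derE lgh) (germ_derE lgh') (germ_derE (gh := (g * g', h * h'))).
  move: lgh lgh' => [W [d [_ Wp _ _ gh]]] [W' [d' [_ W'p _ _ gh']]].
  have [hp ->] := gh p Wp; have [h'p ->] := gh' p W'p; move: hp h'p => /= hp h'p.
  have [_ pi0] := Vi p Vp.
  rewrite /quot_der /= !vderM !(mevalM, mevalN, mevalD).
  by field; rewrite expf_neq0 // hp h'p.
move: lgh lgh' => [W [d [oW Wp /= hg hh gh]]] [W' [d' [oW' W'p /= hg' hh' gh']]].
exists (W `&` W'), (d + d')%N; split=> /=.
- exact: open_setI.
- by split.
- exact: dhomogM.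
- exact: dhomogM.
move=> q [/gh[hq ->] /gh'[h'q ->]]; rewrite !mevalM mulf_neq0 //.
by split=> //; rewrite mulf_div.
Qed.

Definition vector_tangent_field : tangent_field f (chart f i) :=
  TangentField vtd_regular vtd_local vtd_linear vtd_leibniz.

End Chart.

Lemma vector_glue (i j : 'I_n.+1) V phi : zariski_open f V ->
  V `<=` chart f i `&` chart f j -> regular f V phi -> forall p, V p ->
  vector_tangent_field i V phi p * p ord0 i ^ (e%:Z) =
  vector_tangent_field j V phi p * p ord0 j ^ (e%:Z).
Proof.
move=> oV Vij r p Vp; have [[_ pi0] [_ pj0]] := Vij p Vp.
by rewrite -!exprnP /= /vtd !divfK ?expf_neq0.
Qed.

Definition vector_twisted_field : twisted_field f e%:Z := TwistedField vector_glue.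

(** The derivative of [x_k / x_i] is a coordinate of the wedge product with the Euler
    field. *)
Lemma vector_twisted_neq0 p (i k : 'I_n.+1) : chart f i p ->
  (a k).@[p ord0] * p ord0 i != p ord0 k * (a i).@[p ord0] ->
  twisted_field_nonzero vector_twisted_field.
Proof.
move=> ip ak; have [fp pi0] := ip.
exists i, (chart f i), (acoord i k), p; split=> //.
- exact: open_chart.
- exact: acoord_regular.
have vX l : vder 'X_l = a l.
  rewrite /vder (bigD1 l) //= big1 ?addr0 => [|x xl].
    by rewrite mderivX mnm1E eqxx scale1r -{1}[U_(l)%MM]add0m addmK mpolyX0 mulr1.
  by rewrite mderivX mnm1E eq_sym (negPf xl) scale0r mulr0.
rewrite /= /vtd (germ_derE (gh := ('X_k, 'X_i))).
  rewrite /quot_der /= !vX mevalB !mevalM !mevalXU !mulf_neq0 ?invr_eq0 ?expf_neq0 //.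
  by rewrite subr_eq0.
exists (chart f i), 1%N; split=> //=.
- exact: open_chart.
- by rewrite dhomogX /= mdeg1.
- by rewrite dhomogX /= mdeg1.
by move=> q [_ qi]; rewrite !mevalXU.
Qed.

End VectorField.

(** * The converse for surfaces in space *)

Section Surface.
Variable K : closedFieldType.
Hypothesis hK : uncountable K.
Variables (f : 'I_1 -> {mpoly K[4]}) (dg : 'I_1 -> nat).
Hypotheses (hf : forall j, f j \is (dg j).-homog) (hdg : forall j, (2 <= dg j)%N).
Hypothesis smooth : forall p, cone f p -> \rank (jacobian f p) = 1%N.
Local Notation F := (f ord0).
Local Notation D := (dg ord0).

Lemma surface_reduced (u : {mpoly K[4]}) :
  (forall p, cone f p -> u.@[p ord0] = 0) -> inI (codom f) u.
Proof.
move=> u0; have sm := smooth_row_free smooth.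
have pf := posdeg_equations hf hdg.
have [L osL] := three_parameters hK pf sm erefl (ltn0Sn 0).
apply: (cone_reduced hK pf sm erefl osL) => p p0 fp.
by apply: u0.
Qed.

Lemma surface_point : exists p, cone f p.
Proof.
have pf := posdeg_equations hf hdg.
have [L osL] := three_parameters hK pf (smooth_row_free smooth) erefl (ltn0Sn 0).
by have [p p0 fp] := cone_nonempty hK pf erefl osL; exists p.
Qed.

Lemma surface_gradient p : cone f p -> exists i, (F^`M(i)).@[p ord0] != 0.
Proof.
move=> fp; apply: contrapT => /forallNP dz.
have := smooth fp; have -> : jacobian f p = 0.
  apply/matrixP => j i; rewrite !mxE (ord1 j); apply/eqP/negPn/negP/dz.
by rewrite mxrank0.
Qed.

(** The field [F_i D_j - F_j D_i] annihilates [F]. Where [F_i] is nonzero, Euler's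
    relation gives a coordinate [x_s] with [s] distinct from [i] that is nonzero too;
    with [j] distinct from both, the derivative of [x_j / x_s] is nonzero. The
    power of [x_s] makes up for the degree. *)
Lemma surface_foliation (d : int) : D%:Z <= d + 1 -> has_foliation f (1 - d).
Proof.
have [p fp] := surface_point; have [i Fi] := surface_gradient fp.
move=> Dd; have [e de] : exists e : nat, d = (e.+1)%:Z.
  by have := hdg ord0; exists (`|d|.-1)%N; lia.
have De : (D <= e.+2)%N by lia.
(* Otherwise [p] is the i-th coordinate point, contradicting Euler's relation. *)
have [s si ps] : exists2 s : 'I_4, s != i & p ord0 s != 0.
  apply: contrapT => /forall2NP noz.
  have pz k : k != i -> p ord0 k = 0.
    by move=> ki; apply/eqP/negPn/negP => pk; case: (noz k).
  have := euler_cone hf ord0 fp; rewrite (bigD1 i) //= big1 ?addr0 => [|k ki].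
    move/eqP; rewrite mulf_eq0 (negPf Fi) orbF => /eqP pi0.
    case: fp => /eqP[]; apply/rowP => k; rewrite mxE.
    by have [->|/pz] := eqVneq k i.
  by rewrite pz ?mul0r.
have [j ji js] : exists2 j : 'I_4, j != i & j != s.
  have /card_gt0P[j] : (0 < #|predC (pred2 i s)|)%N.
    have := cardC (pred2 i s); rewrite card2 card_ord.
    by case: #|predC _| => //; rewrite addn0; case: (i != s).
  by rewrite !inE negb_or => /andP[ji js]; exists j.
pose t := (e.+2 - D)%N.
pose a (k : 'I_4) : {mpoly K[4]} := 'X_s ^+ t *
  (if k == j then F^`M(i) else if k == i then - F^`M(j) else 0).
have hX : ('X_s : {mpoly K[4]}) ^+ t \is t.-homog.
  by have := @dhomogMn _ _ mdeg 1 ('X_s : {mpoly K[4]}) t; rewrite mul1n; apply; rewrite dhomogX /= mdeg1.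
have ha k : a k \is (e.+1).-homog.
  have te : e.+1 = (t + D.-1)%N by have := hdg ord0; rewrite /t; lia.
  rewrite te; apply: dhomogM => //.
  case: ifP => _; first exact: mderiv_homog.
  by case: ifP => _; [rewrite dhomogN; exact: mderiv_homog | exact: dhomog0].
have tang q x : cone f x -> (vder a (f q)).@[x ord0] = 0.
  move=> _; rewrite (ord1 q) /vder (bigD1 j) //= (bigD1 i) /=; last by rewrite eq_sym.
  rewrite big1 ?addr0 => [|k /andP[kj ki]].
    rewrite /a eqxx [i == j]eq_sym (negPf ji) eqxx (_ : _ + _ = 0) ?meval0 //.
    by ring.
  by rewrite /a (negPf kj) (negPf ki) mulr0 mul0r.
have -> : 1 - d = - (e%:Z) by lia.
rewrite /has_foliation opprK.
exists (vector_twisted_field surface_reduced ha tang).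
apply: (@vector_twisted_neq0 _ _ _ _ _ _ _ _ _ p s j); first by split.
rewrite /a eqxx [s == j]eq_sym (negPf js) (negPf si) mulr0 meval0 mulr0.
by rewrite mevalM rmorphXn /= mevalXU !mulf_neq0 ?expf_neq0.
Qed.

End Surface.

(** * Complex coefficients *)

Section Complex.
Variable R : realType.

(** Remove the points one at a time: the first or the last third of an interval
    misses a given point. *)
Lemma interval_avoid (s : seq R) (x y : R) : x < y ->
  exists x' y', [/\ x' < y', x <= x', y' <= y & forall z, z \in s -> ~~ (x' <= z <= y')].
Proof.
elim: s x y => [|z s IH] x y xy; first by exists x, y.
have [x1 [y1 [xy1 xx1 yy1 zP]]] : exists x1 y1,
    [/\ x1 < y1, x <= x1, y1 <= y & ~~ (x1 <= z <= y1)].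
  pose h := (y - x) / 3.
  have h0 : 0 < h by rewrite divr_gt0 // subr_gt0.
  have yE : y = x + h + h + h by rewrite /h; field.
  have [zx|xz] := ltP z (x + h + h).
    exists (x + h + h), y; split=> //; rewrite ?yE ?ltrDl ?lerD2r //.
      by rewrite -addrA lerDl ltW // addr_gt0.
    by rewrite negb_and -ltNge zx.
  exists x, (x + h); rewrite ltrDl h0 lexx yE -!addrA lerD2l lerDl.
  rewrite ltW ?addr_gt0 //; split=> //.
  by rewrite negb_and -!ltNge orbC (lt_le_trans _ xz) // ltrDl.
have [x2 [y2 [xy2 xx2 yy2 sP]]] := IH x1 y1 xy1.
exists x2, y2; split=> //; [exact: le_trans xx2 | exact: le_trans yy1 |].
move=> w; rewrite inE => /predU1P[->|/sP//].
apply: contra zP => /andP[x2z zy2].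
by rewrite (le_trans xx2 x2z) (le_trans zy2 yy2).
Qed.

(** Cantor's argument: a point common to a nested sequence of intervals, the [k]-th
    step of which avoids [F k]. *)
Lemma real_uncountable (F : nat -> seq R) : exists x, forall k, x \notin F k.
Proof.
have step (u : nat * (R * R)) : exists v : R * R, u.2.1 < u.2.2 ->
    [/\ v.1 < v.2, u.2.1 <= v.1, v.2 <= u.2.2 & forall z, z \in F u.1 -> ~~ (v.1 <= z <= v.2)].
  have [lt|ge] := ltP u.2.1 u.2.2; last by exists (0, 0).
  by have [x [y xyP]] := interval_avoid (F u.1) lt; exists (x, y).
have [next nextP] := choice step.
pose I := fix I k : R * R := if k is k'.+1 then next (k', I k') else (0, 1).
have Ilt k : (I k).1 < (I k).2.
  by elim: k => [|k IH] /=; [exact: ltr01 | case: (nextP (k, I k) IH)].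
have IS k := nextP (k, I k) (Ilt k).
have mono k l : (k <= l)%N -> (I k).1 <= (I l).1 /\ (I l).2 <= (I k).2.
  elim: l => [|l IH]; first by rewrite leqn0 => /eqP ->.
  rewrite leq_eqVlt => /predU1P[->//|]; rewrite ltnS => /IH[kl lk].
  have [_ l1 l2 _] := IS l; split; first exact: le_trans kl l1.
  exact: le_trans l2 lk.
pose E : set R := [set x | exists k, x = (I k).1].
have ubE k : ubound E (I k).2.
  move=> _ [l ->]; have [kl|lk] := leqP k l.
    by apply: le_trans (ltW (Ilt l)) _; case: (mono k l kl).
  apply: le_trans (ltW (Ilt k)); by case: (mono l k (ltnW lk)).
exists (sup E) => k; have [_ _ _ FP] := IS k.
apply/negP => /FP; rewrite negb_and => /orP[|]; apply/negP; rewrite negbK.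
  by apply: ub_le_sup; [exists (I 0%N).2; exact: ubE | exists k.+1].
by apply: ge_sup; [exists (I 0%N).1; exists 0%N | exact: (ubE k.+1)].
Qed.

Lemma complex_uncountable : uncountable (R[i] : closedFieldType).
Proof.
move=> F; have [x xP] := real_uncountable (fun k => map (@complex.Re R) (F k)).
by exists (x%:C)%C => k; apply: contra (xP k) => xF; apply/mapP; exists (x%:C)%C.
Qed.

End Complex.

(** * The bound on the degree of the surface *)

Lemma amgm_bound (c : nat) (dg : 'I_c -> nat) (d : int) : (0 < c)%N ->
  (\sum_j (dg j).-1)%N%:Z <= d -> (forall j, (0 < dg j)%N) ->
  (ci_degree dg)%:R <= ((d + (c.+2)%:Z - 2)%:~R / c%:R) ^+ c :> rat.
Proof.
move=> c0 sd hdg.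
have agm := (leif_AGM (A := 'I_c) (E := fun j => (dg j)%:R : rat) (fun j _ => ler0n _ _)).1.
rewrite card_ord -natr_prod -natr_sum in agm.
apply: le_trans agm _; rewrite lerXn2r ?nnegrE ?divr_ge0 ?ler0n //.
  by rewrite ler0z; lia.
rewrite ler_pM2r ?invr_gt0 ?ltr0n // -[X in X <= _]/((\sum_j dg j)%N%:Z%:~R) ler_int.
have -> : (\sum_j dg j = \sum_j (dg j).-1 + c)%N.
  rewrite -[X in (_ + X)%N](card_ord c) -sum1_card -big_split.
  by apply: eq_bigr => j _ /=; rewrite addn1 prednK.
by lia.
Qed.

Theorem corollary2p3 (R : realType) (n c : nat) (dg : 'I_c -> nat)
    (f : 'I_c -> {mpoly R[i][n.+1]}) (d : int)
    (hn : (3 <= n)%N) (hc : c = (n - 2)%N)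
    (hdg : forall j, (2 <= dg j)%N)
    (hX : smooth_complete_intersection dg f) :
  (has_foliation f (1 - d) ->
     (ci_degree dg)%:R <= ((d + n%:Z - 2)%:~R / c%:R) ^+ c :> rat) /\
  (n = 3%N -> (ci_degree dg)%:Z <= d + 1 -> has_foliation f (1 - d)).
Proof.
case: n f hn hc hX => [|[|n]] // f hn; rewrite !subSS subn0 => nc; subst n.
case=> hf smooth; have hK := @complex_uncountable R.
have c0 : (0 < c)%N by [].
split=> [[s s0]|n3].
  have := foliation_degree hK c0 hf hdg smooth s0 => sd.
  apply: amgm_bound => // [|j]; last by apply: leq_trans (hdg j).
  by move: sd; lia.
have c1 : c = 1%N by case: n3.
subst c => Dd; apply: (surface_foliation hK hf hdg smooth).
by move: Dd; rewrite /ci_degree big_ord1.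
Qed.
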